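(* There exists a deterministic algorithm that, given an unweighted undirected graph $G=(V,E)$ with $n=|V|$ and $m=|E|$, constructs a $4$-additive spanner of $G$ with $\tilde{O}(n^{7/5})$ edges in $\tilde{O}(\min\{mn^{3/5}, n^{11/5}\})$ time.
   Context: For an unweighted undirected graph $G=(V,E)$, a $k$-additive spanner is a subgraph $H=(V,E')$ with $E'\subseteq E$ such that $\mathrm{dist}_H(u,v)\le \mathrm{dist}_G(u,v)+k$ for all $u,v\in V$. The notation $\tilde{O}(\cdot)$ hides polylogarithmic factors in $n$. *)

(* Defs.v *)
From mathcomp Require Import all_boot all_order all_algebra.
From mathcomp Require Import boolp classical_sets reals constructive_ereal ereal exp.

Set Implicit Arguments.
Unset Strict Implicit.
Unset Printing Implicit Defensive.

Import Order.TTheory GRing.Theory Num.Theory.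

(** * Graphs and additive spanners *)

(* A graph on the vertex set {0, ..., n-1} is given by its edge set, each edge
   being the unordered pair of its two (distinct) endpoints. *)
Definition is_graph n (E : {set {set 'I_n}}) : Prop :=
  forall e : {set 'I_n}, e \in E -> #|e| = 2.

Definition adj n (E : {set {set 'I_n}}) : rel 'I_n :=
  fun u v => [set u; v] \in E.

(* [dist] takes the value +oo when v is not reachable from u. *)
Definition dist (R : realType) n (E : {set {set 'I_n}}) (u v : 'I_n) : \bar R :=
  ereal_inf (fun x : \bar R => exists p : seq 'I_n,
    [/\ path (adj E) u p, last u p = v & x = ((size p)%:R%:E)%R]).

Definition additive_spanner (R : realType) n (k : nat)
    (E E' : {set {set 'I_n}}) : Prop :=
  E' \subset E /\
  forall u v : 'I_n, (dist R E' u v <= dist R E u v + k%:R%:E)%E.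

(** * A word RAM *)

(* The memory consists of arrays of natural numbers; [st a i] is the content of
   cell i of array a.  A program text mentions finitely many arrays, so this is
   a RAM whose memory is split into a fixed number of segments.  A scalar
   variable is cell 0 of an array. *)
Definition store := nat -> nat -> nat.

Definition update (st : store) (a i x : nat) : store :=
  fun b j => if (b == a) && (j == i) then x else st b j.

Inductive binop := Add | Sub | Mul | Div | Lt | Eq.

(* [Sub] is truncated, and division by 0 yields 0. *)
Definition binop_eval (o : binop) (x y : nat) : nat :=
  match o with
  | Add => x + y
  | Sub => x - y
  | Mul => x * y
  | Div => x %/ y
  | Lt => x < y
  | Eq => x == y
  end.

Inductive expr :=
  | Const of nat
  | Cell of nat & expr
  | Op of binop & expr & expr.

Definition word (w x : nat) : option nat := if x < 2 ^ w then Some x else None.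

(* All constants, addresses, memory contents read and intermediate results have
   to fit into w bits; evaluation is undefined otherwise. *)
Fixpoint eval (w : nat) (st : store) (e : expr) : option nat :=
  match e with
  | Const c => word w c
  | Cell a e1 => obind (fun i => word w (st a i)) (eval w st e1)
  | Op o e1 e2 =>
      obind (fun x => obind (fun y => word w (binop_eval o x y)) (eval w st e2))
            (eval w st e1)
  end.

Fixpoint ecost (e : expr) : nat :=
  match e with
  | Const _ => 1
  | Cell _ e1 => (ecost e1).+1
  | Op _ e1 e2 => (ecost e1 + ecost e2).+1
  end.

(* [Assign a e1 e2] is the assignment a[e1] := e2. *)
Inductive cmd :=
  | Skip
  | Assign of nat & expr & expr
  | Seq of cmd & cmd
  | If of expr & cmd & cmd
  | While of expr & cmd.

(* [exec w c st st' t]: with word length w, the program c started in the store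
   st halts after t time units in the store st'.  A run in which some value
   overflows a word does not halt. *)
Inductive exec (w : nat) : cmd -> store -> store -> nat -> Prop :=
  | ExecSkip st : exec w Skip st st 1
  | ExecAssign st a e1 e2 i x :
      eval w st e1 = Some i -> eval w st e2 = Some x ->
      exec w (Assign a e1 e2) st (update st a i x) (ecost e1 + ecost e2).+1
  | ExecSeq st st1 st2 c1 c2 t1 t2 :
      exec w c1 st st1 t1 -> exec w c2 st1 st2 t2 ->
      exec w (Seq c1 c2) st st2 (t1 + t2)
  | ExecIfTrue st st1 e c1 c2 x t :
      eval w st e = Some x -> x != 0 -> exec w c1 st st1 t ->
      exec w (If e c1 c2) st st1 (ecost e + t).+1
  | ExecIfFalse st st1 e c1 c2 t :
      eval w st e = Some 0 -> exec w c2 st st1 t ->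
      exec w (If e c1 c2) st st1 (ecost e + t).+1
  | ExecWhileTrue st st1 st2 e c x t1 t2 :
      eval w st e = Some x -> x != 0 ->
      exec w c st st1 t1 -> exec w (While e c) st1 st2 t2 ->
      exec w (While e c) st st2 (ecost e + t1 + t2).+1
  | ExecWhileFalse st e c :
      eval w st e = Some 0 ->
      exec w (While e c) st st (ecost e).+1.

Lemma exec_deterministic w c st st1 st2 t1 t2 :
  exec w c st st1 t1 -> exec w c st st2 t2 -> st1 = st2 /\ t1 = t2.
Proof.
move=> H; elim: H st2 t2 => {c st st1 t1}.
- by move=> st st2 t2 H; inversion H.
- move=> st a e1 e2 i x h1 h2 st2 t2 H; inversion H; subst.
  by split=> //; congr (update _ _ _ _); congruence.
- move=> st st1 st' c1 c2 t1 t2 _ IH1 _ IH2 st2 t H; inversion H; subst.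
  match goal with h : exec w c1 _ _ _ |- _ => case: (IH1 _ _ h) => ? ? end.
  subst; match goal with h : exec w c2 _ _ _ |- _ =>
    by case: (IH2 _ _ h) => -> -> end.
- move=> st st1 e c1 c2 x t h xn _ IH st2 t2 H; inversion H; subst.
    by match goal with h : exec w c1 _ _ _ |- _ => case: (IH _ _ h) => -> -> end.
  by move: xn; have -> : x = 0 by congruence.
- move=> st st1 e c1 c2 t h _ IH st2 t2 H; inversion H; subst.
    by match goal with h : is_true (?x != 0) |- _ =>
      move: h; have -> : x = 0 by congruence end.
  by match goal with h : exec w c2 _ _ _ |- _ => case: (IH _ _ h) => -> -> end.
- move=> st st1 st' e c x t1 t2 h xn _ IH1 _ IH2 st2 t H; inversion H; subst.
    match goal with h : exec w c _ _ _ |- _ => case: (IH1 _ _ h) => ? ? end.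
    subst; match goal with h : exec w (While _ _) ?s _ _, _ : exec w c _ ?s _ |- _ =>
      by case: (IH2 _ _ h) => -> -> end.
  by move: xn; have -> : x = 0 by congruence.
- move=> st e c h st2 t H; inversion H; subst => //.
  by match goal with h : is_true (?x != 0) |- _ =>
    move: h; have -> : x = 0 by congruence end.
Qed.

(** * Graphs as inputs and outputs *)

(* s lists every edge of E exactly once, in one of its two orientations and in
   an arbitrary order. *)
Definition edge_list n (E : {set {set 'I_n}}) (s : seq ('I_n * 'I_n)) : Prop :=
  perm_eq [seq [set p.1; p.2] | p <- s] (enum E).

(* Input format: n and m in cell 0 of arrays 0 and 1, the endpoints of the i-th
   edge in cell i of arrays 2 and 3; all other cells are 0. *)
Definition input n (s : seq ('I_n * 'I_n)) : store := fun a i =>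
  match a with
  | 0 => if i == 0 then n else 0
  | 1 => if i == 0 then size s else 0
  | 2 => nth 0 [seq val p.1 | p <- s] i
  | 3 => nth 0 [seq val p.2 | p <- s] i
  | _ => 0
  end.

(* Output format: as the input format, with arrays 1, 2 and 3; what the other
   cells contain is irrelevant. *)
Definition outputs (st : store) n (s : seq ('I_n * 'I_n)) : Prop :=
  st 1 0 = size s /\
  forall i, i < size s ->
    st 2 i = nth 0 [seq val p.1 | p <- s] i /\
    st 3 i = nth 0 [seq val p.2 | p <- s] i.

(* Logarithm of n, shifted so that it is at least 1 for every n. *)
Definition lg (n : nat) : nat := trunc_log 2 n.+2.

(* Main.v *)
(* Let q be the least integer with q^5 >= n.  If m <= q^7, the graph itself is
   output.  Otherwise vertices are clustered greedily around centres with a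
   threshold T: a vertex with at least T unclustered neighbours becomes the
   centre of a cluster of these neighbours, so there are at most n/T centres.
   The edges with an unclustered endpoint and those joining a vertex to its
   centre number at most nT + n; the others are called missing.

   For T = q^4 and then T = q^3, breadth-first trees from all centres are put
   into the spanner and the missing edges are dropped from the graph: a path
   through a missing edge passes next to a centre, whose tree yields a detour
   of length 2.  The trees are computed in ever sparser graphs, from ever more
   centres.

   For T = q^2, the edges that are not missing are put into the spanner.  From
   each of the at most q^3 centres c a breadth-first tree is computed; for each
   cluster, the path to its first vertex that is reached through at most q
   missing edges is put into the spanner.  For a vertex reached through q+1
   missing edges or more, the clusters met by the first q+1 of them form a set;
   a cluster occurs at most three times in it since the path is shortest.
   O(q^2 log n) clusters hit all these sets, and the trees of their centres are
   put into the spanner too.  If x and y are the first and the last clustered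
   vertex of a path, going from x to its centre c costs one extra edge, and c is
   one edge farther from y than x is; the two remaining edges pay either for
   reaching y through the centre of its cluster, or for the detour through a
   hitting centre next to the tree path. *)

Require Import Defs.
From mathcomp Require Import all_boot zify.
Set Implicit Arguments.
Unset Strict Implicit.
Unset Printing Implicit Defensive.
Import Defs.

(** * Programs and their costs *)

(* Since n <= q^5, every budget is a power of q. A threshold q^i leaves at most q^(5-i) centres and
   O(q^(5+i)) edges for the next level. The searches of the three levels thus cost q * m, q^2 * q^9
   and q^3 * q^8, and m <= n^2 <= q^10 makes each O(q^11). Bounding the surviving edges by m instead
   gives q^3 * m, the other term of the minimum. Searching from q^3 centres in the input graph
   itself could cost q^13, which is why the coarse levels come first. The spanner receives n * q and
   n * q^2 tree edges from the coarse levels, O(n * q^2) edges that are not missing, q edges for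
   each of q^3 * q^3 pairs of a centre and a cluster, and n * q^2 * log n edges from the hitting
   trees: O(q^7 * log n) in total. The test m <= q^7 also serves the running time: costs that depend
   on n alone, such as the O(q^9) incidences between recorded sets and clusters, stay below q^10 <
   q^3 * m. The hitting clusters are chosen by thresholds that are halved, so there is no random
   sampling. On the machine side the obstacle is overflow; it is separated from correctness by first
   running programs on unbounded numbers. *)
Declare Scope prog_scope.
Delimit Scope prog_scope with P.
Bind Scope prog_scope with expr.
Notation "x + y" := (Op Add x y) : prog_scope.
Notation "x - y" := (Op Sub x y) : prog_scope.
Notation "x * y" := (Op Mul x y) : prog_scope.
Notation "x / y" := (Op Div x y) : prog_scope.
Notation "x < y" := (Op Lt x y) : prog_scope.
Notation "x == y" := (Op Eq x y) : prog_scope.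
Notation "# c" := (Const c) (at level 8, format "# c") : prog_scope.
Notation "$ a" := (Cell a (Const 0)) (at level 8, format "$ a") : prog_scope.
Notation "a @[ e ]" := (Cell a e%P) (at level 8, format "a @[ e ]") : prog_scope.
Notation "a <~ e" := (Assign a (Const 0) e%P)
  (at level 80, e at level 79) : prog_scope.
Notation "c1 ;; c2" := (Seq c1 c2) (at level 81, right associativity) : prog_scope.
Bind Scope prog_scope with cmd.

Definition For i (e : expr) c : cmd :=
  ((i <~ #0) ;; While ($i < e) (c ;; (i <~ $i + #1)))%P.
Arguments For i e%_P c%_P.
Arguments Assign _ e1%_P e2%_P : rename.
Arguments While e%_P c%_P.
Arguments If e%_P c1%_P c2%_P.
Notation when e c := (If e c Skip).

Fixpoint den (st : store) (e : expr) : nat :=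
  match e with
  | Const c => c
  | Cell a e1 => st a (den st e1)
  | Op o e1 e2 => binop_eval o (den st e1) (den st e2)
  end.

Inductive big : cmd -> store -> store -> nat -> Prop :=
  | BigSkip st : big Skip st st 1
  | BigAssign st a e1 e2 :
      big (Assign a e1 e2) st (update st a (den st e1) (den st e2))
        (ecost e1 + ecost e2).+1
  | BigSeq st st1 st2 c1 c2 t1 t2 :
      big c1 st st1 t1 -> big c2 st1 st2 t2 ->
      big (Seq c1 c2) st st2 (t1 + t2)
  | BigIfTrue st st1 e c1 c2 t :
      den st e != 0 -> big c1 st st1 t ->
      big (If e c1 c2) st st1 (ecost e + t).+1
  | BigIfFalse st st1 e c1 c2 t :
      den st e = 0 -> big c2 st st1 t ->
      big (If e c1 c2) st st1 (ecost e + t).+1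
  | BigWhileTrue st st1 st2 e c t1 t2 :
      den st e != 0 -> big c st st1 t1 -> big (While e c) st1 st2 t2 ->
      big (While e c) st st2 (ecost e + t1 + t2).+1
  | BigWhileFalse st e c :
      den st e = 0 -> big (While e c) st st (ecost e).+1.

(* Values are not bounded in [big].  If every assigned value exceeds the
   memory contents by a constant at most, then after t steps the contents are
   O(t), and expressions, having constant size, are polynomial in t. *)
Fixpoint esize (e : expr) : nat :=
  match e with
  | Const _ => 1
  | Cell _ e1 => (esize e1).+1
  | Op _ e1 e2 => esize e1 + esize e2
  end.

Fixpoint econst (e : expr) : nat :=
  match e with
  | Const c => c
  | Cell _ e1 => econst e1
  | Op _ e1 e2 => maxn (econst e1) (econst e2)
  end.

(** [None] rejects the assignment of products and of sums of two cells. Products occur in addresses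
    and tests only, so memory contents grow by a constant per assignment. *)
Fixpoint growth (e : expr) : option nat :=
  match e with
  | Const c => Some c
  | Cell _ _ => Some 0
  | Op Add e1 (Const c) => omap (addn c) (growth e1)
  | Op Sub e1 _ | Op Div e1 _ => growth e1
  | Op Lt _ _ | Op Eq _ _ => Some 1
  | _ => None
  end.

Fixpoint tame (K S : nat) (c : cmd) : bool :=
  let ok e := (esize e <= S) && (econst e <= K) in
  match c with
  | Skip => true
  | Assign _ e1 e2 =>
      [&& ok e1, ok e2 & if growth e2 is Some g then g <= K else false]
  | Seq c1 c2 => tame K S c1 && tame K S c2
  | If e c1 c2 => [&& ok e, tame K S c1 & tame K S c2]
  | While e c1 => ok e && tame K S c1
  end.

Definition bounded (B : nat) (st : store) := forall a i, st a i <= B.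

Lemma leq_expn2 a b k : a <= b -> a ^ k <= b ^ k.
Proof. by case: k => // k h; rewrite leq_exp2r. Qed.

Lemma esize_gt0 e : 0 < esize e.
Proof. by elim: e => //= o e1 h1 e2 h2; lia. Qed.

(** The base [B.+2] is at least 2 even for [B = 0]; as [esize] is positive, both operands of an
    operation are bounded by powers that are at least 2, and the sum of two such powers is at most
    their product. *)
Lemma den_le B st e : bounded B st -> econst e <= B -> den st e <= B.+2 ^ esize e.
Proof.
move=> hB; elim: e => [c|a e _|o e1 IH1 e2 IH2] /=.
- by rewrite expn1; lia.
- move=> _; apply: leq_trans (hB _ _) _.
  by apply: leq_trans (leq_pexp2l (n1 := 1) _ _); rewrite // expn1; lia.
rewrite geq_max => /andP[/IH1 h1 /IH2 h2].
have g1 : 1 < B.+2 ^ esize e1 by apply: leq_ltn_trans (ltn_expl _ _); rewrite ?esize_gt0.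
have g2 : 1 < B.+2 ^ esize e2 by apply: leq_ltn_trans (ltn_expl _ _); rewrite ?esize_gt0.
rewrite expnD; case: o => /=; last 1 [ idtac ].
- by nia.
- by nia.
- by apply: leq_mul.
- by apply: leq_trans (leq_div _ _) _; nia.
- by case: (_ < _); nia.
- by case: (_ == _); nia.
Qed.

Lemma den_growth B st e g :
  bounded B st -> growth e = Some g -> den st e <= B + g.
Proof.
move=> hB; elim: e g => [c|a e _|o e1 IH1 e2 IH2] g /=.
- by case=> ->; lia.
- by case=> <-; rewrite addn0.
case: o => //=.
- case: e2 {IH2} => // c; case: (growth e1) IH1 => // g1 IH1 [<-] /=.
  by have := IH1 _ erefl; lia.
- by move=> /IH1; lia.
- by move=> /IH1; apply: leq_trans; exact: leq_div.
- by case=> <-; case: (_ < _); lia.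
- by case=> <-; case: (_ == _); lia.
Qed.

Lemma eval_den w B S st e :
  bounded B st -> econst e <= B -> esize e <= S -> B.+2 ^ S < 2 ^ w ->
  eval w st e = Some (den st e).
Proof.
move=> hB hc hs hw.
have lt2 e' : econst e' <= B -> esize e' <= S -> den st e' < 2 ^ w.
  move=> hc' hs'; apply: leq_ltn_trans hw; apply: leq_trans (den_le hB hc') _.
  by rewrite leq_pexp2l.
have wordE e' : econst e' <= B -> esize e' <= S ->
    word w (den st e') = Some (den st e').
  by move=> h1 h2; rewrite /word lt2.
elim: e hc hs => [c|a e IH|o e1 IH1 e2 IH2] hc hs; rewrite /= -/den.
- exact: wordE (Const c) hc hs.
- rewrite IH //=; first exact: wordE (Cell a e) hc hs.
  exact: ltnW.
- move: (hc) (hs) => /=; rewrite geq_max => /andP[c1 c2] s12.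
  rewrite IH1 //=; last by lia.
  rewrite IH2 //=; last by lia.
  exact: wordE (Op o e1 e2) hc hs.
Qed.

Lemma bounded_update B st a i x : bounded B st -> x <= B -> bounded B (update st a i x).
Proof. by move=> h hx b j; rewrite /update; case: ifP. Qed.

Lemma bounded_le B1 B2 st : B1 <= B2 -> bounded B1 st -> bounded B2 st.
Proof. by move=> h hB a i; apply: leq_trans (hB a i) h. Qed.

(** Every assignment takes at least one time unit and exceeds the current contents by at most [K],
    so contents stay below [B + K * t] throughout, and one inequality on the word length covers
    every expression evaluated in the run. *)
Lemma big_exec w K S c st st' t B :
  big c st st' t -> tame K S c -> bounded B st -> K <= B ->
  (B + K * t).+2 ^ S < 2 ^ w ->
  exec w c st st' t /\ bounded (B + K * t) st'.
Proof.
move=> H; elim: H B => {c st st' t}.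
- move=> st B _ hB _ _; split; first exact: ExecSkip.
  by apply: bounded_le hB; lia.
- move=> st a e1 e2 B /= /and3P[/andP[s1 k1] /andP[s2 k2] hg] hB hK hw.
  have lt2 : B.+2 ^ S < 2 ^ w.
    by apply: leq_ltn_trans hw; apply: leq_expn2; lia.
  split.
    by apply: ExecAssign; apply: (eval_den hB _ _ lt2) => //; exact: leq_trans hK.
  have := @den_growth B st e2 ^~ hB.
  case: (growth e2) hg => // g hg /(_ g erefl) hd.
  apply: bounded_update; first by apply: bounded_le hB; lia.
  by apply: leq_trans hd _; nia.
- move=> st st1 st2 c1 c2 t1 t2 _ IH1 _ IH2 B /= /andP[h1 h2] hB hK hw.
  have le1 : B + K * t1 <= B + K * (t1 + t2) by nia.
  have [|E1 B1] := IH1 B h1 hB hK; first by apply: leq_ltn_trans hw; apply: leq_expn2; lia.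
  have [||E2 B2] := IH2 (B + K * t1) h2 B1; [by lia|by rewrite -addnA -mulnDr|].
  by split; [exact: ExecSeq E1 E2|rewrite mulnDr addnA].
- move=> st st1 e c1 c2 t hd _ IH B /= /and3P[/andP[s1 k1] h1 _] hB hK hw.
  have lt2 : B.+2 ^ S < 2 ^ w by apply: leq_ltn_trans hw; apply: leq_expn2; lia.
  have [|E1 B1] := IH B h1 hB hK; first by apply: leq_ltn_trans hw; apply: leq_expn2; nia.
  split; last by apply: bounded_le B1; nia.
  by apply: ExecIfTrue hd E1; apply: (eval_den hB _ _ lt2) => //; exact: leq_trans hK.
- move=> st st1 e c1 c2 t hd _ IH B /= /and3P[/andP[s1 k1] _ h1] hB hK hw.
  have lt2 : B.+2 ^ S < 2 ^ w by apply: leq_ltn_trans hw; apply: leq_expn2; lia.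
  have [|E1 B1] := IH B h1 hB hK; first by apply: leq_ltn_trans hw; apply: leq_expn2; nia.
  split; last by apply: bounded_le B1; nia.
  by apply: ExecIfFalse E1; rewrite -hd; apply: (eval_den hB _ _ lt2) => //; exact: leq_trans hK.
- move=> st st1 st2 e c t1 t2 hd _ IH1 _ IH2 B /= /andP[/andP[s1 k1] h1] hB hK hw.
  have lt2 : B.+2 ^ S < 2 ^ w by apply: leq_ltn_trans hw; apply: leq_expn2; lia.
  have [|E1 B1] := IH1 B h1 hB hK; first by apply: leq_ltn_trans hw; apply: leq_expn2; nia.
  have [|||E2 B2] := IH2 (B + K * t1) _ B1; [by rewrite /= s1 k1|by lia| |].
    by apply: leq_ltn_trans hw; apply: leq_expn2; nia.
  split; last by apply: bounded_le B2; nia.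
  apply: ExecWhileTrue hd E1 E2.
  by apply: (eval_den hB _ _ lt2) => //; exact: leq_trans hK.
- move=> st e c hd B /= /andP[/andP[s1 k1] h1] hB hK hw.
  have lt2 : B.+2 ^ S < 2 ^ w by apply: leq_ltn_trans hw; apply: leq_expn2; lia.
  split; last by apply: bounded_le hB; lia.
  by apply: ExecWhileFalse; rewrite -hd; apply: (eval_den hB _ _ lt2) => //; exact: leq_trans hK.
Qed.

(** * Frame conditions: arrays that a program does not write *)

Fixpoint mods (c : cmd) : seq nat :=
  match c with
  | Skip => [::]
  | Assign a _ _ => [:: a]
  | Seq c1 c2 => mods c1 ++ mods c2
  | If _ c1 c2 => mods c1 ++ mods c2
  | While _ c1 => mods c1
  end.

Fixpoint reads (e : expr) : seq nat :=
  match e with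
  | Const _ => [::]
  | Cell a e1 => a :: reads e1
  | Op _ e1 e2 => reads e1 ++ reads e2
  end.

Definition same (l : seq nat) (st st' : store) := forall a, a \notin l -> st' a = st a.

Lemma same_refl l st : same l st st. Proof. by []. Qed.

Lemma same_trans l st1 st2 st3 : same l st1 st2 -> same l st2 st3 -> same l st1 st3.
Proof. by move=> h1 h2 a ha; rewrite h2 // h1. Qed.

Lemma same_sub l1 l2 st1 st2 : {subset l1 <= l2} -> same l1 st1 st2 -> same l2 st1 st2.
Proof. by move=> h h1 a ha; apply: h1; apply: contra ha; exact: h. Qed.

Lemma update_neq st a i x b : b != a -> update st a i x b = st b.
Proof. by move=> h; rewrite /update (negPf h). Qed.

Lemma same_update l st a i x : a \in l -> same l st (update st a i x).
Proof. by move=> ha b hb; apply: update_neq; apply: contraNneq hb => ->. Qed.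

Lemma big_same c st st' t : big c st st' t -> same (mods c) st st'.
Proof.
elim=> {c st st' t} //=.
- by move=> st a e1 e2; apply: same_update; rewrite inE.
- move=> st st1 st2 c1 c2 t1 t2 _ h1 _ h2; apply: same_trans.
    by apply: same_sub h1 => x; rewrite mem_cat => ->.
  by apply: same_sub h2 => x; rewrite mem_cat orbC => ->.
- by move=> st st1 e c1 c2 t _ _; apply: same_sub => x; rewrite mem_cat => ->.
- by move=> st st1 e c1 c2 t _ _; apply: same_sub => x; rewrite mem_cat orbC => ->.
- by move=> st st1 st2 e c t1 t2 _ _ h1 _; apply: same_trans.
Qed.

Lemma den_same l st st' e :
  same l st st' -> all (fun a => a \notin l) (reads e) -> den st' e = den st e.
Proof.
move=> h; elim: e => //= [a e IH /andP[ha /IH ->]|o e1 IH1 e2 IH2]; first by rewrite h.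
by rewrite all_cat => /andP[/IH1 -> /IH2 ->].
Qed.

(** * Updates of one array, and rules for timed total correctness *)

Definition upd (f : nat -> nat) (i x : nat) : nat -> nat :=
  fun j => if j == i then x else f j.

Lemma upd_eq f i x : upd f i x i = x. Proof. by rewrite /upd eqxx. Qed.
Lemma upd_neq f i x j : j != i -> upd f i x j = f j.
Proof. by rewrite /upd => /negPf ->. Qed.

Lemma update_same st a i x : update st a i x a = upd (st a) i x.
Proof. by rewrite /update eqxx. Qed.

(* [t] is the reading of a clock when [c] starts; [Q] sees the reading at its end. *)
Definition wp c (Q : store -> nat -> Prop) st t :=
  exists st' t', big c st st' t' /\ Q st' (t + t').

Lemma wp_use c (Q0 Q : store -> nat -> Prop) st t :
  wp c Q0 st t -> (forall st' t', same (mods c) st st' -> Q0 st' t' -> Q st' t') ->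
  wp c Q st t.
Proof.
by move=> [st' [t' [h q]]] H; exists st', t'; split=> //; apply: H q; exact: big_same h.
Qed.

Lemma wp_skip (Q : store -> nat -> Prop) st t : Q st t.+1 -> wp Skip Q st t.
Proof. by move=> h; exists st, 1; split; [exact: BigSkip|rewrite addn1]. Qed.

Lemma wp_assign a e1 e2 (Q : store -> nat -> Prop) st t :
  Q (update st a (den st e1) (den st e2)) (t + (ecost e1 + ecost e2).+1) ->
  wp (Assign a e1 e2) Q st t.
Proof. by move=> h; do 2 eexists; split; [exact: BigAssign|]. Qed.

Lemma wp_seq c1 c2 (Q : store -> nat -> Prop) st t :
  wp c1 (wp c2 Q) st t -> wp (Seq c1 c2) Q st t.
Proof.
move=> [st1 [t1 [h1 [st2 [t2 [h2 q]]]]]]; exists st2, (t1 + t2).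
by rewrite addnA; split=> //; exact: BigSeq h1 h2.
Qed.

Lemma wp_if e c1 c2 (Q : store -> nat -> Prop) st t :
  (den st e != 0 -> wp c1 Q st (t + (ecost e).+1)) ->
  (den st e = 0 -> wp c2 Q st (t + (ecost e).+1)) ->
  wp (If e c1 c2) Q st t.
Proof.
move=> h1 h2; have [d|d] := eqVneq (den st e) 0.
  have [st' [t' [h q]]] := h2 d; exists st', (ecost e + t').+1; split.
    exact: BigIfFalse.
  by have <- : t + (ecost e).+1 + t' = t + (ecost e + t').+1 by lia.
have [st' [t' [h q]]] := h1 d; exists st', (ecost e + t').+1; split.
  exact: BigIfTrue.
by have <- : t + (ecost e).+1 + t' = t + (ecost e + t').+1 by lia.
Qed.

(** The premises also provide [same (mods c) st st'], so invariants need not repeat facts about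
    arrays that the body leaves alone. The measure [mu] yields termination, as [big] describes
    halting runs only. *)
Lemma wp_while e c (I : store -> nat -> Prop) (mu : store -> nat)
    (Q : store -> nat -> Prop) st t :
  I st t ->
  (forall st' t', same (mods c) st st' -> I st' t' -> den st' e != 0 ->
     wp c (fun st2 t2 => I st2 (t2 + (ecost e).+1) /\ mu st2 < mu st') st' t') ->
  (forall st' t', same (mods c) st st' -> I st' t' -> den st' e = 0 ->
     Q st' (t' + (ecost e).+1)) ->
  wp (While e c) Q st t.
Proof.
move=> hI hb hQ.
suff H k st1 t1 : mu st1 < k -> same (mods c) st st1 -> I st1 t1 ->
  wp (While e c) Q st1 t1 by exact: (H _ _ _ (ltnSn _) (same_refl _)).
elim: k st1 t1 => // k IH st1 t1 hk s1 i1.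
have [d|d] := eqVneq (den st1 e) 0.
  by exists st1, (ecost e).+1; split; [exact: BigWhileFalse|exact: hQ].
have [st2 [t2 [h2 [i2 m2]]]] := hb _ _ s1 i1 d.
have [||st3 [t3 [h3 q]]] := IH st2 (t1 + t2 + (ecost e).+1) _ _ i2.
- by apply: leq_trans m2 _.
- exact: same_trans s1 (big_same h2).
exists st3, (ecost e + t2 + t3).+1; split; first exact: BigWhileTrue h2 h3.
by have <- : t1 + t2 + (ecost e).+1 + t3 = t1 + (ecost e + t2 + t3).+1 by lia.
Qed.

(** The constants price the control: guard and increment cost [ecost e + 10] per round, the initial
    assignment 3 and the failing guard [ecost e + 4]. The side conditions keep the loop bound fixed
    although it is evaluated in every round. *)
Lemma wp_for i e c (I : nat -> store -> nat -> Prop) (Q : store -> nat -> Prop) st t :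
  i \notin mods c -> all (fun a => a \notin i :: mods c) (reads e) ->
  I 0 (update st i 0 0) t ->
  (forall k st' t', k < den st e -> same (i :: mods c) st st' -> st' i 0 = k ->
     I k st' t' ->
     wp c (fun st2 t2 => I k.+1 (update st2 i 0 k.+1) (t2 + (ecost e + 10))) st' t') ->
  (forall st' t', same (i :: mods c) st st' ->
     I (den st e) st' t' -> Q st' (t' + (ecost e + 7))) ->
  wp (For i e c) Q st t.
Proof.
move=> hi hr h0 hb hQ; apply: wp_seq; apply: wp_assign => /=.
have s0 : same (i :: mods c) st (update st i 0 0).
  by apply: same_update; rewrite inE eqxx.
apply: (wp_while (I := fun st' t' => [/\ same (i :: mods c) st st',
    st' i 0 <= den st e & exists2 t1, I (st' i 0) st' t1 & t' = t1 + 3])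
  (mu := fun st' => den st e - st' i 0)).
- split=> //; rewrite update_same upd_eq //; by exists t.
- move=> st1 t1 s1 [s1' k1 [t1' I1 ->]] /=.
  rewrite (den_same s1' hr); case: ltnP => // lt1 _.
  apply: wp_seq; have [st2 [t2 [h2 I2]]] := hb _ _ _ lt1 s1' erefl I1.
  exists st2, t2; split=> //; apply: wp_assign => /=.
  have e2 : st2 i 0 = st1 i 0 by rewrite (big_same h2).
  rewrite update_same upd_eq e2 addn1; split; last by lia.
  split=> //.
    apply: same_trans s1' _; apply: (same_trans (st2 := st2)).
      by apply: same_sub (big_same h2) => x hx; rewrite inE hx orbT.
    by apply: same_update; rewrite inE eqxx.
  by exists (t1' + t2 + (ecost e + 10)) => //; lia.
- move=> st1 t1 s1 [s1' k1 [t1' I1 ->]] /=.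
  rewrite (den_same s1' hr); case: ltnP => // ge1 _.
  have ek : st1 i 0 = den st e by lia.
  rewrite ek in I1.
  have := hQ _ _ s1' I1; congr Q; lia.
Qed.

(** * Walks and edge lists *)

(** The length is bounded by [k] instead of being equal to it: stretch then becomes an implication
    for all [k], and pairs at infinite distance need no separate treatment. *)
Definition reach (g : rel nat) k u v :=
  exists p, [/\ path g u p, last u p = v & size p <= k].

Lemma reach0 g u k : reach g k u u.
Proof. by exists [::]. Qed.

Lemma reach1 (g : rel nat) u v : g u v -> reach g 1 u v.
Proof. by move=> h; exists [:: v]; rewrite /= h. Qed.

Lemma reach_le g k1 k2 u v : k1 <= k2 -> reach g k1 u v -> reach g k2 u v.
Proof. by move=> h [p [h1 h2 h3]]; exists p; split=> //; exact: leq_trans h. Qed.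

Lemma reach_trans g a b u v w : reach g a u v -> reach g b v w -> reach g (a + b) u w.
Proof.
move=> [p [h1 h2 h3]] [q [h4 h5 h6]]; exists (p ++ q).
by rewrite cat_path last_cat h2 h1 h4 size_cat leq_add.
Qed.

Lemma reach_sub (g h : rel nat) k u v : subrel g h -> reach g k u v -> reach h k u v.
Proof. by move=> s [p [h1 h2 h3]]; exists p; split=> //; exact: sub_path h1. Qed.

Lemma reach_ind (g : rel nat) v (P : nat -> nat -> Prop) :
  (forall k, P k v) ->
  (forall k u w, g u w -> reach g k w v -> P k w -> P k.+1 u) ->
  forall k u, reach g k u v -> P k u.
Proof.
move=> h0 hS k u [p]; elim: p k u => [|w p IH] k u [] /=; first by move=> _ ->.
move=> /andP[h1 h2] h3; case: k => // k h4; apply: (hS _ _ w h1).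
  by exists p.
by apply: IH.
Qed.

Lemma reach_sym (g : rel nat) k u v : symmetric g -> reach g k u v -> reach g k v u.
Proof.
move=> gs; elim/reach_ind => [k'|k' x w h _ h2]; first exact: reach0.
by rewrite -addn1; apply: reach_trans h2 _; apply: reach1; rewrite gs.
Qed.

(** The walk is cut at its first edge outside [h]. One such edge is enough for the coarse levels,
    where both halves are measured in [g]. *)
Lemma reach_split (g h : rel nat) k u v : reach g k u v ->
  reach h k u v \/
  exists x y a b, [/\ (a + b).+1 <= k, reach g a u x, g x y, ~~ h x y & reach g b y v].
Proof.
elim/reach_ind => [k'|k' x w gxw rw]; first by left; exact: reach0.
have [hxw|nh] := boolP (h x w); last first.
  by right; exists x, w, 0, k'; split=> //; exact: reach0.
case=> [r|[x' [y [a [b [le h1 h2 h3 h4]]]]]].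
  by left; rewrite -add1n; apply: reach_trans r; exact: reach1.
right; exists x', y, a.+1, b; split=> //.
by rewrite -add1n; apply: reach_trans h1; exact: reach1.
Qed.

(** The walk is cut at its first and its last edge outside [h]. The outer pieces lie in [h] and will
    be kept literally, so only the middle piece, between two vertices with [P], has to be
    stretched. *)
Lemma reach_split2 (g h : rel nat) (P : pred nat) k u v :
  subrel h g -> (forall x y, g x y -> ~~ h x y -> P x && P y) ->
  reach g k u v ->
  reach h k u v \/
  exists x y a b c, [/\ a + b + c <= k, reach h a u x, P x & P y] /\
     [/\ reach g b x y & reach h c y v].
Proof.
move=> sub hP; elim/reach_ind => [k'|k' x w gxw rw IH]; first by left; exact: reach0.
have [hxw|nh] := boolP (h x w).
  case: IH => [r|[x' [y [a [b [c [[le h1 h2 h3] [h4 h5]]]]]]]].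
    by left; rewrite -add1n; apply: reach_trans r; exact: reach1.
  right; exists x', y, a.+1, b, c; split; split=> //.
  by rewrite -add1n; apply: reach_trans h1; exact: reach1.
have /andP[Px Pw] := hP _ _ gxw nh.
case: IH => [r|[x' [y [a [b [c [[le h1 h2 h3] [h4 h5]]]]]]]].
  right; exists x, w, 0, 1, k'; split; split=> //; first exact: reach0.
  exact: reach1.
right; exists x, y, 0, (a + b).+1, c; split; split=> //.
- exact: reach0.
- rewrite -add1n; apply: reach_trans (reach1 gxw) _.
  by apply: reach_trans h4; exact: reach_sub h1.
Qed.

(** * Edge lists as undirected graphs *)

Notation edges := (seq (nat * nat)).

Definition gr (es : edges) : rel nat := fun x y => ((x, y) \in es) || ((y, x) \in es).

Lemma gr_sym es : symmetric (gr es).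
Proof. by move=> x y; rewrite /gr orbC. Qed.

Lemma gr_sub es1 es2 : {subset es1 <= es2} -> subrel (gr es1) (gr es2).
Proof. by move=> h x y /orP[] /h hh; rewrite /gr hh ?orbT. Qed.

Definition ends (e : nat * nat) := (minn e.1 e.2, maxn e.1 e.2).

Definition simple n (es : edges) :=
  (forall e, e \in es -> [/\ e.1 < n, e.2 < n & e.1 != e.2]) /\ uniq (map ends es).

Lemma simple_filter n P es : simple n es -> simple n (filter P es).
Proof.
move=> [h1 h2]; split; first by move=> e; rewrite mem_filter => /andP[_ /h1].
by apply: subseq_uniq h2; apply: map_subseq; exact: filter_subseq.
Qed.

Lemma gr_lt n es x y : simple n es -> gr es x y -> [/\ x < n, y < n & x != y].
Proof. by move=> [h _] /orP[] /h[] /= h1 h2 h3; split=> //; rewrite eq_sym. Qed.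

Definition nbrs (es : edges) v :=
  flatten [seq (if e.1 == v then [:: e.2] else if e.2 == v then [:: e.1] else [::]) | e <- es].

Lemma nbrs_rcons es e v : nbrs (rcons es e) v =
  nbrs es v ++ (if e.1 == v then [:: e.2] else if e.2 == v then [:: e.1] else [::]).
Proof. by rewrite /nbrs map_rcons flatten_rcons. Qed.

Lemma mem_nbrs es x y : (y \in nbrs es x) = gr es x y.
Proof.
elim: es => [|[a b] es IH] //=; rewrite /nbrs /= mem_cat -/(nbrs es x) IH.
rewrite /gr !in_cons !xpair_eqE [RHS]orbACA (eq_sym a x); congr (_ || _).
have [<-|ax] := eqVneq x a; rewrite ?inE /=.
  have [->|yb] /= := eqVneq y b; first by [].
  by case: (eqVneq y x) => //= e; case: (eqVneq x b) => // e'; move: yb; rewrite e e' eqxx.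
rewrite (eq_sym b x); case: (x == b); rewrite ?inE ?andbT ?andbF //.
Qed.

Lemma nbrs_uniq n es x : simple n es -> uniq (nbrs es x).
Proof.
elim: es => [|[a b] es IH] // [h1 /= /andP[h2 h3]].
have {}IH : uniq (nbrs es x).
  by apply: IH; split=> // e he; apply: h1; rewrite inE he orbT.
have [_ _ /= ab] := h1 _ (mem_head _ _).
have new y z : gr es y z -> ends (y, z) != ends (a, b).
  move=> g; apply: contraNneq h2 => <-.
  case/orP: g => [h|h]; first exact: (map_f ends h).
  by have := map_f ends h; rewrite /ends /= minnC maxnC.
rewrite /nbrs /= cat_uniq -/(nbrs es x) IH andbT.
have [ax|ax] := eqVneq a x; subst.
  by apply/hasPn => z; rewrite mem_nbrs inE => /new; apply: contra => /eqP ->.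
have [bx|bx] := eqVneq b x; subst; last by apply/hasPn.
apply/hasPn => z; rewrite mem_nbrs inE => /new; apply: contra => /eqP ->.
by rewrite /ends /= minnC maxnC.
Qed.

(** Handshake argument: an edge is counted at its two ends only, and each end occurs at most once in
    [Q]. This pays for scanning the adjacency lists of all vertices in a search queue. *)
Lemma sum_nbrs es Q : uniq Q -> sumn [seq size (nbrs es v) | v <- Q] <= 2 * size es.
Proof.
move=> uQ; elim: es => [|[a b] es IH] /=.
  by rewrite muln0 leqn0; apply/eqP; elim: Q {uQ} => //= v Q ->.
have H : sumn [seq size (nbrs ((a, b) :: es) v) | v <- Q] <=
    sumn [seq size (nbrs es v) | v <- Q] + (count_mem a Q + count_mem b Q).
  set F := fun v => size (nbrs ((a, b) :: es) v).
  have H1 v : F v <= size (nbrs es v) + ((v == a) + (v == b)).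
    rewrite /F /nbrs /= size_cat (eq_sym v a) (eq_sym v b).
    by case: (a == v); case: (b == v) => /=; lia.
  move: F H1 => F H1; elim: Q {uQ IH} => //= v Q IH.
  by apply: leq_trans (leq_add (H1 v) IH) _; rewrite addnACA (addnACA (v == a)).
apply: leq_trans H _; rewrite !count_uniq_mem //.
by apply: leq_trans (leq_add IH (leq_add (leq_b1 _) (leq_b1 _))) _; lia.
Qed.

(* cen w = c.+1 means that w is in the cluster of the centre c, and cen w = 0
   that w is unclustered. *)
Definition miss (cen : nat -> nat) x y :=
  [&& cen x != 0, cen y != 0, cen x != y.+1, cen y != x.+1 & x != y].

Lemma miss_sym cen : symmetric (miss cen).
Proof.
move=> x y; rewrite /miss (eq_sym x).
by case: (cen x == 0); case: (cen y == 0); case: (cen x == _); case: (cen y == _).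
Qed.

Definition kept cen (es : edges) := [seq e <- es | ~~ miss cen e.1 e.2].

Lemma gr_kept cen es x y : gr (kept cen es) x y = gr es x y && ~~ miss cen x y.
Proof.
by rewrite /gr !mem_filter /= (miss_sym cen y x) -andb_orr andbC.
Qed.

Lemma sub_kept cen es : subrel (gr (kept cen es)) (gr es).
Proof. by move=> x y; rewrite gr_kept => /andP[]. Qed.

(** Suitably oriented, a kept edge is a vertex followed by one of its fewer than [thr] unclustered
    neighbours, or a centre followed by a member of its cluster; the latter pair is determined by
    the member. *)
Lemma size_kept n thr cen es : simple n es ->
  (forall v, v < n -> count (fun w => cen w == 0) (nbrs es v) < thr) ->
  size (kept cen es) <= n * thr + n.
Proof.
move=> sim few.
(* On kept edges the second component of [f e] is unclustered or lies in the cluster centred at the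
   first one. *)
pose f (e : nat * nat) := if cen e.1 == 0 then (e.2, e.1) else
  if cen e.2 == 0 then e else if cen e.1 == e.2.+1 then (e.2, e.1) else e.
have fE e : ends (f e) = ends e.
  by rewrite /f /ends; do ! case: ifP => //= _; rewrite minnC maxnC.
have uf : uniq (map f (kept cen es)).
  apply: (@map_uniq _ _ ends); rewrite -map_comp (eq_map fE).
  by case: (@simple_filter n (fun e => ~~ miss cen e.1 e.2) _ sim).
pose L := flatten [seq [seq (v, w) | w <- [seq w <- nbrs es v | cen w == 0]] | v <- iota 0 n]
   ++ [seq ((cen w).-1, w) | w <- iota 0 n].
have sL : size L <= n * thr + n.
  rewrite size_cat size_map size_iota leq_add2r size_flatten /shape -map_comp.
  have: forall v, v \in iota 0 n -> count (fun w => cen w == 0) (nbrs es v) <= thr.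
    by move=> v; rewrite mem_iota => /few/ltnW.
  rewrite -[n in n * _](size_iota 0); elim: (iota 0 n) => //= v s IH h.
  rewrite size_map size_filter mulSn leq_add ?h ?mem_head // IH // => w hw.
  by rewrite h // inE hw orbT.
rewrite -(size_map f); apply: leq_trans sL; apply: uniq_leq_size uf _ => e' /mapP[[a b]].
rewrite mem_filter /= => /andP[nm hab] ->.
have [/= an bn ab] := sim.1 _ hab.
have in1 x y : gr es x y -> cen y == 0 -> x < n -> (x, y) \in L.
  move=> g c hx; rewrite mem_cat; apply/orP; left; apply/flattenP.
  exists [seq (x, w) | w <- [seq w <- nbrs es x | cen w == 0]].
    by apply/mapP; exists x => //; rewrite mem_iota.
  by apply/mapP; exists y => //; rewrite mem_filter c mem_nbrs.
have in2 x y : cen y == x.+1 -> y < n -> (x, y) \in L.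
  move=> /eqP c hy; rewrite mem_cat; apply/orP; right; apply/mapP; exists y.
    by rewrite mem_iota.
  by rewrite c.
rewrite /f /=; case: ifP => [c1|c1]; first by apply: in1 => //; rewrite /gr hab orbT.
case: ifP => [c2|c2]; first by apply: in1 => //; rewrite /gr hab.
case: ifP => [c3|c3]; first exact: in2.
by apply: in2 => //; move: nm; rewrite /miss c1 c2 c3 ab andbT /= negbK.
Qed.

(** Edges are deleted by a flag on their position, so the endpoint arrays hold the whole input graph
    until the final filtering. *)
Definition alive (es : edges) (dead : nat -> nat) : edges :=
  [seq nth (0, 0) es e | e <- iota 0 (size es) & dead e == 0].

Lemma alive0 es dead : (forall e, e < size es -> dead e = 0) -> alive es dead = es.
Proof.
move=> h; rewrite /alive (eq_in_filter (a2 := predT)) => [|e].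
  by rewrite filter_predT; exact: mkseq_nth.
by rewrite mem_iota => /h ->.
Qed.

Lemma alive_sub es dead : {subset alive es dead <= es}.
Proof. by move=> e /mapP[i]; rewrite mem_filter mem_iota => /andP[_ /= h] ->; rewrite mem_nth. Qed.

Lemma simple_alive n es dead : simple n es -> simple n (alive es dead).
Proof.
move=> [h1 h2]; split; first by move=> e /alive_sub /h1.
apply: subseq_uniq h2; apply: map_subseq.
rewrite -[X in subseq _ X](mkseq_nth (0, 0) es); apply: map_subseq; exact: filter_subseq.
Qed.

(** The spanner under construction is a table of flags addressed by ordered pairs, so that inserting
    an edge twice is harmless. The conjunct [gr es x y] discards flags that are no edges, such as
    the one set for the root of a tree, which is its own parent. *)
Definition sp (es : edges) n (mk : nat -> nat) : rel nat :=
  fun x y => gr es x y && ((mk (x * n + y) != 0) || (mk (y * n + x) != 0)).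

Lemma sp_sym es n mk : symmetric (sp es n mk).
Proof. by move=> x y; rewrite /sp gr_sym orbC. Qed.

Definition mle (mk mk' : nat -> nat) := forall i, mk i != 0 -> mk' i != 0.

Lemma mle_trans mk1 mk2 mk3 : mle mk1 mk2 -> mle mk2 mk3 -> mle mk1 mk3.
Proof. by move=> h1 h2 i /h1/h2. Qed.
Lemma mle_upd mk i : mle mk (upd mk i 1).
Proof. by move=> j; rewrite /upd; case: (j == i). Qed.

Lemma sp_sub es n mk mk' : mle mk mk' -> subrel (sp es n mk) (sp es n mk').
Proof. by move=> h x y /andP[g /orP[] /h e]; rewrite /sp g e ?orbT. Qed.

Definition few (mk : nat -> nat) K :=
  exists2 l : seq nat, size l <= K & forall i, mk i != 0 -> i \in l.

Lemma few_upd mk K i x : few mk K -> few (upd mk i x) K.+1.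
Proof.
move=> [l hl h]; exists (i :: l) => // j; rewrite /upd inE.
by case: (j == i) => //=; exact: h.
Qed.

Lemma few_le mk K1 K2 : K1 <= K2 -> few mk K1 -> few mk K2.
Proof. by move=> h [l hl H]; exists l => //; exact: leq_trans h. Qed.

Lemma index_inj n x y z t : y < n -> t < n -> x * n + y = z * n + t -> x = z /\ y = t.
Proof.
move=> yn tn e; have /= := congr1 (modn^~ n) e; rewrite !modnMDl !modn_small // => ?; subst.
by split=> //; have : 0 < n by [lia]; move=> ?; apply/eqP; rewrite -(@eqn_pmul2r n) //; apply/eqP; lia.
Qed.

Lemma size_marked n es mk K : simple n es -> few mk K ->
  size [seq e <- es | (mk (e.1 * n + e.2) != 0) || (mk (e.2 * n + e.1) != 0)] <= K.
Proof.
set P := fun e => _ => sim [l hl h].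
pose f (e : nat * nat) := if mk (e.1 * n + e.2) != 0 then e.1 * n + e.2 else e.2 * n + e.1.
apply: leq_trans hl; rewrite -(size_map f); apply: uniq_leq_size.
  have [h1 h2] := simple_filter P sim.
  rewrite map_inj_in_uniq; first exact: map_uniq h2.
  move=> [a b] [c d] he hf ff; have [/= an bn _] := h1 _ he; have [/= cn dn _] := h1 _ hf.
  have H : ends (a, b) = ends (c, d).
    move: ff; rewrite /f /=; case: ifP => _; case: ifP => _ /index_inj[]// -> ->;
    by rewrite /ends //= minnC maxnC.
  case/(nthP (0, 0)): he => i hi ei; case/(nthP (0, 0)): hf => j hj ej.
  have := nth_uniq (0, 0) _ _ h2; rewrite !size_map => /(_ i j hi hj).
  by rewrite !(nth_map (0, 0)) // ei ej H eqxx => /esym/eqP e; rewrite -ei -ej e.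
move=> i /mapP[e]; rewrite mem_filter => /andP[hP _] ->; apply: h.
by rewrite /f; case: ifP => [//|/negbFE e0]; move: hP; rewrite /P e0.
Qed.

(** Apply [size_marked] to the table in which exactly the cells below [n * n] are marked. *)
Lemma simple_size n es : simple n es -> size es <= n * n.
Proof.
move=> sim; rewrite -(size_iota 0 (n * n)).
pose f (e : nat * nat) := e.1 * n + e.2.
have := size_marked (mk := fun i => i < n * n) (K := n * n) sim.
rewrite (_ : filter _ _ = es); last first.
  apply/all_filterP/allP => e /sim.1 [h1 h2 _].
  by have -> : e.1 * n + e.2 < n * n by nia.
rewrite size_iota; apply; exists (iota 0 (n * n)); first by rewrite size_iota.
by move=> i; rewrite mem_iota; case: ltnP.
Qed.

(** * Adjacency tables, clustering and breadth-first search *)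

Notation aN := 0 (only parsing).
Notation aM := 1 (only parsing).
Notation aU := 2 (only parsing).
Notation aV := 3 (only parsing).
Notation aQ := 4 (only parsing).
Notation aDead := 5 (only parsing).
Notation aDeg := 6 (only parsing).
Notation aAdj := 7 (only parsing).
Notation aCen := 8 (only parsing).
Notation aIsc := 9 (only parsing).
Notation aMark := 10 (only parsing).
Notation aQue := 11 (only parsing).
Notation aTail := 12 (only parsing).
Notation aHead := 13 (only parsing).
Notation aDist := 14 (only parsing).
Notation aPar := 15 (only parsing).
Notation aVis := 16 (only parsing).
Notation aSrc := 17 (only parsing).
Notation aI := 18 (only parsing).
Notation aJ := 19 (only parsing).
Notation aX := 20 (only parsing).
Notation aK := 21 (only parsing).

Definition pArc x y : cmd :=
  (Assign aAdj (aDeg@[x] * $aN + x) y ;; Assign aDeg x (aDeg@[x] + #1))%P.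

Definition pBuild : cmd :=
  (For aI ($aN) (Assign aDeg $aI #0) ;;
   For aI ($aM)
     (If (aDead@[$aI]) Skip
        (pArc (aU@[$aI]) (aV@[$aI]) ;; pArc (aV@[$aI]) (aU@[$aI]))))%P.

Definition inp n es (st : store) :=
  [/\ st aN 0 = n, st aM 0 = size es &
      forall e, e < size es -> (st aU e, st aV e) = nth (0, 0) es e].

(* Entry i of the list of v is stored in cell i * n + v, so that the lists may
   have any length. *)
Definition table n (L : nat -> seq nat) (len tab : nat -> nat) :=
  forall v, v < n -> mkseq (fun i => tab (i * n + v)) (len v) = L v.

Lemma iota_rcons k : iota 0 k.+1 = rcons (iota 0 k) k.
Proof. by rewrite -addn1 iotaD cats1. Qed.

Lemma eq_mkseq_lt (f g : nat -> nat) k : (forall i, i < k -> f i = g i) -> mkseq f k = mkseq g k.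
Proof. by move=> h; apply/eq_in_map => i; rewrite mem_iota => /h. Qed.

Lemma table_push n L len tab x y : table n L len tab -> x < n ->
  table n (fun v => if v == x then rcons (L v) y else L v)
    (upd len x (len x).+1) (upd tab (len x * n + x) y).
Proof.
move=> h hx v hv; rewrite /upd; case: eqVneq => [->|ne].
  rewrite mkseqS eqxx -h //; congr rcons; apply: eq_mkseq_lt => i hi.
  by case: eqVneq => // /index_inj[]//; lia.
rewrite -h //; apply: eq_mkseq_lt => i hi.
by case: eqVneq => // /index_inj[]// _ e; rewrite e eqxx in ne.
Qed.

Lemma eq_table n L1 L2 len tab : (forall v, v < n -> L1 v = L2 v) ->
  table n L1 len tab -> table n L2 len tab.
Proof. by move=> e h v hv; rewrite h // e. Qed.

Lemma table_size n L len tab v : table n L len tab -> v < n -> len v = size (L v).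
Proof. by move=> h hv; rewrite -h // size_mkseq. Qed.

Lemma table_nth n L len tab v i :
  table n L len tab -> v < n -> i < len v -> tab (i * n + v) = nth 0 (L v) i.
Proof. by move=> h hv hi; rewrite -h // nth_mkseq. Qed.

Ltac norm := repeat first
  [ progress rewrite ?update_same ?upd_eq /=
  | rewrite update_neq; [|by []] ].

Ltac frame h := repeat match type of h with same _ ?s ?s' =>
  match goal with |- context [s' ?a] => rewrite (h a isT) end end.

Lemma build_spec n es st t : simple n es -> inp n es st ->
  wp pBuild (fun st' t' => table n (nbrs (alive es (st aDead))) (st' aDeg) (st' aAdj)
    /\ t' <= t + 100 * (n + size es + 1)) st t.
Proof.
move=> sim [hn hm he].
apply: wp_seq; apply: (@wp_for _ _ _ (fun k st' t' => (forall v, v < k -> st' aDeg v = 0) /\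
   t' <= t + 20 * k)) => //.
- by split=> //; lia.
- move=> k st1 t1 hk s1 ik [i1 it]; apply: wp_assign; norm; rewrite ik; split.
    by move=> v hv; rewrite /upd; case: eqVneq => // ne; apply: i1; lia.
  lia.
move=> st1 t1 s1 [i1 it] /=; move: i1; rewrite /= hn => i1.
pose al k := [seq nth (0, 0) es e | e <- iota 0 k & st aDead e == 0].
apply: (@wp_for _ _ _ (fun k st' t' => table n (nbrs (al k)) (st' aDeg) (st' aAdj) /\
   t' <= t + 20 * n + 9 + 100 * k)) => //.
- split; last by rewrite /= hn in it; lia.
  by norm => v hv; rewrite i1.
- move=> k st2 t2; rewrite /= (s1 aM isT) hm => hk s2 ik [i2 it2].
  have alS : al k.+1 = if st aDead k == 0 then rcons (al k) (nth (0, 0) es k) else al k.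
    rewrite /al iota_rcons filter_rcons; case: ifP => //.
    by rewrite map_rcons.
  have e1 : st2 aDead = st aDead by frame s2; frame s1.
  have e2 : st2 aU k = (nth (0, 0) es k).1 by frame s2; frame s1; rewrite -he.
  have e3 : st2 aV k = (nth (0, 0) es k).2 by frame s2; frame s1; rewrite -he.
  have e4 : st2 aN 0 = n by frame s2; frame s1.
  apply: wp_if => /=; rewrite ik e1 => hd.
    apply: wp_skip; norm; rewrite alS (negPf hd); split=> //; lia.
  have [h1 h2 h3] := sim.1 _ (mem_nth (0, 0) hk).
  apply: wp_seq; apply: wp_seq; apply: wp_assign; norm.
  apply: wp_assign; norm; apply: wp_seq; apply: wp_assign; norm; apply: wp_assign; norm.
  rewrite !ik !e2 !e3 !e4 alS hd !addn1 /=; split; last by lia.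
  have := table_push (nth (0, 0) es k).1 (table_push (nth (0, 0) es k).2 i2 h1) h2.
  apply: eq_table => v hv; rewrite nbrs_rcons.
  rewrite eq_sym; case: (eqVneq _ v) => [<-|ne1]; rewrite eq_sym.
    by rewrite (negPf h3) cats1.
  by case: (eqVneq _ v); rewrite ?cats1 ?cats0.
move=> st2 t2 s2; rewrite /= (s1 aM isT) hm => -[i2 it2]; split=> //; lia.
Qed.

(** Strict comparison being the only order test, [x < #1] tests for zero and [thr < $aK + #1] says
    that [thr] is at most the count. The neighbours are counted before any of them is claimed. *)
Definition pCluster (thr : expr) : cmd :=
  (For aI ($aN) (Assign aCen $aI #0 ;; Assign aIsc $aI #0) ;;
   For aI ($aN)
     ((aK <~ #0) ;;
      For aJ (aDeg@[$aI])
        (when (aCen@[aAdj@[$aJ * $aN + $aI]] < #1) (aK <~ $aK + #1)) ;;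
      when (thr < $aK + #1)
        (Assign aIsc $aI #1 ;;
         For aJ (aDeg@[$aI])
           (when (aCen@[aAdj@[$aJ * $aN + $aI]] < #1)
              (Assign aCen (aAdj@[$aJ * $aN + $aI]) ($aI + #1))))))%P.

(** A centre collects neighbours and need not lie in its own cluster, so members are at distance
    exactly 1 from it. The last clause holds because clusters are disjoint and have at least [T]
    members when they are formed. *)
Definition clustering n es T (cen isc : nat -> nat) :=
  [/\ forall w c, w < n -> cen w = c.+1 -> [/\ c < n, isc c != 0 & gr es c w],
      forall v, v < n -> count (fun w => cen w == 0) (nbrs es v) < T &
      count (fun v => isc v != 0) (iota 0 n) * T <= n].

Definition mass es k := sumn [seq (size (nbrs es v)).+1 | v <- iota 0 k].

Lemma massS es k : mass es k.+1 = mass es k + (size (nbrs es k)).+1.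
Proof. by rewrite /mass iota_rcons map_rcons sumn_rcons. Qed.

Lemma mass_le es n : mass es n <= n + 2 * size es.
Proof.
apply: leq_trans (leq_add (leqnn n) (sum_nbrs es (iota_uniq 0 n))).
rewrite /mass -[n in n + _](size_iota 0); elim: (iota 0 n) => //= v s IH.
by lia.
Qed.

Lemma count_iota_upd (f : nat -> nat) k x n : k < n -> f k = 0 -> x != 0 ->
  count (fun v => upd f k x v != 0) (iota 0 n) = (count (fun v => f v != 0) (iota 0 n)).+1.
Proof.
move=> hk fk x0; have ks : k \in iota 0 n by rewrite mem_iota.
rewrite !(permP (perm_to_rem ks)) /= upd_eq x0 fk; congr S.
apply: eq_in_count => v; rewrite mem_rem_uniq ?iota_uniq // inE => /andP[hv _].
by rewrite upd_neq.
Qed.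

Lemma count_sub n (P : pred nat) s : uniq s -> (forall w, w \in s -> w < n) ->
  count P s <= count (fun w => P w && (w \in s)) (iota 0 n).
Proof.
move=> us hs; rewrite -!size_filter; apply: uniq_leq_size; first exact: filter_uniq.
by move=> w; rewrite !mem_filter mem_iota => /andP[-> h]; rewrite h hs.
Qed.

Lemma cluster_spec n es thr T st t : simple n es ->
  st aN 0 = n -> table n (nbrs es) (st aDeg) (st aAdj) -> 0 < T ->
  (forall st', st' aQ = st aQ -> den st' thr = T) ->
  wp (pCluster thr) (fun st' t' => clustering n es T (st' aCen) (st' aIsc)
    /\ t' <= t + (200 + 2 * ecost thr) * (n + size es + 1)) st t.
Proof.
move=> sim hn tab T0 hthr.
apply: wp_seq; apply: (@wp_for _ _ _ (fun k st' t' =>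
   (forall v, v < k -> st' aCen v = 0 /\ st' aIsc v = 0) /\ t' <= t + 22 * k)) => //.
- by split=> //; lia.
- move=> k st1 t1 hk s1 ik [i1 it]; apply: wp_seq; do 2 apply: wp_assign; norm.
  rewrite ik; split; last by lia.
  by move=> v hv; rewrite /upd; case: eqVneq => // ne; apply: i1; lia.
move=> st1 t1 s1 [i1 it] /=; rewrite /= hn in i1 it.
(* The third clause is the disjointness of clusters in accounting form: each new centre pays [T]
   with vertices that were unclustered until then. *)
apply: (@wp_for _ _ _ (fun k st' t' =>
  [/\ forall w c, w < n -> st' aCen w = c.+1 -> [/\ c < n, st' aIsc c != 0 & gr es c w],
      forall v, v < k -> count (fun w => st' aCen w == 0) (nbrs es v) < T,
      count (fun v => st' aIsc v != 0) (iota 0 n) * T <=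
        count (fun v => st' aCen v != 0) (iota 0 n) &
      forall v, k <= v < n -> st' aIsc v = 0] /\
  t' <= t + 22 * n + 9 + (100 + ecost thr) * mass es k)) => //.
- norm; split; last by lia.
  split=> //.
  + by move=> w c hw; rewrite (i1 w hw).1.
  + rewrite (eq_in_count (a2 := pred0)) ?count_pred0 // => v.
    by rewrite mem_iota => /i1[_ ->].
  + by move=> v /= /i1[].
- move=> k st2 t2 hk s2 ik [[a b c d] i2t]; rewrite /= (s1 aN isT) hn in hk.
  have e0 : st2 aN 0 = n by frame s2; frame s1.
  have e1 : table n (nbrs es) (st2 aDeg) (st2 aAdj) by frame s2; frame s1.
  have e2 : st2 aDeg k = size (nbrs es k) by apply: table_size e1 hk.
  have nbn w : w \in nbrs es k -> w < n.
    by rewrite mem_nbrs => /(gr_lt sim)[].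
  apply: wp_seq; apply: wp_assign; norm; apply: wp_seq.
  apply: (@wp_for _ _ _ (fun j st' t' =>
    st' aK 0 = count (fun w => st2 aCen w == 0) (take j (nbrs es k)) /\
    t' <= t2 + 3 + 40 * j)) => //.
  + by norm; split; [rewrite take0|lia].
  + move=> j st3 t3; norm; rewrite ik e2 => hj s3 ij [i3 i3t].
    have ew : st3 aAdj (st3 aJ 0 * st3 aN 0 + st3 aI 0) = nth 0 (nbrs es k) j.
      by frame s3; norm; rewrite ij e0 ik (table_nth e1) ?e2.
    have ec : st3 aCen = st2 aCen by frame s3; norm.
    rewrite (take_nth 0 hj) -cats1 count_cat /= addn0.
    apply: wp_if => /=; rewrite ew ec; case: ltnP => // h _.
      apply: wp_assign; norm; rewrite i3; split; last by lia.
      by have -> : st2 aCen (nth 0 (nbrs es k) j) == 0 by lia.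
    apply: wp_skip; norm; rewrite i3; split; last by lia.
    have -> : (st2 aCen (nth 0 (nbrs es k) j) == 0) = false by lia.
    by rewrite addn0.
  move=> st3 t3 s3 [i3 i3t].
  have {}i3 : st3 aK 0 = count (fun w => st2 aCen w == 0) (nbrs es k).
    by rewrite i3; norm; rewrite ik e2 take_size.
  have {}i3t : t3 <= t2 + 3 + 40 * size (nbrs es k).
    by move: i3t; norm; rewrite ik e2.
  have i3k : st3 aI 0 = k by frame s3; norm.
  have thr3 : den st3 thr = T by apply: hthr; frame s3; norm; frame s2; frame s1.
  have ec : st3 aCen = st2 aCen by frame s3; norm.
  have ei : st3 aIsc = st2 aIsc by frame s3; norm.
  have m_le : count (fun w => st2 aCen w == 0) (nbrs es k) <= size (nbrs es k) by apply: count_size.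
  apply: wp_if => /=; rewrite thr3 i3 addn1 ltnS; case: leqP => // h _; last first.
    apply: wp_skip; norm; rewrite ec ei; split; last by rewrite massS; have := leq0n (ecost thr * size (nbrs es k)); lia.
    split=> //.
    * by move=> v; rewrite ltnS leq_eqVlt => /orP[/eqP ->|/b].
    * by move=> v hv; apply: d; lia.
  apply: wp_seq; apply: wp_assign; norm.
  apply: (@wp_for _ _ _ (fun j st' t' =>
    (forall w, st' aCen w = if (st2 aCen w == 0) && (w \in take j (nbrs es k)) then k.+1
                            else st2 aCen w) /\
    t' <= t3 + 60 + ecost thr + 46 * j)) => //.
  + norm; split; last by lia.
    by move=> w; rewrite take0 andbF ec.
  + move=> j st4 t4; norm; rewrite i3k.
    have -> : st3 aDeg k = size (nbrs es k) by frame s3; norm.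
    move=> hj s4 ij [i4 i4t].
    have ew : st4 aAdj (st4 aJ 0 * st4 aN 0 + st4 aI 0) = nth 0 (nbrs es k) j.
      by frame s4; norm; frame s3; norm; rewrite ij e0 ik (table_nth e1) ?e2.
    have ik4 : st4 aI 0 = k by frame s4; norm.
    rewrite (take_nth 0 hj).
    apply: wp_if => /=; rewrite ew i4; set x := nth 0 _ _.
      case: ltnP => // h4 _.
      apply: wp_assign; norm; rewrite ew ik4 addn1; split; last by lia.
      move=> w; rewrite /upd mem_rcons inE; case: eqVneq => [->|ne] /=.
        by move: h4; rewrite andbT; case: ifP => [/andP[->]//|]; case: (st2 aCen x).
      exact: i4.
    case: ltnP => // h4 _; apply: wp_skip; norm; split; last by lia.
    move=> w; rewrite i4 mem_rcons inE; case: (eqVneq w x) => [->|//] /=.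
    by move: h4; rewrite andbT; case: (st2 aCen x) => //=; case: ifP.
  move=> st4 t4 s4 [i4 i4t].
  have ei4 : st4 aIsc = upd (st2 aIsc) k 1 by frame s4; norm; rewrite i3k ei.
  have {}i4t : t4 <= t3 + 60 + ecost thr + 46 * size (nbrs es k).
    by move: i4t; norm; rewrite i3k; have -> : st3 aDeg k = size (nbrs es k) by frame s3; norm.
  have {}i4 w : st4 aCen w = if (st2 aCen w == 0) && (w \in nbrs es k) then k.+1
                            else st2 aCen w.
    rewrite i4; norm; rewrite i3k; have -> : st3 aDeg k = size (nbrs es k) by frame s3; norm.
    by rewrite take_size.
  norm; rewrite ei4; split; last by rewrite massS; have := leq0n (ecost thr * size (nbrs es k)); lia.
  have dk : st2 aIsc k = 0 by apply: d; rewrite leqnn.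
  split.
  + move=> w c' hw; rewrite i4; case: ifP => [/andP[_ hnb] [<-]|_ /(a _ _ hw)[a1 a2 a3]].
      by rewrite upd_eq -mem_nbrs.
    by split=> //; rewrite /upd; case: ifP.
  (* The set of unclustered vertices only shrinks, which settles the earlier vertices; [k] itself
     has just claimed all its unclustered neighbours. *)
  + move=> v; rewrite ltnS => hv.
    have sub : subpred (fun w => st4 aCen w == 0) (fun w => st2 aCen w == 0).
      by move=> w; rewrite i4; case: ifP => // /andP[].
    case: (eqVneq v k) => [->|ne]; last first.
      by apply: leq_ltn_trans (sub_count sub _) (b _ _); lia.
    rewrite (eq_in_count (a2 := pred0)) ?count_pred0 // => w hw /=.
    by rewrite i4 hw andbT; case: ifP.
  + rewrite count_iota_upd // mulSn.
    have -> : count (fun v => st4 aCen v != 0) (iota 0 n) =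
        count (fun w => (st2 aCen w == 0) && (w \in nbrs es k)) (iota 0 n)
        + count (fun v => st2 aCen v != 0) (iota 0 n).
      elim: (iota 0 n) => //= w s ->; rewrite i4.
      by case h1: (st2 aCen w == 0) => /=; case: (w \in nbrs es k) => /=; rewrite ?h1 /=; lia.
    apply: leq_add c; apply: leq_trans h _.
    by apply: count_sub nbn; exact: nbrs_uniq sim.
  + by move=> v hv; rewrite upd_neq; [apply: d|]; lia.
move=> st2 t2 s2; rewrite /= (s1 aN isT) hn => -[[a b c _] it2]; split.
  split=> //; apply: leq_trans c _.
  by apply: leq_trans (count_size _ _) _; rewrite size_iota.
have := leq_mul (leqnn (100 + ecost thr)) (mass_le es n).
set A := (_ * mass _ _) in it2 *; lia.
Qed.

(** Here [d] is merely the depth in the tree; that depths are distances follows once the search is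
    complete. The queue positions of parents give the well-founded order for inductions along tree
    paths, and [bt_mono] makes a scan of the queue meet near vertices first. *)
Record bfs_tree n es c (Q : seq nat) (d p : nat -> nat) : Prop := BfsTree {
  bt_uniq : uniq Q;
  bt_lt : forall v, v \in Q -> v < n;
  bt_root : 0 < size Q /\ nth 0 Q 0 = c;
  bt_rootd : d c = 0 /\ p c = c;
  bt_par : forall v, v \in Q -> v != c ->
    [/\ p v \in Q, gr es (p v) v, d v = (d (p v)).+1 & index (p v) Q < index v Q];
  bt_mono : forall i j, i <= j < size Q -> d (nth 0 Q i) <= d (nth 0 Q j) }.

(** [br_front] is the classical two-layer invariant: no discovered vertex is more than one level
    deeper than the head [h] of the queue. *)
Record bfs_run n es c h (Q : seq nat) (d p vis : nat -> nat) : Prop := BfsRun {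
  br_tree : bfs_tree n es c Q d p;
  br_vis : forall v, v < n -> (vis v != 0) = (v \in Q);
  br_h : h <= size Q;
  br_front : h < size Q -> forall v, v \in Q -> d v <= (d (nth 0 Q h)).+1;
  br_done : forall x w, x \in take h Q -> gr es x w -> w \in Q /\ d w <= (d x).+1 }.

Lemma run_push n es c h Q d p vis x w :
  bfs_run n es c h Q d p vis -> h < size Q -> nth 0 Q h = x -> gr es x w ->
  w < n -> w \notin Q ->
  bfs_run n es c h (rcons Q w) (upd d w (d x).+1) (upd p w x) (upd vis w 1).
Proof.
move=> [[uQ ltQ [r1 r2] [rd rp] par mono] visQ hQ front done] hlt ex gxw wn wQ.
have xQ : x \in Q by rewrite -ex mem_nth.
have neq v : v \in Q -> (v == w) = false.
  by move=> vQ; apply/eqP => e; rewrite -e vQ in wQ.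
have cQ : c \in Q by rewrite -r2 mem_nth.
have du v : v \in Q -> upd d w (d x).+1 v = d v by rewrite /upd => /neq ->.
have pu v : v \in Q -> upd p w x v = p v by rewrite /upd => /neq ->.
have fr v : v \in Q -> d v <= (d x).+1 by rewrite -ex; apply: front.
have nthr i : i < size Q -> nth 0 (rcons Q w) i = nth 0 Q i by rewrite nth_rcons => ->.
have idr v : v \in Q -> index v (rcons Q w) = index v Q.
  by rewrite -cats1 index_cat => ->.
split; first split.
- by rewrite rcons_uniq wQ.
- by move=> v; rewrite mem_rcons inE => /orP[/eqP ->|/ltQ].
- by rewrite size_rcons nthr.
- by rewrite du // pu.
- move=> v; rewrite mem_rcons inE => /orP[/eqP -> _|vQ vc]; last first.
    have [q1 q2 q3 q4] := par _ vQ vc.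
    by rewrite pu // !du // !idr // mem_rcons inE q1 orbT.
  rewrite !upd_eq mem_rcons inE xQ orbT du // idr //; split=> //.
  by rewrite -cats1 index_cat (negPf wQ) /= eqxx addn0 index_mem.
- move=> i j; rewrite size_rcons => /andP[ij]; rewrite ltnS leq_eqVlt => /orP[/eqP ej|jlt].
    rewrite ej [nth 0 _ (size Q)]nth_rcons ltnn eqxx upd_eq.
    move: ij; rewrite ej leq_eqVlt => /orP[/eqP ->|ilt].
      by rewrite nth_rcons ltnn eqxx upd_eq.
    by rewrite nthr // du ?mem_nth // fr // mem_nth.
  have ilt : i < size Q by lia.
  by rewrite !nthr // !du ?mem_nth // mono // ij.
- by move=> v hv; rewrite mem_rcons inE /upd; case: (eqVneq v w) => //= _; exact: visQ.
- by rewrite size_rcons ltnW.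
- move=> _ v; rewrite mem_rcons inE nthr // ex (du x) // => /orP[/eqP ->|vQ].
    by rewrite upd_eq.
  by rewrite du // fr.
- move=> y z; rewrite -cats1 take_cat hlt => /[dup] yQ' /done h' /h' [zQ zd].
  have yQ : y \in Q by exact: mem_take yQ'.
  by rewrite mem_cat zQ !du.
Qed.

Lemma run_pop n es c h Q d p vis :
  bfs_run n es c h Q d p vis -> h < size Q ->
  (forall w, gr es (nth 0 Q h) w -> w \in Q) ->
  bfs_run n es c h.+1 Q d p vis.
Proof.
move=> [tree visQ hQ front done] hlt cl; split=> //.
  move=> h1 v /(front hlt) h2; apply: leq_trans h2 _.
  by rewrite ltnS; apply: (bt_mono tree); lia.
move=> x w; rewrite (take_nth 0) // mem_rcons inE => /orP[/eqP ->|].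
  by move=> /cl wQ; split=> //; apply: front.
exact: done.
Qed.

(** Once the queue is exhausted, [br_done] applies to every discovered vertex: crossing an edge
    raises [d] by at most one, and [d c = 0]. *)
Lemma run_complete n es c Q d p vis b v :
  bfs_run n es c (size Q) Q d p vis -> reach (gr es) b c v -> v \in Q /\ d v <= b.
Proof.
move=> [[uQ ltQ [r1 r2] [rd rp] par mono] visQ hQ front done] /(reach_sym (@gr_sym es)).
elim/reach_ind => [k|k u w g _ [wQ wd]]; first by rewrite rd -r2 mem_nth.
have [||uQ' ud] := done w u; rewrite ?take_size //; first by rewrite gr_sym.
by split=> //; lia.
Qed.

Definition pBfs : cmd :=
  (For aI ($aN) (Assign aVis $aI #0) ;;
   Assign aQue #0 $aSrc ;; (aTail <~ #1) ;; (aHead <~ #0) ;;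
   Assign aDist $aSrc #0 ;; Assign aPar $aSrc $aSrc ;; Assign aVis $aSrc #1 ;;
   While ($aHead < $aTail)
     ((aX <~ aQue@[$aHead]) ;;
      For aJ (aDeg@[$aX])
        ((aK <~ aAdj@[$aJ * $aN + $aX]) ;;
         when (aVis@[$aK] < #1)
           (Assign aVis $aK #1 ;; Assign aDist $aK (aDist@[$aX] + #1) ;;
            Assign aPar $aK $aX ;; Assign aQue $aTail $aK ;;
            (aTail <~ $aTail + #1))) ;;
      (aHead <~ $aHead + #1)))%P.

Definition bfs_post n es c (Q : seq nat) (d p : nat -> nat) :=
  bfs_tree n es c Q d p /\
  forall b v, reach (gr es) b c v -> v \in Q /\ d v <= b.

Lemma size_bound n (Q : seq nat) : uniq Q -> (forall v, v \in Q -> v < n) -> size Q <= n.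
Proof.
move=> uQ ltQ; rewrite -[n in _ <= n](size_iota 0); apply: uniq_leq_size => // v /ltQ.
by rewrite mem_iota.
Qed.

Lemma bfs_spec n es c st t : simple n es ->
  st aN 0 = n -> table n (nbrs es) (st aDeg) (st aAdj) -> st aSrc 0 = c -> c < n ->
  wp pBfs (fun st' t' => bfs_post n es c (mkseq (st' aQue) (st' aTail 0)) (st' aDist) (st' aPar)
    /\ t' <= t + 200 * (n + size es + 1)) st t.
Proof.
move=> sim hn tab hc cn.
apply: wp_seq; apply: (@wp_for _ _ _ (fun k st' t' =>
   (forall v, v < k -> st' aVis v = 0) /\ t' <= t + 20 * k)) => //.
- by split=> //; lia.
- move=> k st1 t1 hk s1 ik [i1 it]; apply: wp_assign; norm; rewrite ik; split; last by lia.
  by move=> v hv; rewrite /upd; case: eqVneq => // ne; apply: i1; lia.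
move=> st1 t1 s1 [i1 it] /=; rewrite /= hn in i1 it.
have hc1 : st1 aSrc 0 = c by frame s1.
do 6 (apply: wp_seq; apply: wp_assign; norm); rewrite !hc1.
(* Each vertex leaving the queue is charged its degree plus one; the handshake bound turns the total
   into O(n + m). *)
pose cost (Q : seq nat) := sumn [seq (size (nbrs es v)).+1 | v <- Q].
apply: (@wp_while _ _ (fun st' t' => let Q := mkseq (st' aQue) (st' aTail 0) in
   bfs_run n es c (st' aHead 0) Q (st' aDist) (st' aPar) (st' aVis) /\
   t' <= t + 20 * n + 50 + 80 * cost (take (st' aHead 0) Q))
   (fun st' => n - st' aHead 0)).
- norm; split; last by rewrite /cost /=; lia.
  split=> //; first split=> //=.
  + by move=> v; rewrite inE => /eqP ->.
  + by rewrite !upd_eq.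
  + by move=> v; rewrite inE => ->.
  + by move=> i j; rewrite ltnS leqn0 => /andP[] /[swap] /eqP ->; rewrite leqn0 => /eqP ->.
  + move=> v hv; rewrite inE /upd; case: (eqVneq v c) => //= _.
    by rewrite i1.
  + by move=> _ v; rewrite inE => /eqP -> /=; rewrite upd_eq.
- move=> st2 t2 s2 []; set h := st2 aHead 0; set Q := mkseq _ _ => run i2t.
  rewrite /= -/h; case: ltnP => // hlt _.
  have hQ : h < size Q by rewrite size_mkseq.
  set x := nth 0 Q h.
  have xE : st2 aQue h = x by rewrite /x nth_mkseq.
  have xn : x < n by apply: (bt_lt (br_tree run)); rewrite mem_nth.
  have e0 : st2 aN 0 = n by frame s2; norm; frame s1.
  have e1 : table n (nbrs es) (st2 aDeg) (st2 aAdj) by frame s2; norm; frame s1.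
  have e2 : st2 aDeg x = size (nbrs es x) by apply: table_size e1 xn.
  apply: wp_seq; apply: wp_assign; norm; rewrite -/h xE; apply: wp_seq.
  apply: (@wp_for _ _ _ (fun j st' t' => let Q' := mkseq (st' aQue) (st' aTail 0) in
    [/\ bfs_run n es c h Q' (st' aDist) (st' aPar) (st' aVis), h < size Q',
       nth 0 Q' h = x, take h Q' = take h Q & {subset take j (nbrs es x) <= Q'}] /\
    t' <= t2 + 10 + 60 * j)) => //.
  + by norm; split; [rewrite take0|lia].
  + move=> j st3 t3; norm; rewrite e2 => hj s3 ij []; set Q3 := mkseq _ _.
    move=> [run3 hQ3 x3 tk3 sub3] i3t.
    have e3 : st3 aN 0 = n by frame s3; norm.
    have e4 : table n (nbrs es) (st3 aDeg) (st3 aAdj) by frame s3; norm.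
    have e5 : st3 aX 0 = x by frame s3; norm.
    have e6 : st3 aDeg x = size (nbrs es x) by apply: table_size e4 xn.
    apply: wp_seq; apply: wp_assign; norm; rewrite ij e3 e5 (table_nth e4) ?e6 //.
    set w := nth 0 _ _.
    have gw : gr es x w by rewrite -mem_nbrs mem_nth.
    have [_ wn _] := gr_lt sim gw.
    rewrite (take_nth 0 hj) -/w.
    apply: wp_if => /=; norm; have vw := br_vis run3 wn.
      rewrite -[st3 aVis w < 1]negbK -leqNgt lt0n vw.
      have [//|wQ _] := boolP (w \in Q3).
      do 4 (apply: wp_seq; apply: wp_assign; norm); apply: wp_assign; norm.
      rewrite e5 addn1; set Q4 := mkseq _ _.
      have eQ4 : Q4 = rcons Q3 w.
        rewrite /Q4 mkseqS upd_eq; congr rcons; apply: eq_mkseq_lt => i hi.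
        by rewrite upd_neq //; lia.
      rewrite eQ4 size_rcons ltnS (ltnW hQ3) nth_rcons hQ3 x3; split; last by lia.
      split=> //.
      * by rewrite addn1; apply: run_push run3 hQ3 x3 gw wn wQ.
      * by rewrite -cats1 take_cat hQ3.
      * by move=> z; rewrite !mem_rcons !inE => /orP[->//|/sub3 ->]; rewrite orbT.
    have [wQ _|wQ] := boolP (w \in Q3); last first.
      by have : st3 aVis w < 1 by [move: vw; rewrite (negPf wQ); case: (st3 aVis w)]; move->.
    apply: wp_skip; norm; rewrite -/Q3; split; last by lia.
    by split=> // z; rewrite mem_rcons inE => /orP[/eqP ->|/sub3].
  move=> st3 t3 s3; norm; rewrite e2 take_size; set Q3 := mkseq _ _.
  move=> [[run3 hQ3 x3 tk3 sub3] i3t].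
  have e3 : st3 aHead 0 = h by frame s3; norm.
  apply: wp_assign; norm; rewrite e3 -/Q3 addn1; split; last first.
    have := size_bound (bt_uniq (br_tree run)) (bt_lt (br_tree run)); lia.
  split; first by apply: run_pop => // w; rewrite x3 -mem_nbrs; exact: sub3.
  rewrite (take_nth 0) // x3 tk3 /cost map_rcons sumn_rcons -/(cost _).
  by lia.
move=> st2 t2 s2 []; set h := st2 aHead 0; set Q := mkseq _ _ => run i2t.
rewrite /= -/h; case: ltnP => // hge _.
have eh : h = size Q.
  by apply/eqP; rewrite eqn_leq (br_h run) size_mkseq.
rewrite eh take_size in i2t; rewrite eh in run.
split; first by split; [exact: br_tree run|move=> b v; exact: run_complete run].
have sQ := size_bound (bt_uniq (br_tree run)) (bt_lt (br_tree run)).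
have cQ : cost Q <= n + 2 * size es.
  apply: leq_trans (leq_add sQ (sum_nbrs es (bt_uniq (br_tree run)))).
  rewrite /cost; elim: (Q) => //= v s IH; by lia.
by lia.
Qed.

Lemma tree_reach n es c Q d p (g : rel nat) : bfs_tree n es c Q d p ->
  (forall v, v \in Q -> v != c -> g (p v) v) ->
  forall v, v \in Q -> reach g (d v) c v.
Proof.
move=> T hg v; have [k] := ubnP (index v Q); elim: k v => // k IH v hk vQ.
have [->|vc] := eqVneq v c; first exact: reach0.
have [pQ pg -> pi] := bt_par T vQ vc.
rewrite -addn1; apply: reach_trans (IH _ _ pQ) (reach1 (hg _ vQ vc)).
by lia.
Qed.

(** * Breadth-first trees put into the spanner, and the coarse levels *)

Definition pTree : cmd :=
  (For aI ($aTail) (Assign aMark (aPar@[aQue@[$aI]] * $aN + aQue@[$aI]) #1))%P.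

Notation aC := 22 (only parsing).

Definition pTrees f : cmd :=
  (For aC ($aN) (when (f@[$aC]) ((aSrc <~ $aC) ;; pBfs ;; pTree)))%P.

Lemma tree_spec n es es0 c st t :
  subrel (gr es) (gr es0) -> st aN 0 = n ->
  bfs_post n es c (mkseq (st aQue) (st aTail 0)) (st aDist) (st aPar) ->
  wp pTree (fun st' t' => [/\ mle (st aMark) (st' aMark),
      forall b v, reach (gr es) b c v -> reach (sp es0 n (st' aMark)) b c v,
      forall K, few (st aMark) K -> few (st' aMark) (K + n) &
      t' <= t + 100 * (n + 1)]) st t.
Proof.
move=> sub hn []; set Q := mkseq _ _ => T compl.
have sQ : size Q <= n := size_bound (bt_uniq T) (bt_lt T).
have tQ : st aTail 0 = size Q by rewrite size_mkseq.
apply: (@wp_for _ _ _ (fun k st' t' => [/\ mle (st aMark) (st' aMark),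
  forall v, v \in take k Q -> st' aMark (st aPar v * n + v) != 0,
  forall K, few (st aMark) K -> few (st' aMark) (K + k) & t' <= t + 50 * k])) => //.
- by norm; split=> //; [rewrite take0|move=> K; rewrite addn0|lia].
- move=> k st1 t1 /= hk s1 ik [i1 i2 i3 it]; apply: wp_assign; norm; rewrite ik.
  have -> : st1 aN 0 = n by frame s1.
  have -> : st1 aPar = st aPar by frame s1.
  have -> : st1 aQue k = nth 0 Q k by frame s1; rewrite nth_mkseq.
  split; last by lia.
  + by apply: mle_trans i1 _; exact: mle_upd.
  + move=> v; rewrite (take_nth 0) -?tQ // mem_rcons inE /upd => /orP[/eqP ->|/i2 h].
      by rewrite eqxx.
    by case: ifP.
  + by move=> K /i3; rewrite addnS; exact: few_upd.
move=> st1 t1 s1 /=; rewrite tQ take_size => -[i1 i2 i3 it]; split=> //; last by lia.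
- move=> b v /compl[vQ vd]; apply: reach_le vd _; apply: (tree_reach T) vQ => w wQ wc.
  by have [_ g _ _] := bt_par T wQ wc; rewrite /sp (sub _ _ g) i2.
- by move=> K /i3; apply: few_le; lia.
Qed.

Lemma trees_spec f n es es0 st t : f \notin mods (pTrees f) ->
  simple n es -> subrel (gr es) (gr es0) -> st aN 0 = n ->
  table n (nbrs es) (st aDeg) (st aAdj) ->
  let F := count (fun v => st f v != 0) (iota 0 n) in
  wp (pTrees f) (fun st' t' => [/\ mle (st aMark) (st' aMark),
      forall c b v, c < n -> st f c != 0 ->
        reach (gr es) b c v -> reach (sp es0 n (st' aMark)) b c v,
      forall K, few (st aMark) K -> few (st' aMark) (K + n * F) &
      t' <= t + 400 * (F + 1) * (n + size es + 1)]) st t.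
Proof.
move=> hf sim sub hn tab F.
pose G k := count (fun v => st f v != 0) (iota 0 k).
have GS k : G k.+1 = G k + (st f k != 0) by rewrite /G iota_rcons -cats1 count_cat /= addn0.
have sf st1 : same (aC :: mods (when (f@[$aC]) ((aSrc <~ $aC) ;; pBfs ;; pTree))%P) st st1 ->
    st1 f = st f.
  by apply; apply: contra hf; rewrite /= !inE; repeat case: (f == _) => //=.
apply: (@wp_for _ _ _ (fun k st' t' => [/\ mle (st aMark) (st' aMark),
      forall c b v, c < k -> st f c != 0 ->
        reach (gr es) b c v -> reach (sp es0 n (st' aMark)) b c v,
      forall K, few (st aMark) K -> few (st' aMark) (K + n * G k) &
      t' <= t + 40 * k + 360 * G k * (n + size es + 1)])) => //.
- by norm; split=> //; [move=> K; rewrite muln0 addn0|lia].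
- move=> k st1 t1 /=; rewrite hn => hk s1 ik [i1 i2 i3 it].
  have e0 : st1 aN 0 = n by frame s1.
  have e1 : table n (nbrs es) (st1 aDeg) (st1 aAdj) by frame s1.
  apply: wp_if => /=; rewrite ik (sf _ s1) => hfk; last first.
    apply: wp_skip; norm; rewrite GS hfk addn0; split=> //; last by lia.
    move=> c b v; rewrite ltnS leq_eqVlt => /orP[/eqP ->|/i2 h]; last exact: h.
    by rewrite hfk.
  apply: wp_seq; apply: wp_assign; norm; rewrite ik; apply: wp_seq.
  apply: wp_use; first by apply: (@bfs_spec n es k).
  move=> st2 t2 s2 [post2 it2].
  apply: wp_use; first by apply: (@tree_spec n es es0 k) post2 => //; frame s2; norm.
  have e10 : st2 aMark = st1 aMark by frame s2; norm.
  move=> st3 t3 s3 []; rewrite e10 => j1 j2 j3 jt; norm; rewrite GS hfk /= addn1; split.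
  + exact: mle_trans i1 j1.
  + move=> c b v; rewrite ltnS leq_eqVlt => /orP[/eqP -> _|hc hcf hr]; first exact: j2.
    by apply: reach_sub (i2 _ _ _ hc hcf hr); exact: sp_sub.
  + by move=> K /i3/j3; rewrite mulnS; apply: few_le; lia.
  + by rewrite (mulnS 360) mulnDl; lia.
move=> st1 t1 s1 /=; rewrite hn => -[i1 i2 i3 it]; split=> //.
rewrite mulnDr mulnDl muln1; change (G n) with F in it.
have := leq0n (F * (n + size es + 1)); lia.
Qed.

(** Products of truth values serve as conjunctions, and comparison with 1 as negation. *)
Definition missE x y : expr :=
  ((#0 < aCen@[x]) * (#0 < aCen@[y]) * ((aCen@[x] == y + #1) < #1) *
   ((aCen@[y] == x + #1) < #1) * ((x == y) < #1))%P.

Lemma den_missE st x y : den st (missE x y) = miss (st aCen) (den st x) (den st y).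
Proof.
rewrite /miss /= !addn1 !lt0n.
do 2 case: (_ == 0) => //=.
by case: (_ == _) => //=; case: (_ == _) => //=; case: (_ == _).
Qed.

Definition pKill : cmd :=
  (For aI ($aM) (when (missE (aU@[$aI]) (aV@[$aI])) (Assign aDead $aI #1)))%P.

Lemma kill_spec n es st t : inp n es st ->
  wp pKill (fun st' t' => alive es (st' aDead) = kept (st aCen) (alive es (st aDead)) /\
    t' <= t + 100 * (size es + 1)) st t.
Proof.
move=> [hn hm he].
apply: (@wp_for _ _ _ (fun k st' t' => (forall e, st' aDead e = 0 <->
  st aDead e = 0 /\ (e < k -> ~~ miss (st aCen) (st aU e) (st aV e))) /\
  t' <= t + 80 * k)) => //.
- by norm; split; [move=> e; split=> // -[]|lia].
- move=> k st1 t1 /= hk s1 ik [i1 it].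
  have eU : st1 aU = st aU by frame s1.
  have eV : st1 aV = st aV by frame s1.
  have eC : st1 aCen = st aCen by frame s1.
  apply: wp_if; rewrite den_missE /= ik eU eV eC.
    case mk : (miss _ _ _) => // _; apply: wp_assign; norm; rewrite ik; split; last by lia.
    move=> e; rewrite /upd; case: (eqVneq e k) => [->|ne].
      by split=> // -[_ /(_ (ltnSn _))]; rewrite mk.
    rewrite i1; split=> -[h1 h2]; split=> // h3; apply: h2; lia.
  case mk : (miss _ _ _) => // _; apply: wp_skip; norm; split; last by lia.
  move=> e; rewrite i1; split=> -[h1 h2]; split=> // h3; last by apply: h2; lia.
  by case: (eqVneq e k) => [->|ne]; [rewrite mk|apply: h2; lia].
move=> st1 t1 s1 /=; rewrite hm => -[i1 it]; split; last by lia.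
rewrite /kept /alive filter_map -filter_predI; congr map.
apply: eq_in_filter => e; rewrite mem_iota /= => he'; rewrite -he //=.
apply/eqP/andP => [/i1[h1 /(_ he') h2]|[h1 /eqP h2]]; first by rewrite h1.
by apply/i1.
Qed.

Definition pLevel thr : cmd :=
  (pBuild ;; pCluster thr ;; pTrees aIsc ;; pKill)%P.

(** If the walk has pieces of lengths a and b around a missing edge xy, the centre of x reaches its
    two ends within 1 + a and 1 + 1 + b, and a + b + 1 <= k. A walk either survives at its own
    length or is replaced at once at a loss of 2, so the losses of successive levels never add
    up. *)
Lemma level_spec n es thr T st t : simple n es -> inp n es st -> 0 < T ->
  (forall st', st' aQ = st aQ -> den st' thr = T) ->
  let es1 := alive es (st aDead) in
  wp (pLevel thr) (fun st' t' => let es2 := alive es (st' aDead) in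
    exists2 K, K * T <= n &
    [/\ mle (st aMark) (st' aMark),
      forall k u v, reach (gr es1) k u v ->
        reach (gr es2) k u v \/ reach (sp es n (st' aMark)) (k + 2) u v,
      forall F, few (st aMark) F -> few (st' aMark) (F + n * K),
      size es2 <= n * T + n /\ size es2 <= size es1 &
      t' <= t + 2000 * (1 + ecost thr) * (n + size es + (K + 1) * (n + size es1 + 1))]) st t.
Proof.
move=> sim hinp T0 hthr es1; have [hn hm he] := hinp.
have sub : subrel (gr es1) (gr es) by apply: gr_sub; exact: alive_sub.
have sim1 : simple n es1 by exact: simple_alive.
apply: wp_seq; apply: wp_use; first exact: build_spec sim hinp.
move=> st1 t1 s1 [tab1 it1].
have hn1 : st1 aN 0 = n by frame s1.
have hthr1 st' : st' aQ = st1 aQ -> den st' thr = T.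
  by move=> h; apply: hthr; rewrite h; frame s1.
apply: wp_seq; apply: wp_use; first exact: (cluster_spec _ sim1 hn1 tab1 T0 hthr1).
move=> st2 t2 s2 [[c1 c2 c3] it2].
apply: wp_seq; apply: wp_use.
  apply: (@trees_spec aIsc n es1 es _ _ isT sim1 sub); first by frame s2.
  by frame s2.
move=> st3 t3 s3 [m3 r3 f3 it3].
have inp3 : inp n es st3.
  by split; [frame s3; frame s2; frame s1| frame s3; frame s2; frame s1| move=> e; frame s3; frame s2; frame s1; exact: he].
apply: wp_use; first exact: kill_spec inp3.
have e1 : st3 aCen = st2 aCen by frame s3.
have e2 : st3 aDead = st aDead by frame s3; frame s2; frame s1.
rewrite e1 e2 -/es1 => st4 t4 s4 [a4 it4].
have e3 : st4 aMark = st3 aMark by frame s4.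
have e4 : st2 aMark = st aMark by frame s2; frame s1.
rewrite e4 in m3 f3; exists (count (fun v => st2 aIsc v != 0) (iota 0 n)) => //.
rewrite e3 a4; split=> //.
- move=> k u v /(reach_split (gr (kept (st2 aCen) es1))) [|]; first by left.
  move=> [x [y [a [b [le h1 h2 h3 h4]]]]]; right.
  have : miss (st2 aCen) x y by move: h3; rewrite gr_kept h2 /= negbK.
  have [xn _ _] := gr_lt sim1 h2.
  case/and5P => cx _ _ _ _; case ec : (st2 aCen x) cx => [//|c] _.
  have [cn ic gc] := c1 _ _ xn ec.
  have R1 : reach (sp es n (st3 aMark)) (1 + a) c u.
    apply: r3 => //; apply: reach_trans (reach1 gc) _.
    exact: reach_sym (@gr_sym _) h1.
  have R2 : reach (sp es n (st3 aMark)) (1 + b.+1) c v.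
    apply: r3 => //; apply: reach_trans (reach1 gc) _.
    by rewrite -add1n; apply: reach_trans h4; exact: reach1.
  apply: reach_le (reach_trans (reach_sym (@sp_sym _ _ _) R1) R2); lia.
- split; first exact: (size_kept sim1 c2).
  by rewrite size_filter count_size.
have sz1 : size es1 <= size es.
  by rewrite size_map size_filter; apply: leq_trans (count_size _ _) _; rewrite size_iota.
move: (count _ (iota 0 n)) it3 => K it3.
set A := n + size es1 + 1 in it2 it3 *.
have := leq0n (ecost thr * A); have := leq0n (ecost thr * (n + size es)).
have := leq0n (K * A); have := leq0n (ecost thr * (K * A)).
by lia.
Qed.

(** * Missing edges on tree paths *)

(* lm w is the last vertex of the tree path to w whose parent edge is missing;
   the trace lists the k last such vertices, starting from w. *)
Definition trace (lm p : nat -> nat) k w := mkseq (fun j => lm (iter j (p \o lm) w)) k.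

Lemma traceS lm p k w : trace lm p k.+1 w = lm w :: trace lm p k (p (lm w)).
Proof.
rewrite /trace /mkseq /= -[1]addn0 iotaDl -map_comp; congr (_ :: _).
by apply: eq_map => j; rewrite -[RHS]/(lm (iter j (p \o lm) ((p \o lm) w))) -iterSr.
Qed.

(** [cnt w] is the number of missing edges on the tree path to [w]. The recurrences are consistent
    at the root, where [p c = c] and [miss] is irreflexive; they leave [lm] arbitrary where [cnt] is
    0. *)
Definition counted c (Q : seq nat) cen (p cnt lm : nat -> nat) :=
  cnt c = 0 /\ forall w, w \in Q ->
    cnt w = cnt (p w) + miss cen (p w) w /\
    lm w = if miss cen (p w) w then w else lm (p w).

Lemma missxx cen x : miss cen x x = false.
Proof. by rewrite /miss eqxx !andbF. Qed.

(** Induction on queue positions: [w] inherits the decomposition of its parent, prolonged by a kept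
    edge, unless its own parent edge is missing. Thus below [lm w] the tree path consists of kept
    edges. *)
Lemma last_missing n es c Q d p cen cnt lm w :
  bfs_tree n es c Q d p -> counted c Q cen p cnt lm -> w \in Q ->
  if cnt w is k.+1 then let y := lm w in
    [/\ y \in Q /\ miss cen (p y) y, cnt y = k.+1, p y \in Q /\ cnt (p y) = k,
      index y Q <= index w Q & d y = (d (p y)).+1 /\
      exists2 a, d w = d y + a & reach (gr (kept cen es)) a y w]
  else reach (gr (kept cen es)) (d w) c w.
Proof.
move=> T [c0 hc]; have [k] := ubnP (index w Q); elim: k w => // k IH w hk wQ.
have [->|wc] := eqVneq w c; first by rewrite c0 (bt_rootd T).1; exact: reach0.
have [pQ pg pd pi] := bt_par T wQ wc.
have [h1 h2] := hc _ wQ.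
case mk : (miss cen (p w) w) h1 h2; rewrite ?addn1 ?addn0 => h1 h2.
  rewrite {1}h1 h2; split=> //; split=> //; exists 0; rewrite ?addn0 //.
  exact: reach0.
have gk : gr (kept cen es) (p w) w by rewrite gr_kept pg mk.
have {IH} := IH (p w) _ pQ; rewrite h1.
case: (cnt (p w)) => [|k'] /=.
  by move=> h; rewrite pd -addn1; apply: reach_trans (h _) (reach1 gk); lia.
rewrite h2 => /(_ _)[|a1 a2 a3 a4 [a5 [a a6 a7]]]; first by lia.
split=> //; [by lia|split=> //; exists a.+1; [by lia|]].
by rewrite -addn1; apply: reach_trans a7 (reach1 gk).
Qed.

Lemma trace_mem n es c Q d p cen cnt lm w :
  bfs_tree n es c Q d p -> counted c Q cen p cnt lm -> w \in Q ->
  forall y, y \in trace lm p (cnt w) w -> [/\ y \in Q, miss cen (p y) y &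
    exists2 a, d w = d y + a & reach (gr es) a y w].
Proof.
move=> T C; move e : (cnt w) => k; elim: k w e => // k IH w e wQ y.
have := last_missing T C wQ; rewrite e => -[[b1 b2] b3 [b4 b5] b6 [b7 [a b8 b9]]].
have b9' : reach (gr es) a (lm w) w by apply: reach_sub b9; exact: sub_kept.
rewrite traceS inE => /orP[/eqP ->|hy]; first by split=> //; exists a.
have [c1 c2 [a' c3 c4]] := IH _ b5 b4 _ hy; split=> //.
exists (a' + 1 + a); first by lia.
apply: reach_trans b9'; apply: reach_trans c4 _; apply: reach1.
have nc : lm w != c by apply: contraTneq b2 => ->; rewrite (bt_rootd T).2 missxx.
by have [] := bt_par T b1 nc.
Qed.

Lemma trace_pairwise n es c Q d p cen cnt lm w :
  bfs_tree n es c Q d p -> counted c Q cen p cnt lm -> w \in Q ->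
  pairwise (fun x y => d y < d x) (trace lm p (cnt w) w).
Proof.
move=> T C; move e : (cnt w) => k; elim: k w e => // k IH w e wQ.
have := last_missing T C wQ; rewrite e => -[[b1 b2] b3 [b4 b5] b6 [b7 _]].
rewrite traceS /= IH // andbT; apply/allP => y; rewrite -b5 => hy.
have [_ _ [a h _]] := trace_mem T C b4 hy; lia.
Qed.

(** A tree path is kept segments joined by the missing edges of its trace. Once the kept edges are
    in the spanner, realising the path to [w] therefore costs [cnt w] further edges, however long
    the path is. *)
Lemma trace_reach n es c Q d p cen cnt lm w (g : rel nat) :
  bfs_tree n es c Q d p -> counted c Q cen p cnt lm -> w \in Q ->
  subrel (gr (kept cen es)) g ->
  (forall y, y \in trace lm p (cnt w) w -> g (p y) y) -> reach g (d w) c w.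
Proof.
move=> T C + sub; move e : (cnt w) => k; elim: k w e => [|k IH] w e wQ.
  by have := last_missing T C wQ; rewrite e => h _; exact: reach_sub h.
have := last_missing T C wQ; rewrite e => -[[b1 b2] b3 [b4 b5] b6 [b7 [a b8 b9]]].
rewrite traceS => h; rewrite b8; apply: reach_trans (reach_sub sub b9).
rewrite b7 -addn1; apply: reach_trans (reach1 (h _ (mem_head _ _))).
by apply: IH => // y hy; apply: h; rewrite inE hy orbT.
Qed.

(** The count rises by at most one per tree edge, so it takes the value [q.+1] at a missing edge
    above or at [w]. Cutting there gives all recorded sets the same size [q.+1]. *)
Lemma trace_cut n es c Q d p cen cnt lm q w :
  bfs_tree n es c Q d p -> counted c Q cen p cnt lm -> w \in Q -> q < cnt w ->
  exists2 y, y \in Q & [/\ miss cen (p y) y, cnt y = q.+1 &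
    exists2 a, d w = d y + a & reach (gr es) a y w].
Proof.
move=> T C; move e : (cnt w) => k; elim: k w e => // k IH w e wQ.
have := last_missing T C wQ; rewrite e => -[[b1 b2] b3 [b4 b5] b6 [b7 [a b8 b9]]].
have b9' : reach (gr es) a (lm w) w by apply: reach_sub b9; exact: sub_kept.
rewrite ltnS leq_eqVlt => /orP[/eqP eq|lt].
  by exists (lm w) => //; split; [|rewrite b3 eq|exists a].
have [y yQ [c1 c2 [a' c3 c4]]] := IH _ b5 b4 lt; exists y => //; split=> //.
exists (a' + 1 + a); first by lia.
apply: reach_trans b9'; apply: reach_trans c4 _; apply: reach1.
have nc : lm w != c by apply: contraTneq b2 => ->; rewrite (bt_rootd T).2 missxx.
by have [] := bt_par T b1 nc.
Qed.

(* The tree path is a shortest path, and two neighbours of the centre s are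
   at distance 2 at most. *)
Lemma trace_mult n es c Q d p cen isc T cnt lm w s :
  bfs_post n es c Q d p -> clustering n es T cen isc ->
  counted c Q cen p cnt lm -> w \in Q ->
  count (fun y => cen y == s.+1) (trace lm p (cnt w) w) <= 3.
Proof.
move=> [tree compl] [hc _ _] C wQ; rewrite -size_filter.
set F := filter _ _.
have pw : pairwise (fun x y => d y < d x) F.
  by apply: subseq_pairwise (trace_pairwise tree C wQ); exact: filter_subseq.
have near y z : y \in F -> z \in F -> d z <= d y + 2.
  rewrite !mem_filter => /andP[/eqP cy yT] /andP[/eqP cz zT].
  have [yQ _ _] := trace_mem tree C wQ yT; have [zQ _ _] := trace_mem tree C wQ zT.
  have [_ _ gy] := hc _ _ (bt_lt tree yQ) cy; have [_ _ gz] := hc _ _ (bt_lt tree zQ) cz.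
  have [|_] := compl (d y + (1 + 1)) z; last by [].
  have r := tree_reach (g := gr es) tree.
  apply: reach_trans (r _ _ yQ) _; first by move=> v vQ vc; have [] := bt_par tree vQ vc.
  by apply: reach_trans (reach1 _) (reach1 gz); rewrite gr_sym.
case: F pw near => // y F /= /andP[/allP h1 h2] near.
have u : uniq (map d (y :: F)).
  rewrite /= map_inj_in_uniq; last first.
    move=> x z hx hz; elim: F h2 hx hz {h1 near} => // v F IH /= /andP[/allP h1 h2].
    rewrite !inE => /orP[/eqP ->|hx] /orP[/eqP ->|hz] // e; last exact: IH.
      by have := h1 _ hz; lia.
    by have := h1 _ hx; lia.
  apply/andP; split; first by apply/mapP => -[z /h1]; lia.
  elim: F h2 {h1 near} => //= v F IH /andP[/allP h1 /IH ->]; rewrite andbT.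
  by apply/negP => /h1; rewrite ltnn.
(* The first element [y] is the deepest and all depths lie within 2 of each other, so strictly
   decreasing depths take at most three values. *)
rewrite -(size_map d) -[3]/(size [:: d y; (d y).-1; (d y).-2]).
apply: uniq_leq_size u _ => i /mapP[z hz ->].
have l1 := near z y hz (mem_head _ _).
have l2 : d z <= d y by move: hz; rewrite inE => /orP[/eqP ->|/h1/ltnW].
by rewrite !inE; lia.
Qed.

(** * Programs that count, follow and record missing edges *)

Notation aCnt := 23 (only parsing).
Notation aLm := 24 (only parsing).
Notation aBest := 25 (only parsing).
Notation aY := 26 (only parsing).
Notation aW := 27 (only parsing).
Notation aP := 28 (only parsing).
Notation aLen := 29 (only parsing).
Notation aTab := 30 (only parsing).
Notation aNs := 31 (only parsing).
Notation aZ := 32 (only parsing).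

Definition pKeep : cmd :=
  (For aI ($aM) (If (aDead@[$aI]) Skip
     (If (missE (aU@[$aI]) (aV@[$aI])) Skip
        (Assign aMark (aU@[$aI] * $aN + aV@[$aI]) #1))))%P.

Lemma keep_spec n es st t : inp n es st ->
  let ke := kept (st aCen) (alive es (st aDead)) in
  wp pKeep (fun st' t' => [/\ mle (st aMark) (st' aMark),
    subrel (gr ke) (sp es n (st' aMark)),
    forall F, few (st aMark) F -> few (st' aMark) (F + size ke) &
    t' <= t + 100 * (size es + 1)]) st t.
Proof.
move=> [hn hm he] ke.
pose al k := kept (st aCen) [seq nth (0, 0) es e | e <- iota 0 k & st aDead e == 0].
apply: (@wp_for _ _ _ (fun k st' t' => [/\ mle (st aMark) (st' aMark),
  forall e, e \in al k -> st' aMark (e.1 * n + e.2) != 0,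
  forall F, few (st aMark) F -> few (st' aMark) (F + size (al k)) &
  t' <= t + 90 * k])) => //.
- by norm; split=> //; [move=> F; rewrite addn0|lia].
- move=> k st1 t1 /=; rewrite hm => hk s1 ik [i1 i2 i3 it].
  have eD : st1 aDead = st aDead by frame s1.
  have eC : st1 aCen = st aCen by frame s1.
  have eN : st1 aN 0 = n by frame s1.
  have eU : st1 aU k = (nth (0, 0) es k).1 by frame s1; rewrite -he.
  have eV : st1 aV k = (nth (0, 0) es k).2 by frame s1; rewrite -he.
  have alS : al k.+1 = if (st aDead k == 0) && ~~ miss (st aCen) (nth (0, 0) es k).1 (nth (0, 0) es k).2
      then rcons (al k) (nth (0, 0) es k) else al k.
    rewrite /al /kept iota_rcons filter_rcons; case: ifP => //= _.
    by rewrite map_rcons filter_rcons.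
  apply: wp_if => /=; rewrite ik eD => hd.
    by apply: wp_skip; norm; rewrite alS (negPf hd) /=; split=> //; lia.
  apply: wp_if; rewrite den_missE /= ik eU eV eC.
    case mk : (miss _ _ _) => // _.
    by apply: wp_skip; norm; rewrite alS hd mk /=; split=> //; lia.
  case mk : (miss _ _ _) => // _; apply: wp_assign; norm.
  rewrite ik eU eV eN alS hd mk /=; split; last by lia.
  + by apply: mle_trans i1 _; exact: mle_upd.
  + move=> e; rewrite mem_rcons inE /upd => /orP[/eqP ->|/i2 h]; first by rewrite eqxx.
    by case: ifP.
  + by move=> F /i3; rewrite size_rcons addnS; exact: few_upd.
move=> st1 t1 s1 /=; rewrite hm => -[i1 i2 i3 it]; split=> //; last by lia.
move=> x y g; have gxy : gr es x y.
  by apply: gr_sub (sub_kept g); exact: alive_sub.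
by rewrite /sp gxy /=; case/orP: g => /i2 /= ->; rewrite ?orbT.
Qed.

Definition pCount : cmd :=
  (Assign aCnt $aSrc #0 ;;
   For aI ($aTail)
     ((aW <~ aQue@[$aI]) ;; (aP <~ aPar@[$aW]) ;;
      If (missE $aP $aW)
        (Assign aCnt $aW (aCnt@[$aP] + #1) ;; Assign aLm $aW $aW)
        (Assign aCnt $aW (aCnt@[$aP]) ;; Assign aLm $aW (aLm@[$aP]))))%P.

Lemma count_spec n es c st t : let Q := mkseq (st aQue) (st aTail 0) in
  bfs_tree n es c Q (st aDist) (st aPar) -> st aSrc 0 = c ->
  wp pCount (fun st' t' => counted c Q (st aCen) (st aPar) (st' aCnt) (st' aLm) /\
    t' <= t + 100 * (n + 1)) st t.
Proof.
move=> Q T hc.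
have tQ : st aTail 0 = size Q by rewrite size_mkseq.
have sQ : size Q <= n := size_bound (bt_uniq T) (bt_lt T).
have [r1 r2] := bt_root T.
apply: wp_seq; apply: wp_assign; norm; rewrite hc.
apply: (@wp_for _ _ _ (fun k st' t' => [/\ st' aCnt c = 0,
  forall w, w \in take k Q ->
    st' aCnt w = st' aCnt (st aPar w) + miss (st aCen) (st aPar w) w /\
    st' aLm w = if miss (st aCen) (st aPar w) w then w else st' aLm (st aPar w) &
  t' <= t + 20 + 80 * k])) => //.
- by norm; split=> //; [rewrite take0|lia].
- move=> k st1 t1; norm; rewrite tQ => hk s1 ik [i1 i2 it].
  have eP : st1 aPar = st aPar by frame s1; norm.
  have eC : st1 aCen = st aCen by frame s1; norm.
  have eq : st1 aQue k = nth 0 Q k by frame s1; norm; rewrite nth_mkseq ?tQ.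
  have tk : take k.+1 Q = rcons (take k Q) (nth 0 Q k) by exact: take_nth.
  move: eq tk; set w := nth 0 Q k => eq tk.
  have wQ : w \in Q by exact: mem_nth.
  have uk : uniq (rcons (take k Q) w) by rewrite -tk take_uniq // (bt_uniq T).
  have wk : w \notin take k Q by move: uk; rewrite rcons_uniq => /andP[].
  (* At the root the program reads the very cells that it writes, so that case is separated: it
     happens only for [k = 0], and there both updates write back the old value. *)
  have cw : (st aPar w = w /\ w = c /\ k = 0) \/ (st aPar w != w /\ c != w).
    have [e|ne] := eqVneq w c.
      left; rewrite e (bt_rootd T).2; split=> //; split=> //.
      by apply/eqP; rewrite -(nth_uniq 0 hk r1 (bt_uniq T)) r2 -e.
    right; split=> //.
    have [_ _ _] := bt_par T wQ ne; apply: contraTneq => ->; rewrite ltnn //.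
  (* Queue order: the recurrence at an earlier [v] mentions only [v] and its parent, and neither is
     overwritten when [w] is treated. *)
  have old v : v \in take k Q -> v != w /\ st aPar v != w.
    move=> vk; have vQ := mem_take vk.
    split; first by apply: contraNneq wk => <-.
    have [->|vc] := eqVneq v c.
      rewrite (bt_rootd T).2; case: cw => [[_ [e k0]]|[_ //]].
      by rewrite k0 take0 in vk.
    have [_ _ _ hi] := bt_par T vQ vc; apply: contraTneq hi => ->.
    rewrite -leqNgt /w index_uniq ?(bt_uniq T) //.
    rewrite -[X in index v X](cat_take_drop k Q) index_cat vk.
    by apply: leq_trans (index_size _ _) _; rewrite size_take hk.
  apply: wp_seq; apply: wp_assign; norm; rewrite ik eq.
  apply: wp_seq; apply: wp_assign; norm; rewrite eP.
  apply: wp_if; rewrite den_missE; norm; rewrite eC; case mk : (miss _ _ _) => // _.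
    apply: wp_seq; do 2 (apply: wp_assign; norm).
    case: cw => [[e _]|[pw cw]]; first by rewrite e missxx in mk.
    split; last by lia.
      by rewrite upd_neq.
    move=> v; rewrite tk mem_rcons inE => /orP[/eqP ->|vk].
      by rewrite !upd_eq mk upd_neq.
    have [h1 h2] := old _ vk; have [h3 h4] := i2 _ vk.
    by rewrite !upd_neq.
  apply: wp_seq; do 2 (apply: wp_assign; norm).
  split; last by lia.
    by case: cw => [[-> [-> _]]|[pw cw]]; [rewrite upd_eq|rewrite upd_neq].
  move=> v; rewrite tk mem_rcons inE => /orP[/eqP ->|vk].
    rewrite !upd_eq mk addn0; case: cw => [[-> _]|[pw _]]; first by rewrite !upd_eq.
    by rewrite !upd_neq.
  have [h1 h2] := old _ vk; have [h3 h4] := i2 _ vk.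
  by rewrite !upd_neq.
move=> st1 t1 s1; norm; rewrite tQ take_size => -[i1 i2 it]; split; last by lia.
by split.
Qed.

Definition pTrace act : cmd :=
  ((aY <~ $aW) ;;
   For aJ (aCnt@[$aW]) ((aY <~ aLm@[$aY]) ;; act ;; (aY <~ aPar@[$aY])))%P.

(** Loop rule for an action performed at every missing edge of a tree path, from the bottom up. The
    invariant must be insensitive to the scratch arrays [aY] and [aJ]. The control costs 23 per
    round and 14 besides. *)
Lemma wp_trace act (I : nat -> store -> nat -> Prop) (Q : store -> nat -> Prop) st t :
  all (fun a => a \notin mods act) [:: aY; aJ; aW; aCnt; aLm; aPar] ->
  (forall j st' a x t', a \in [:: aY; aJ] -> I j st' t' -> I j (update st' a 0 x) t') ->
  let w := st aW 0 in let k := st aCnt w in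
  I 0 st t ->
  (forall j st' t', j < k -> same (mods (pTrace act)) st st' ->
     st' aY 0 = nth 0 (trace (st aLm) (st aPar) k w) j -> I j st' t' ->
     wp act (I j.+1) st' t') ->
  (forall st' t', same (mods (pTrace act)) st st' -> I k st' t' -> Q st' (t' + (23 * k + 14))) ->
  wp (pTrace act) Q st t.
Proof.
rewrite /= => /and5P[a1 a2 a3 a4 /and3P[a5 a6 _]] upI I0 hact hQ.
set w := st aW 0 in I0 hact hQ *; set k := st aCnt w in hact hQ *.
have sub a : a \in aJ :: mods ((aY <~ aLm@[$aY]) ;; act ;; (aY <~ aPar@[$aY]))%P ->
    a \in mods (pTrace act).
  by rewrite /= !(inE, mem_cat); case: (a == aJ); case: (a == aY); case: (a \in mods act).
have notin b : b \notin mods act -> b != aY -> b != aJ -> b \notin mods (pTrace act).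
  by rewrite /= !(inE, mem_cat) => /negPf -> /negPf -> /negPf ->.
pose step := st aPar \o st aLm.
apply: wp_seq; apply: wp_assign => /=; rewrite -/w.
apply: (@wp_for _ _ _ (fun j st' t' => st' aY 0 = iter j step w /\
  exists2 t1, I j st' t1 & t' = t1 + 4 + 23 * j)).
- by rewrite /= !(inE, mem_cat) (negPf a2).
- by rewrite /= !(inE, mem_cat) (negPf a3) (negPf a4).
- norm; split=> //; exists t; last by lia.
  by do 2 apply: (upI) => //.
- move=> j st1 t1; norm; rewrite -/k => hj s1 ij [i1 [t1' i2 ->]].
  have s1' : same (mods (pTrace act)) st st1.
    apply: same_trans (same_sub sub s1).
    by apply: same_update; rewrite /= inE.
  have eP : st1 aPar = st aPar by rewrite s1' // notin.
  have eL : st1 aLm = st aLm by rewrite s1' // notin.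
  apply: wp_seq; apply: wp_assign; norm; rewrite i1 eL.
  apply: wp_seq; set st2 := update _ _ _ _.
  have s2 : same (mods (pTrace act)) st st2.
    by apply: same_trans s1' _; apply: same_update; rewrite /= inE.
  have [||st3 [t3 [h3 i3]]] := hact j st2 t1' hj s2; first by rewrite /st2; norm; rewrite nth_mkseq.
    exact: upI.
  exists st3, t3; split=> //; apply: wp_assign; norm.
  have s3 := big_same h3.
  have eP3 : st3 aPar = st aPar by rewrite s3 // /st2; norm; rewrite eP.
  have eY3 : st3 aY 0 = st aLm (iter j step w) by rewrite s3 // /st2; norm.
  rewrite eP3 eY3; split=> //; exists (t1' + t3); last by lia.
  by do 2 apply: (upI) => //.
move=> st1 t1 s1; norm; rewrite -/k => -[i1 [t1' i2 ->]].
have s1' : same (mods (pTrace act)) st st1.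
  apply: same_trans (same_sub sub s1).
  by apply: same_update; rewrite /= inE.
have -> : t1' + 4 + 23 * k + 10 = t1' + (23 * k + 14) by lia.
exact: hQ.
Qed.

(** Transposed incidences: cluster [j] lists the numbers of the sets containing it, repeated with
    multiplicity and increasing, which is the order in which the program pushes them. *)
Definition lists (sets : seq (seq nat)) j :=
  flatten [seq nseq (count_mem j (nth [::] sets id)) id | id <- iota 0 (size sets)].

Lemma den_op st o e1 e2 : den st (Op o e1 e2) = binop_eval o (den st e1) (den st e2).
Proof. by []. Qed.

Lemma lists_rcons sets S j :
  lists (rcons sets S) j = lists sets j ++ nseq (count_mem j S) (size sets).
Proof.
rewrite /lists size_rcons iota_rcons map_rcons flatten_rcons nth_rcons ltnn eqxx.
congr (flatten _ ++ _); apply/eq_in_map => i; rewrite mem_iota nth_rcons => /= hi.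
by rewrite hi.
Qed.

Lemma lists_push sets S z j :
  lists (rcons sets (rcons S z)) j =
  if j == z then rcons (lists (rcons sets S) j) (size sets) else lists (rcons sets S) j.
Proof.
rewrite !lists_rcons -cats1 count_cat /= addn0 eq_sym.
by case: (j == z); rewrite ?addn0 // addn1 rcons_cat; congr (_ ++ _); elim: (count_mem _ _) => //= k ->.
Qed.

(** The common size makes double counting work, and the bound 3 comes from [trace_mult]. *)
Definition set_ok n isc q (S : seq nat) :=
  [/\ size S = q.+1, forall s, s \in S -> s < n /\ isc s != 0 &
      forall s, count_mem s S <= 3].

Definition pPush : cmd :=
  ((aZ <~ aCen@[$aY] - #1) ;; Assign aTab (aLen@[$aZ] * $aN + $aZ) $aNs ;;
   Assign aLen $aZ (aLen@[$aZ] + #1))%P.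

(** A set is recorded only at the lower end of a missing edge with count exactly [q + 1]. Deeper
    vertices share the set of their ancestor, so a centre contributes at most one set per vertex. *)
Definition pSets : cmd :=
  (For aI ($aTail)
    ((aW <~ aQue@[$aI]) ;;
     when (missE (aPar@[$aW]) $aW * (aCnt@[$aW] == $aQ + #1))
       (pTrace pPush ;; (aNs <~ $aNs + #1))))%P.

Definition clusters_of (cen lm p : nat -> nat) k w := [seq (cen z).-1 | z <- trace lm p k w].

Lemma clusters_of_ok n es c Q d p cen isc T cnt lm w q :
  bfs_post n es c Q d p -> clustering n es T cen isc ->
  counted c Q cen p cnt lm -> w \in Q -> cnt w = q.+1 ->
  set_ok n isc q (clusters_of cen lm p q.+1 w).
Proof.
move=> post cl C wQ cw; have [tree _] := post; have [hc _ _] := cl.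
have mem := trace_mem tree C wQ; rewrite cw in mem.
split; first by rewrite size_map size_mkseq.
  move=> s /mapP[z /mem[zQ mz _] ->]; move: mz => /and5P[_ + _ _ _].
  case e : (cen z) => [//|s'] _ /=.
  by have [] := hc _ _ (bt_lt tree zQ) e.
move=> s; have := trace_mult s post cl C wQ; rewrite cw => h; apply: leq_trans h.
rewrite /clusters_of count_map.
rewrite leq_eqVlt; apply/orP; left; apply/eqP; apply: eq_in_count => z /mem[_ mz _] /=.
by move: mz => /and5P[_ + _ _ _]; case: (cen z).
Qed.

Lemma sets_spec n es c T q sets st t : let Q := mkseq (st aQue) (st aTail 0) in
  bfs_post n es c Q (st aDist) (st aPar) -> clustering n es T (st aCen) (st aIsc) ->
  counted c Q (st aCen) (st aPar) (st aCnt) (st aLm) ->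
  st aN 0 = n -> st aQ 0 = q ->
  table n (lists sets) (st aLen) (st aTab) -> st aNs 0 = size sets ->
  wp pSets (fun st' t' => (exists X,
    [/\ size X <= n, table n (lists (sets ++ X)) (st' aLen) (st' aTab),
      st' aNs 0 = size (sets ++ X), forall S, S \in X -> set_ok n (st aIsc) q S &
      forall w, w \in Q -> miss (st aCen) (st aPar w) w -> st aCnt w = q.+1 ->
        clusters_of (st aCen) (st aLm) (st aPar) q.+1 w \in X]) /\
    t' <= t + 200 * (n * (q + 2) + 1)) st t.
Proof.
move=> Q post cl C hn hq tab hs; have [tree _] := post.
have tQ : st aTail 0 = size Q by rewrite size_mkseq.
have sQ : size Q <= n := size_bound (bt_uniq tree) (bt_lt tree).
apply: (@wp_for _ _ _ (fun k st' t' => (exists X,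
    [/\ size X <= k, table n (lists (sets ++ X)) (st' aLen) (st' aTab),
      st' aNs 0 = size (sets ++ X), forall S, S \in X -> set_ok n (st aIsc) q S &
      forall w, w \in take k Q -> miss (st aCen) (st aPar w) w -> st aCnt w = q.+1 ->
        clusters_of (st aCen) (st aLm) (st aPar) q.+1 w \in X]) /\
    t' <= t + 190 * (k * (q + 2)))) => //.
- split; last by lia.
  by exists [::]; split; rewrite ?cats0 ?take0.
- move=> k st1 t1; rewrite /= tQ => hk s1 ik [[X [x1 x2 x3 x4 x5]] it].
  have eq : st1 aQue k = nth 0 Q k by frame s1; rewrite nth_mkseq ?tQ.
  have tk : take k.+1 Q = rcons (take k Q) (nth 0 Q k) by exact: take_nth.
  move: eq tk; set w := nth 0 Q k => eq tk.
  have wQ : w \in Q by exact: mem_nth.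
  apply: wp_seq; apply: wp_assign; norm; rewrite ik eq.
  have eP : st1 aPar = st aPar by frame s1.
  have eC : st1 aCen = st aCen by frame s1.
  have eN : st1 aCnt = st aCnt by frame s1.
  have eL : st1 aLm = st aLm by frame s1.
  have eQ : st1 aQ 0 = q by frame s1.
  have en : st1 aN 0 = n by frame s1.
  have qk : k.+1 * (q + 2) = k * (q + 2) + (q + 2) by rewrite mulSn addnC.
  apply: wp_if; rewrite den_op den_missE; norm; rewrite eP eC eN eQ => mw; last first.
    apply: wp_skip; norm; split; last by lia.
    exists X; split=> //; first exact: leqW.
    move=> v; rewrite tk mem_rcons inE => /orP[/eqP ->|vk]; last exact: x5.
    by move=> m1 m2; move: mw; rewrite m1 m2 addn1 eqxx.
  have /andP[mk /eqP cw] : miss (st aCen) (st aPar w) w && (st aCnt w == q.+1).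
    by move: mw; rewrite addn1; case: (miss _ _ _); case: (_ == q.+1).
  have [S SE] : exists S, S = clusters_of (st aCen) (st aLm) (st aPar) q.+1 w by eexists.
  have Sok : set_ok n (st aIsc) q S by rewrite SE; exact: clusters_of_ok post cl C wQ cw.
  have [sS memS _] := Sok.
  (* The set under construction carries the next free number, hence the prefix [take j S] appended
     last; the counter [aNs] moves only when the trace is finished. *)
  apply: wp_seq; apply: (@wp_trace pPush (fun j st' t' =>
    [/\ table n (lists (rcons (sets ++ X) (take j S))) (st' aLen) (st' aTab),
        st' aNs 0 = size (sets ++ X) & t' <= t1 + 10 + 80 + 40 * j])) => //.
  + by move=> j st' a x t'; rewrite !inE => /orP[] /eqP ->.
  + norm; split=> //; last by lia.
    rewrite ?take0; apply: eq_table x2 => v _; by rewrite lists_rcons /= cats0.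
  + move=> j st2 t2; norm; rewrite eN eL eP cw => hj s2 ey [y1 y2 y3].
    have hjS : j < size S by rewrite sS.
    have e1 : st2 aCen = st aCen by frame s2; norm; rewrite eC.
    have e2 : st2 aN 0 = n by frame s2; norm.
    apply: wp_seq; apply: wp_assign; norm; rewrite ey e1 subn1.
    have -> : (st aCen (nth 0 (trace (st aLm) (st aPar) q.+1 w) j)).-1 = nth 0 S j.
      by rewrite SE /clusters_of (nth_map 0) ?size_mkseq.
    apply: wp_seq; apply: wp_assign; norm; apply: wp_assign; norm.
    rewrite e2 y2 addn1; split; [|by []|by lia].
    have [zn _] := memS _ (mem_nth 0 hjS).
    apply: eq_table (table_push (size (sets ++ X)) y1 zn) => v hv.
    by rewrite (take_nth 0 hjS) lists_push.
  move=> st2 t2 s2; norm; rewrite eN cw -sS take_size => -[y1 y2 y3].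
  rewrite sS in y3 *; apply: wp_assign; norm; rewrite y2 addn1 qk; split; last by lia.
  exists (rcons X S); split.
  + by rewrite size_rcons.
  + by rewrite -rcons_cat.
  + by rewrite -rcons_cat size_rcons.
  + by move=> S'; rewrite mem_rcons inE => /orP[/eqP ->|/x4].
  + move=> v; rewrite tk !mem_rcons !inE => /orP[/eqP -> _ _|vk m1 m2]; first by rewrite SE eqxx.
    by rewrite x5 ?orbT.
move=> st1 t1 s1; rewrite /= tQ take_size => -[[X [x1 x2 x3 x4 x5]] it]; split.
  by exists X; split=> //; exact: leq_trans sQ.
have := leq_mul sQ (leqnn (q + 2)); lia.
Qed.

Definition pMark : cmd := (Assign aMark (aPar@[$aY] * $aN + $aY) #1)%P.

(** [aBest] is a mere flag: the queue is sorted by distance, so the first suitable vertex met in a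
    cluster is a nearest one. *)
Definition pPaths : cmd :=
  (For aI ($aN) (Assign aBest $aI #0) ;;
   For aI ($aTail)
    ((aW <~ aQue@[$aI]) ;;
     when ((#0 < aCen@[$aW]) * (aCnt@[$aW] < $aQ + #1))
       (when (aBest@[aCen@[$aW] - #1] < #1)
          (Assign aBest (aCen@[$aW] - #1) #1 ;; pTrace pMark))))%P.

Lemma paths_spec n es c T q st t : let Q := mkseq (st aQue) (st aTail 0) in
  bfs_post n es c Q (st aDist) (st aPar) -> clustering n es T (st aCen) (st aIsc) ->
  counted c Q (st aCen) (st aPar) (st aCnt) (st aLm) ->
  st aN 0 = n -> st aQ 0 = q ->
  let K := count (fun v => st aIsc v != 0) (iota 0 n) in
  wp pPaths (fun st' t' => [/\ mle (st aMark) (st' aMark),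
      forall y s, y \in Q -> st aCen y = s.+1 -> st aCnt y <= q ->
        exists2 y0, y0 \in Q /\ st aCen y0 = s.+1 & st aDist y0 <= st aDist y /\
          forall z, z \in trace (st aLm) (st aPar) (st aCnt y0) y0 ->
            st' aMark (st aPar z * n + z) != 0,
      forall F, few (st aMark) F -> few (st' aMark) (F + K * q) &
      t' <= t + 300 * (n * (q + 2) + 1)]) st t.
Proof.
move=> Q post cl C hn hq K; have [tree _] := post; have [hcl _ _] := cl.
have tQ : st aTail 0 = size Q by rewrite size_mkseq.
have sQ : size Q <= n := size_bound (bt_uniq tree) (bt_lt tree).
apply: wp_seq; apply: (@wp_for _ _ _ (fun k st' t' =>
   (forall v, v < k -> st' aBest v = 0) /\ t' <= t + 20 * k)) => //.
- by split=> //; lia.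
- move=> k st1 t1 hk s1 ik [i1 it]; apply: wp_assign; norm; rewrite ik; split; last by lia.
  by move=> v hv; rewrite /upd; case: eqVneq => // ne; apply: i1; lia.
move=> st1 t1 s1 [i1 it] /=; rewrite /= hn in i1 it.
pose traced (mk : nat -> nat) y := forall z, z \in trace (st aLm) (st aPar) (st aCnt y) y ->
  mk (st aPar z * n + z) != 0.
have traced_le mk mk' y : mle mk mk' -> traced mk y -> traced mk' y.
  by move=> h h1 z /h1/h.
apply: (@wp_for _ _ _ (fun k st' t' => [/\ mle (st aMark) (st' aMark),
  forall s, s < n -> st' aBest s != 0 -> st aIsc s != 0 /\ exists2 y0, y0 \in take k Q &
    st aCen y0 = s.+1 /\ traced (st' aMark) y0,
  forall y s, y \in take k Q -> st aCen y = s.+1 -> st aCnt y <= q ->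
    exists2 y0, y0 \in Q /\ st aCen y0 = s.+1 & st aDist y0 <= st aDist y /\
    traced (st' aMark) y0,
  forall F, few (st aMark) F ->
    few (st' aMark) (F + count (fun v => st' aBest v != 0) (iota 0 n) * q) &
  t' <= t1 + 9 + 200 * (k * (q + 2))])) => //.
- have e : update st1 aI 0 0 aMark = st aMark by norm; frame s1.
  rewrite e; norm; split=> //; first by move=> s /i1 ->.
  + by move=> y s; rewrite take0.
  + move=> F; rewrite (eq_in_count (a2 := pred0)) ?count_pred0 ?addn0 // => v.
    by rewrite mem_iota => /i1 ->.
  + by lia.
- move=> k st2 t2; rewrite /= (s1 aTail isT) tQ => hk s2 ik [j1 j2 j3 j4 jt].
  have eq : st2 aQue k = nth 0 Q k by frame s2; frame s1; rewrite nth_mkseq ?tQ.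
  have tk : take k.+1 Q = rcons (take k Q) (nth 0 Q k) by exact: take_nth.
  have [w wE] : exists w, w = nth 0 Q k by eexists.
  rewrite -wE in eq tk.
  have wQ : w \in Q by rewrite wE; exact: mem_nth.
  have wn : w < n := bt_lt tree wQ.
  (* This is where queue order turns the first suitable vertex of a cluster into one at minimal
     distance. *)
  have front y : y \in take k Q -> st aDist y <= st aDist w.
    move=> /(nthP 0)[i hi <-]; rewrite size_take hk in hi.
    by rewrite nth_take // wE; apply: (bt_mono tree); lia.
  have sub y : y \in take k Q -> y \in take k.+1 Q by rewrite tk mem_rcons inE => ->; rewrite orbT.
  apply: wp_seq; apply: wp_assign; norm; rewrite ik eq.
  have eP : st2 aPar = st aPar by frame s2; frame s1.
  have eC : st2 aCen = st aCen by frame s2; frame s1.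
  have eN : st2 aCnt = st aCnt by frame s2; frame s1.
  have eL : st2 aLm = st aLm by frame s2; frame s1.
  have eQ : st2 aQ 0 = q by frame s2; frame s1.
  have en : st2 aN 0 = n by frame s2; frame s1.
  have qk : k.+1 * (q + 2) = k * (q + 2) + (q + 2) by rewrite mulSn addnC.
  have old s : s < n -> st2 aBest s != 0 -> st aIsc s != 0 /\ exists2 y0, y0 \in take k.+1 Q &
      st aCen y0 = s.+1 /\ traced (st2 aMark) y0.
    by move=> sn /(j2 _ sn)[? [y0 /sub]]; split=> //; exists y0.
  apply: wp_if => /=; norm; rewrite eC eN eQ => mw; last first.
    apply: wp_skip; norm; split=> //; last by lia.
    move=> v s; rewrite tk mem_rcons inE => /orP[/eqP -> cv hv|vk]; last exact: j3.
    by move: mw; rewrite cv addn1 (ltnS (st aCnt w)) hv.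
  have {mw} [s cw hw] : exists2 s, st aCen w = s.+1 & st aCnt w <= q.
    move: mw; rewrite addn1 ltnS; case: (st aCen w) => // s; case: (leqP (st aCnt w) q) => // h _.
    by exists s.
  have [sn isS _] := hcl _ _ wn cw.
  apply: wp_if => /=; norm; rewrite eC cw subn1 /=; last first.
    case bs : (st2 aBest s) => // _; have /(j2 _ sn)[_ [y0 y0k [cy0 ty0]]] : st2 aBest s != 0 by rewrite bs.
    apply: wp_skip; norm; split=> //; last by lia.
    move=> v s'; rewrite tk mem_rcons inE => /orP[/eqP -> cv hv|vk]; last exact: j3.
    move: cv; rewrite cw => -[<-]; exists y0; first by split=> //; exact: mem_take y0k.
    by split=> //; exact: front.
  case bs : (st2 aBest s) => // _.
  apply: wp_seq; apply: wp_assign; norm; rewrite eC cw subn1 /=.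
  (* Marks are charged to flagged clusters, [q] for each; the current trace has at most [q] edges
     and the flag of [s] has just been set. *)
  pose G := count (fun v => st2 aBest v != 0) (iota 0 n).
  have [tr trE] : exists tr, tr = trace (st aLm) (st aPar) (st aCnt w) w by eexists.
  have str : size tr = st aCnt w by rewrite trE size_mkseq.
  apply: (@wp_trace pMark (fun j st' t' =>
    [/\ mle (st2 aMark) (st' aMark), forall z, z \in take j tr -> st' aMark (st aPar z * n + z) != 0,
      forall F, few (st aMark) F -> few (st' aMark) (F + G * q + j) &
      t' <= t2 + 100 + 40 * j])) => //.
  + by move=> j st' a x t'; rewrite !inE => /orP[] /eqP ->.
  + norm; split=> //; [by rewrite take0|by move=> F; rewrite addn0; exact: j4|by lia].
  + move=> j st3 t3; norm; rewrite eN eL eP => hj s3 ey [y1 y2 y3 y4].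
    have hjS : j < size tr by rewrite str.
    have e1 : st3 aPar = st aPar by frame s3; norm.
    have e2 : st3 aN 0 = n by frame s3; norm.
    apply: wp_assign; norm; rewrite ey e1 e2 -trE; split; last by lia.
    * by apply: mle_trans y1 _; exact: mle_upd.
    * move=> z; rewrite (take_nth 0 hjS) mem_rcons inE /upd => /orP[/eqP ->|/y2 h].
        by rewrite eqxx.
      by case: ifP.
    * by move=> F /y3; rewrite addnS; exact: few_upd.
  move=> st3 t3 s3; norm; rewrite eN -{1}str take_size => -[y1 y2 y3 y4].
  have eb : st3 aBest = upd (st2 aBest) s 1 by frame s3; norm.
  rewrite eb; split.
  + exact: mle_trans j1 y1.
  + move=> s' s'n; rewrite /upd; case: (eqVneq s' s) => [-> _|ne].
      by split=> //; exists w; [rewrite tk mem_rcons inE eqxx|rewrite /traced -trE].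
    by move=> /(old _ s'n)[? [y0 ? [? ?]]]; split=> //; exists y0 => //; split=> //; apply: traced_le y1 _.
  + move=> v s'; rewrite tk mem_rcons inE => /orP[/eqP -> cv hv|vk c1 c2].
      by exists w => //; split=> //; rewrite /traced -trE.
    have [y0 h1 [h2 h3]] := j3 _ _ vk c1 c2; exists y0 => //; split=> //.
    exact: traced_le y1 _.
  + move=> F /y3; apply: few_le; rewrite count_iota_upd // -/G mulSn ?str; lia.
  + rewrite ?str in y4; rewrite qk; lia.
move=> st2 t2 s2; rewrite /= (s1 aTail isT) tQ take_size => -[j1 j2 j3 j4 jt]; split=> //.
- move=> F /j4; apply: few_le; rewrite leq_add2l leq_mul // /K.
  rewrite -!size_filter; apply: uniq_leq_size; first by rewrite filter_uniq ?iota_uniq.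
  move=> v; rewrite !mem_filter mem_iota => /andP[h1 h2].
  by rewrite h2 andbT; case: (j2 v).
- have := leq_mul sQ (leqnn (q + 2)); lia.
Qed.

Definition pCentres : cmd :=
  (For aC ($aN) (when (aIsc@[$aC])
     ((aSrc <~ $aC) ;; pBfs ;; pCount ;; pSets ;; pPaths)))%P.

(* Distances from the centre c to the clustered vertex y are either realised
   in g up to a detour through the cluster of y, or every shortest path
   recorded for y meets the clusters listed in one of the sets. *)
Definition served n es cen (sets : seq (seq nat)) (g : rel nat) c :=
  forall y s b, cen y = s.+1 -> reach (gr es) b c y ->
    (exists2 y0, cen y0 = s.+1 /\ y0 < n & reach g b c y0) \/
    (exists2 S, S \in sets & forall s', s' \in S -> exists z a1 a2,
       [/\ z < n, cen z = s'.+1, a1 + a2 <= b, reach (gr es) a1 c z & reach (gr es) a2 z y]).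

Lemma served_le n es cen sets1 sets2 (g1 g2 : rel nat) c :
  {subset sets1 <= sets2} -> subrel g1 g2 ->
  served n es cen sets1 g1 c -> served n es cen sets2 g2 c.
Proof.
move=> h1 h2 h y s b cy /(h _ _ _ cy)[[y0 c0 r]|[S /h1 hS c0]]; last by right; exists S.
by left; exists y0 => //; exact: reach_sub r.
Qed.

(** The two cases are [cnt y <= q] and its negation. In the first, the tree path to [y0] consists of
    kept edges and marked missing edges. In the second, the recorded clusters all meet the tree path
    to [y], a shortest path, whose two pieces have total length at most [b]. *)
Lemma served_centre n es es0 c Q d p cen isc T cnt lm q X mk :
  bfs_post n es c Q d p -> clustering n es T cen isc -> counted c Q cen p cnt lm ->
  subrel (gr es) (gr es0) -> subrel (gr (kept cen es)) (sp es0 n mk) ->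
  (forall w, w \in Q -> miss cen (p w) w -> cnt w = q.+1 ->
     clusters_of cen lm p q.+1 w \in X) ->
  (forall y s, y \in Q -> cen y = s.+1 -> cnt y <= q ->
        exists2 y0, y0 \in Q /\ cen y0 = s.+1 & d y0 <= d y /\
          forall z, z \in trace lm p (cnt y0) y0 -> mk (p z * n + z) != 0) ->
  served n es cen X (sp es0 n mk) c.
Proof.
move=> post cl C sub keep hX hP y s b cy ry; have [tree compl] := post.
have [yQ yd] := compl _ _ ry.
have treeg : forall v, v \in Q -> reach (gr es) (d v) c v.
  by apply: (tree_reach tree) => v vQ vc; have [] := bt_par tree vQ vc.
have [le|lt] := leqP (cnt y) q.
  left; have [y0 [y0Q cy0] [dy0 tr]] := hP _ _ yQ cy le.
  exists y0; first by split=> //; exact: (bt_lt tree).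
  apply: (reach_le (leq_trans dy0 yd)); apply: (trace_reach tree C y0Q keep) => z hz.
  have [zQ mz _] := trace_mem tree C y0Q hz.
  have zc : z != c by apply: contraTneq mz => ->; rewrite (bt_rootd tree).2 missxx.
  have [_ gz _ _] := bt_par tree zQ zc.
  by rewrite /sp (sub _ _ gz) tr.
right; have [w wQ [mw cw [a e ra]]] := trace_cut tree C yQ lt.
exists (clusters_of cen lm p q.+1 w); first exact: hX.
move=> s' /mapP[z]; rewrite -cw => /(trace_mem tree C wQ)[zQ mz [a' e' ra']] ->.
move: mz => /and5P[_ + _ _ _]; case cz : (cen z) => [//|k] _ /=.
exists z, (d z), (a' + a); split=> //; [exact: (bt_lt tree)|by lia|exact: treeg|].
exact: reach_trans ra' ra.
Qed.

Lemma centres_spec n es es0 T q st t : simple n es -> subrel (gr es) (gr es0) ->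
  st aN 0 = n -> st aQ 0 = q -> table n (nbrs es) (st aDeg) (st aAdj) ->
  clustering n es T (st aCen) (st aIsc) ->
  table n (fun=> [::]) (st aLen) (st aTab) -> st aNs 0 = 0 ->
  subrel (gr (kept (st aCen) es)) (sp es0 n (st aMark)) ->
  let K := count (fun v => st aIsc v != 0) (iota 0 n) in
  wp pCentres (fun st' t' => (exists sets,
    [/\ size sets <= K * n, table n (lists sets) (st' aLen) (st' aTab),
      st' aNs 0 = size sets, forall S, S \in sets -> set_ok n (st aIsc) q S &
      forall c, c < n -> st aIsc c != 0 ->
        served n es (st aCen) sets (sp es0 n (st' aMark)) c]) /\
    [/\ mle (st aMark) (st' aMark),
      forall F, few (st aMark) F -> few (st' aMark) (F + K * (K * q)) &
      t' <= t + 1000 * (n + 1 + K * (n * (q + 2) + size es + 1))]) st t.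
Proof.
move=> sim sub hn hq tab cl tab0 hs keep K.
pose G k := count (fun v => st aIsc v != 0) (iota 0 k).
have GS k : G k.+1 = G k + (st aIsc k != 0) by rewrite /G iota_rcons -cats1 count_cat /= addn0.
apply: (@wp_for _ _ _ (fun k st' t' => (exists sets,
    [/\ size sets <= G k * n, table n (lists sets) (st' aLen) (st' aTab),
      st' aNs 0 = size sets, forall S, S \in sets -> set_ok n (st aIsc) q S &
      forall c, c < k -> st aIsc c != 0 ->
        served n es (st aCen) sets (sp es0 n (st' aMark)) c]) /\
    [/\ mle (st aMark) (st' aMark),
      forall F, few (st aMark) F -> few (st' aMark) (F + G k * (K * q)) &
      t' <= t + 40 * k + 950 * (G k * (n * (q + 2) + size es + 1))])) => //.
- norm; split; last by split=> //; [move=> F; rewrite mul0n addn0|lia].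
  by exists [::]; split=> //; apply: eq_table tab0.
- move=> k st1 t1 /=; rewrite hn => hk s1 ik [[sets [x1 x2 x3 x4 x5]] [i1 i2 it]].
  have e0 : st1 aN 0 = n by frame s1.
  have e1 : table n (nbrs es) (st1 aDeg) (st1 aAdj) by frame s1.
  have e2 : st1 aIsc = st aIsc by frame s1.
  have e3 : st1 aCen = st aCen by frame s1.
  have e4 : st1 aQ 0 = q by frame s1.
  apply: wp_if => /=; rewrite ik e2 => hfk; last first.
    apply: wp_skip; norm; rewrite GS hfk addn0; split; last by split=> //; lia.
    exists sets; split=> // c; rewrite ltnS leq_eqVlt => /orP[/eqP ->|hc]; last exact: x5.
    by rewrite hfk.
  apply: wp_seq; apply: wp_assign; norm; rewrite ik; apply: wp_seq.
  apply: wp_use; first by apply: (@bfs_spec n es k).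
  move=> st2 t2 s2 [+ jt2]; set Q := mkseq _ _ => post.
  apply: wp_seq; apply: wp_use.
    by apply: (@count_spec n es k); [exact: post.1|frame s2; norm].
  rewrite -/Q => st3 t3 s3 [C jt3].
  have f1 : mkseq (st3 aQue) (st3 aTail 0) = Q by frame s3.
  have f2 : st3 aCen = st aCen by frame s3; frame s2; norm.
  have f3 : st3 aIsc = st aIsc by frame s3; frame s2; norm.
  have f4 : st3 aPar = st2 aPar by frame s3.
  have f5 : st3 aDist = st2 aDist by frame s3.
  have f6 : st2 aCen = st aCen by frame s2; norm.
  rewrite f6 in C.
  apply: wp_seq; apply: wp_use.
    apply: (@sets_spec n es k T q sets); rewrite ?f1 ?f2 ?f3 ?f4 ?f5 //.
    - by frame s3; frame s2; norm.
    - by frame s3; frame s2; norm.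
    - by frame s3; frame s2; norm.
    - by frame s3; frame s2; norm.
  rewrite f1 f2 f3 f4 => st4 t4 s4 [[X [y1 y2 y3 y4 y5]] jt4].
  have g1 : mkseq (st4 aQue) (st4 aTail 0) = Q by frame s4.
  have g2 : st4 aCen = st aCen by frame s4.
  have g3 : st4 aIsc = st aIsc by frame s4.
  have g4 : st4 aPar = st2 aPar by frame s4.
  have g5 : st4 aDist = st2 aDist by frame s4.
  have g6 : st4 aCnt = st3 aCnt by frame s4.
  have g7 : st4 aLm = st3 aLm by frame s4.
  have g8 : st4 aMark = st1 aMark by frame s4; frame s3; frame s2; norm.
  apply: wp_use.
    apply: (@paths_spec n es k T q); rewrite ?g1 ?g2 ?g3 ?g4 ?g5 ?g6 ?g7 //.
    - by frame s4; frame s3; frame s2; norm.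
    - by frame s4; frame s3; frame s2; norm.
  rewrite g1 g2 g3 g4 g5 g6 g7 g8 -/K => st5 t5 s5 [z1 z2 z3 z4]; norm.
  rewrite GS hfk /=; have m15 := mle_trans i1 z1.
  split.
    exists (sets ++ X); split.
    + by rewrite size_cat addn1 mulSn addnC leq_add.
    + by frame s5.
    + by frame s5.
    + by move=> S; rewrite mem_cat => /orP[/x4|/y4].
    + move=> c; rewrite ltnS leq_eqVlt => /orP[/eqP -> _|hc hcf]; last first.
        apply: served_le (x5 _ hc hcf); last exact: sp_sub.
        by move=> S; rewrite mem_cat => ->.
      apply: (@served_le _ _ _ X _ (sp es0 n (st5 aMark))) => //.
        by move=> S; rewrite mem_cat orbC => ->.
      apply: (served_centre post cl C sub _ y5 z2).
      by move=> x y h; apply: (sp_sub m15); exact: keep.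
  split.
  + exact: m15.
  + by move=> F /i2/z3; apply: few_le; rewrite addn1 mulSn; lia.
  + rewrite addn1 mulSn; have := leq0n (n * q); lia.
move=> st1 t1 s1 /=; rewrite hn => -[h1 [i1 i2 it]]; split=> //; split=> //.
change (G n) with K in it; have := leq0n (K * (n * (q + 2) + size es + 1)); lia.
Qed.

(** * Hitting the recorded sets of clusters *)

Lemma count_lists P sets j : count P (lists sets j) =
  \sum_(i <- iota 0 (size sets)) P i * count_mem j (nth [::] sets i).
Proof.
rewrite /lists; elim: (iota _ _) => [|i s IH]; first by rewrite big_nil.
by rewrite big_cons -IH /= count_cat count_nseq.
Qed.

Lemma mem_lists sets j i :
  i \in lists sets j -> i < size sets /\ j \in nth [::] sets i.
Proof.
move=> /flattenP[s /mapP[k]]; rewrite mem_iota => /= hk -> hi.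
move: hi; rewrite mem_nseq => /andP[h /eqP ->].
by rewrite hk -has_pred1 has_count.
Qed.

(** Multiplicity at most 3 means that a cluster lying on tau unhit sets, counted with repetition,
    hits at least tau / 3 distinct ones. *)
Lemma count_lists_le P sets j : (forall S, S \in sets -> count_mem j S <= 3) ->
  count P (lists sets j) <=
  3 * count (fun i => P i && (i \in lists sets j)) (iota 0 (size sets)).
Proof.
move=> h3; rewrite count_lists -sum1_count big_distrr /= [X in _ <= X]big_mkcond /=.
rewrite !big_seq; apply: leq_sum => i; rewrite mem_iota => /= hi.
case Pi : (P i) => //=; rewrite mul1n muln1.
have [h|] := boolP (i \in lists sets j); first by rewrite h3 ?mem_nth.
apply: contraR; rewrite -ltnNge => h; apply/flattenP.
exists (nseq (count_mem j (nth [::] sets i)) i); last by rewrite mem_nseq h eqxx.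
by apply/mapP; exists i; rewrite ?mem_iota.
Qed.

Lemma sum_count_mem n (S : seq nat) : (forall s, s \in S -> s < n) ->
  \sum_(j <- iota 0 n) count_mem j S = size S.
Proof.
elim: S => [|s S IH] hS /=; first by rewrite big1_eq.
rewrite big_split /= IH; last by move=> x hx; apply: hS; rewrite inE hx orbT.
have sn : s < n by apply: hS; rewrite mem_head.
rewrite (bigD1_seq s) ?iota_uniq ?mem_iota //= eqxx big1 // => j.
by rewrite eq_sym => /negPf ->.
Qed.

(** Double counting of incidences between clusters and the sets satisfying [P], each of size
    [q.+1]. *)
Lemma sum_count_lists n isc q P sets : (forall S, S \in sets -> set_ok n isc q S) ->
  \sum_(j <- iota 0 n) count P (lists sets j) = count P (iota 0 (size sets)) * q.+1.
Proof.
move=> ok; under eq_bigr do rewrite count_lists.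
rewrite exchange_big /= -sum1_count big_distrl /= [RHS]big_mkcond /= !big_seq.
apply: eq_bigr => i; rewrite mem_iota => /= hi.
have [s1 s2 _] := ok _ (mem_nth [::] hi).
rewrite -big_distrr /= sum_count_mem; last by move=> s /s2[].
by rewrite s1; case: (P i); rewrite ?mul1n.
Qed.

(** In the double count only clusters of centres contribute, since the sets contain no other
    indices; this puts the number of centres, instead of [n], on the right. *)
Lemma count_lists_bound n isc q P sets tau : (forall S, S \in sets -> set_ok n isc q S) ->
  (forall j, j < n -> count P (lists sets j) <= tau) ->
  count P (iota 0 (size sets)) * q.+1 <= count (fun v => isc v != 0) (iota 0 n) * tau.
Proof.
move=> ok h; rewrite -(sum_count_lists P ok) -sum1_count big_distrl /= [X in _ <= X]big_mkcond /= !big_seq.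
apply: leq_sum => j; rewrite mem_iota => /= hj; rewrite mul1n.
case: ifPn => [_|]; first exact: h.
rewrite negbK => /eqP ij; case e : (lists sets j) => [//|i l].
have /mem_lists[hi hj'] : i \in lists sets j by rewrite e mem_head.
by have [_ /(_ _ hj')[_]] := ok _ (mem_nth [::] hi); rewrite ij.
Qed.

Notation aTau := 33 (only parsing).
Notation aHit := 34 (only parsing).
Notation aSel := 35 (only parsing).

(* In the phase with threshold tau, every cluster that lies on tau unhit sets
   or more (with multiplicity) is selected.  Afterwards no cluster lies on tau
   unhit sets, which bounds the number of unhit sets, and hence the number of
   selections, in the phase with threshold tau / 2. *)
Definition pHit : cmd :=
  ((aTau <~ $aNs) ;;
   While (#0 < $aTau)
    (For aI ($aN)
      ((aK <~ #0) ;;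
       For aJ (aLen@[$aI])
         (when (aHit@[aTab@[$aJ * $aN + $aI]] < #1) (aK <~ $aK + #1)) ;;
       when ($aTau < $aK + #1)
         (Assign aSel $aI #1 ;;
          For aJ (aLen@[$aI]) (Assign aHit (aTab@[$aJ * $aN + $aI]) #1))) ;;
     (aTau <~ $aTau / #2)))%P.

Lemma count_upd_le (f : nat -> nat) k x s : uniq s ->
  count (fun v => upd f k x v != 0) s <= (count (fun v => f v != 0) s).+1.
Proof.
move=> us; apply: (@leq_trans (count (predU (pred1 k) (fun v => f v != 0)) s)).
  by apply: sub_count => v; rewrite /upd /=; case: (v == k).
rewrite -addn1 addnC -(leq_add2r (count (predI (pred1 k) (fun v => f v != 0)) s)) count_predUI.
by rewrite count_uniq_mem //; case: (k \in s) => /=; lia.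
Qed.

(** The 9 is 3 * 3. When a phase starts, every cluster lies on at most 3 * tau unhit sets, so the
    number U of unhit sets satisfies U * (q + 1) <= 3 * K * tau. A selection hits at least tau / 3
    new sets, so their number is at most 3 * U / tau, that is 9 * K / (q + 1). Halving a threshold
    below 2 ^ B gives at most [B] phases. *)
Lemma hit_spec n isc q sets B st t :
  (forall S, S \in sets -> set_ok n isc q S) -> size sets < 2 ^ B ->
  st aN 0 = n -> table n (lists sets) (st aLen) (st aTab) -> st aNs 0 = size sets ->
  (forall i, st aHit i = 0) -> (forall i, st aSel i = 0) ->
  let K := count (fun v => isc v != 0) (iota 0 n) in
  wp pHit (fun st' t' => [/\ forall S, S \in sets -> exists2 s, s \in S & st' aSel s != 0,
      count (fun v => st' aSel v != 0) (iota 0 n) * q.+1 <= 9 * K * B &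
      t' <= t + 200 * (B + 1) * (n + size sets * q.+1 + 1)]) st t.
Proof.
move=> ok hB hn tab hs hit0 sel0 K.
pose U (hit : nat -> nat) := count (fun i => hit i == 0) (iota 0 (size sets)).
pose uc (hit : nat -> nat) j := count (fun i => hit i == 0) (lists sets j).
pose cs (sel : nat -> nat) := count (fun v => sel v != 0) (iota 0 n).
pose sound hit sel := forall i, i < size sets -> hit i != 0 ->
  exists2 s, s \in nth [::] sets i & sel s != 0.
have ok3 j S : S \in sets -> count_mem j S <= 3 by move=> /ok[_ _]; apply.
pose W := n + size sets * q.+1 + 1.
apply: wp_seq; apply: wp_assign; norm; rewrite hs.
apply: (@wp_while _ _ (fun st' t' => exists ph, [/\ st' aTau 0 * 2 ^ ph <= size sets,
   ph <= B, forall j, j < n -> uc (st' aHit) j <= 3 * st' aTau 0, 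
   sound (st' aHit) (st' aSel) & cs (st' aSel) * q.+1 <= 9 * K * ph /\
   t' <= t + 10 + 150 * (ph * W)]) (fun st' => st' aTau 0)).
- norm; exists 0; split=> //.
  + by rewrite muln1.
  + move=> j jn; apply: leq_trans (count_lists_le _ (ok3 j)) _.
    by rewrite leq_mul2l /=; apply: leq_trans (count_size _ _) _; rewrite size_iota.
  + by move=> i _; rewrite hit0.
  + split; last by lia.
    by rewrite /cs (eq_count (a2 := pred0)) ?count_pred0 // => v; rewrite sel0.
- move=> st1 t1 s1 [ph [h1 h2 h3 h4 [h5 h6]]] /=; case: posnP => // tau0 _.
  set tau := st1 aTau 0 in h1 h3 tau0 *.
  have phB : ph < B.
    by rewrite -(@ltn_exp2l 2) //; apply: leq_ltn_trans hB; nia.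
  have n1 : st1 aN 0 = n by frame s1; norm.
  have tab1 : table n (lists sets) (st1 aLen) (st1 aTab) by frame s1; norm.
  pose len k := \sum_(j <- iota 0 k) (size (lists sets j)).+1.
  have lenS k : len k.+1 = len k + (size (lists sets k)).+1.
    by rewrite /len iota_rcons -cats1 big_cat big_seq1.
  (* The first clause is a potential argument: each selection made in this phase is paid with [tau]
     out of three times the number of unhit sets. *)
  apply: wp_seq; apply: (@wp_for _ _ _ (fun k st' t' =>
    [/\ (cs (st' aSel) - cs (st1 aSel)) * tau + 3 * U (st' aHit) <= 3 * U (st1 aHit),
        forall j, j < k -> uc (st' aHit) j < tau,
        (forall i, st' aHit i == 0 -> st1 aHit i == 0) /\ cs (st1 aSel) <= cs (st' aSel),
        sound (st' aHit) (st' aSel) &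
        t' <= t1 + 100 * len k])) => //.
  + norm; split=> //; first by rewrite subnn mul0n.
    by rewrite /len big_nil; lia.
  + move=> k st2 t2; rewrite /= n1 => hk s2 ik [a1 a2 [a3 a3'] a4 a5].
    have e0 : st2 aN 0 = n by frame s2.
    have e1 : table n (lists sets) (st2 aLen) (st2 aTab) by frame s2.
    have e2 : st2 aLen k = size (lists sets k) by apply: table_size e1 hk.
    have e3 : st2 aTau 0 = tau by frame s2.
    apply: wp_seq; apply: wp_assign; norm; apply: wp_seq.
    apply: (@wp_for _ _ _ (fun j st' t' =>
      st' aK 0 = count (fun i => st2 aHit i == 0) (take j (lists sets k)) /\
      t' <= t2 + 3 + 40 * j)) => //.
    * by norm; split; [rewrite take0|lia].
    * move=> j st3 t3; norm; rewrite ik e2 => hj s3 ij [i3 i3t].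
      have ew : st3 aTab (st3 aJ 0 * st3 aN 0 + st3 aI 0) = nth 0 (lists sets k) j.
        by frame s3; norm; rewrite ij e0 ik (table_nth e1) ?e2.
      have ec : st3 aHit = st2 aHit by frame s3; norm.
      rewrite (take_nth 0 hj) -cats1 count_cat /= addn0.
      apply: wp_if => /=; rewrite ew ec; case: ltnP => // h _.
        apply: wp_assign; norm; rewrite i3; split; last by lia.
        by have -> : st2 aHit (nth 0 (lists sets k) j) == 0 by lia.
      apply: wp_skip; norm; rewrite i3; split; last by lia.
      have -> : (st2 aHit (nth 0 (lists sets k) j) == 0) = false by lia.
      by rewrite addn0.
    move=> st3 t3 s3; norm; rewrite ik e2 take_size => -[i3 i3t].
    have f0 : st3 aHit = st2 aHit by frame s3; norm.
    have f1 : st3 aSel = st2 aSel by frame s3; norm.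
    have f2 : st3 aTau 0 = tau by frame s3; norm.
    have f3 : st3 aI 0 = k by frame s3; norm.
    have f4 : st3 aLen k = size (lists sets k) by frame s3; norm.
    apply: wp_if => /=; rewrite f2 i3 addn1 ltnS; case: leqP => // h _; last first.
      apply: wp_skip; norm; rewrite f0 f1; split=> //; last by rewrite lenS; lia.
      by move=> j; rewrite ltnS leq_eqVlt => /orP[/eqP ->|/a2].
    apply: wp_seq; apply: wp_assign; norm; rewrite f3.
    apply: (@wp_for _ _ _ (fun j st' t' =>
      (forall i, (st' aHit i == 0) = (st2 aHit i == 0) && (i \notin take j (lists sets k))) /\
      t' <= t3 + 30 + 30 * j)) => //.
    * norm; split; last by lia.
      by move=> i; rewrite take0 andbT f0.
    * move=> j st4 t4; norm; rewrite f3 f4 => hj s4 ij [i4 i4t].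
      have ew : st4 aTab (st4 aJ 0 * st4 aN 0 + st4 aI 0) = nth 0 (lists sets k) j.
        frame s4; norm; frame s3; norm; rewrite ij e0 ik (table_nth e1) ?e2 //.
      apply: wp_assign; norm; rewrite ew; split; last by lia.
      move=> i; rewrite (take_nth 0 hj) mem_rcons inE /upd; case: (eqVneq i) => [->|ne] /=.
        by rewrite andbF.
      exact: i4.
    move=> st4 t4 s4; norm; rewrite f3 f4 take_size => -[i4 i4t].
    have g1 : st4 aSel = upd (st2 aSel) k 1 by frame s4; norm; rewrite ?f3 ?f1.
    have cle : cs (st2 aSel) <= cs (upd (st2 aSel) k 1).
      by apply: sub_count => v; rewrite /upd; case: (v == k).
    have cge : cs (upd (st2 aSel) k 1) <= (cs (st2 aSel)).+1.
      by apply: count_upd_le; exact: iota_uniq.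
    have dec : tau + 3 * U (st4 aHit) <= 3 * U (st2 aHit).
      have -> : U (st2 aHit) = U (st4 aHit) +
          count (fun i => (st2 aHit i == 0) && (i \in lists sets k)) (iota 0 (size sets)).
        rewrite /U; elim: (iota _ _) => //= i s ->; rewrite i4.
        by case: (_ == 0); case: (i \in lists sets k) => /=; lia.
      rewrite mulnDr addnC leq_add2l; apply: leq_trans h _.
      exact: count_lists_le (ok3 k).
    rewrite g1; split.
    * have : (cs (upd (st2 aSel) k 1) - cs (st1 aSel)) * tau <=
          (cs (st2 aSel) - cs (st1 aSel)) * tau + tau.
        by rewrite -mulSnr leq_mul2r; apply/orP; right; lia.
      by lia.
    * move=> j; rewrite ltnS leq_eqVlt => /orP[/eqP ->|/a2 h'].
        rewrite /uc (eq_in_count (a2 := pred0)) ?count_pred0 // => i hi.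
        by rewrite i4 hi andbF.
      apply: leq_ltn_trans h'; apply: sub_count => i; rewrite i4 => /andP[]//.
    * split; last exact: leq_trans cle.
      by move=> i; rewrite i4 => /andP[/a3].
    * move=> i hi; rewrite i4 negb_and negbK => /orP[/(a4 _ hi)[s hs1 hs2]|/mem_lists[_ h']].
        by exists s => //; rewrite /upd; case: ifP.
      by exists k => //; rewrite upd_eq.
    * by rewrite lenS; lia.
  move=> st2 t2 s2; rewrite /= n1 => -[a1 a2 [a3 a3'] a4 a5].
  have e3 : st2 aTau 0 = tau by frame s2.
  apply: wp_assign; norm; rewrite e3; split; last by rewrite ltn_Pdiv.
  have td : tau = tau %/ 2 * 2 + tau %% 2 := divn_eq tau 2.
  have tm : tau %% 2 < 2 by rewrite ltn_mod.
  have lenn : len n <= W.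
    rewrite /len; under eq_bigr do rewrite -addn1 addnC.
    rewrite big_split /= sum1_size size_iota.
    have := sum_count_lists predT ok; rewrite count_predT size_iota.
    by under eq_bigr do rewrite count_predT; move=> ->; rewrite /W; lia.
  exists ph.+1; split=> //.
  + by rewrite expnS; apply: leq_trans h1; rewrite mulnA leq_mul2r; apply/orP; right; lia.
  (* Fewer than [tau] means at most [2 * (tau %/ 2)], even for odd [tau]; the invariant allows 3
     because initially only the multiplicity bound is known. *)
  + by move=> j /a2; lia.
  + have U0 : U (st1 aHit) * q.+1 <= K * (3 * tau) by exact: count_lists_bound ok h3.
    have U1 : (cs (st2 aSel) - cs (st1 aSel)) * tau <= 3 * U (st1 aHit) by lia.
    have U2 : (cs (st2 aSel) - cs (st1 aSel)) * q.+1 <= 9 * K.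
      rewrite -(leq_pmul2r tau0) mulnAC; apply: (@leq_trans (3 * U (st1 aHit) * q.+1)).
        by rewrite leq_mul2r U1 orbT.
      by rewrite -mulnA; lia.
    split; last by rewrite mulSn; lia.
    rewrite mulnS; rewrite mulnBl in U2; lia.
move=> st1 t1 s1 [ph [h1 h2 h3 h4 [h5 h6]]] /=; case: posnP => // tau0 _.
split.
(* With threshold 0 no cluster lies on an unhit set, and as the sets are nonempty, none is left
   unhit. *)
- move=> S /(nthP [::])[i hi <-]; apply: h4 => //.
  have : U (st1 aHit) * q.+1 <= K * 0.
    by apply: count_lists_bound ok _ => j /h3; rewrite tau0 muln0.
  rewrite muln0 leqn0 muln_eq0 orbF -leqn0 leqNgt -has_count => /hasPn; apply.
  by rewrite mem_iota.
- by apply: leq_trans h5 _; rewrite leq_mul2l h2 orbT.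
- have : ph * W <= B * W by rewrite leq_mul2r h2 orbT.
  have : 0 < W by rewrite /W addn1.
  by rewrite -/W -mulnA mulnDl mul1n; clearbody W; lia.
Qed.

(** * The algorithm *)

Definition pFine : cmd :=
  (pBuild ;; pCluster ($aQ * $aQ)%P ;; pKeep ;; pCentres ;; pHit ;; pTrees aSel)%P.

Lemma kept_star n es T cen isc x c : simple n es -> clustering n es T cen isc ->
  x < n -> cen x = c.+1 -> [/\ c < n, isc c != 0 & gr (kept cen es) c x].
Proof.
move=> sim [cl _ _] xn cx; have [cn ic g] := cl _ _ xn cx; split=> //.
by rewrite gr_kept g /miss cx eqxx /= !andbF.
Qed.

(** With [c] the centre of [x], the lengths are 1 + (1 + b) + 1 + 1 through a vertex [y0] of the
    cluster of [y] and its centre, or 1 + (1 + a1) + (1 + a2) through a hitting centre, where a1 +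
    a2 <= 1 + b. *)
Lemma served_stretch n es es0 T cen isc sets mk sel x y b :
  simple n es -> clustering n es T cen isc ->
  subrel (gr (kept cen es)) (sp es0 n mk) ->
  (forall c, c < n -> isc c != 0 -> served n es cen sets (sp es0 n mk) c) ->
  (forall S, S \in sets -> exists2 s, s \in S & sel s != 0) ->
  (forall c b v, c < n -> sel c != 0 -> reach (gr es) b c v -> reach (sp es0 n mk) b c v) ->
  cen x != 0 -> cen y != 0 -> x < n -> y < n -> reach (gr es) b x y ->
  reach (sp es0 n mk) (b + 4) x y.
Proof.
move=> sim cl keep srv hit tree.
case cx : (cen x) => [//|c] _; case cy : (cen y) => [//|s] _ xn yn rxy.
have [cn ic gx] := kept_star sim cl xn cx; have [sn _ gy] := kept_star sim cl yn cy.
have rcy : reach (gr es) (1 + b) c y.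
  by apply: reach_trans rxy; apply: reach1; exact: sub_kept gx.
have sx : reach (sp es0 n mk) 1 x c by apply: reach1; rewrite sp_sym keep.
have sy : reach (sp es0 n mk) 1 s y by apply: reach1; rewrite keep.
case: (srv _ cn ic _ _ _ cy rcy) => [[y0 [cy0 y0n] r0]|[S hS hz]].
  have [_ _ gy0] := kept_star sim cl y0n cy0.
  have sy0 : reach (sp es0 n mk) 1 y0 s by apply: reach1; rewrite sp_sym keep.
  apply: (@reach_le _ (1 + (1 + b) + 1 + 1)); first by lia.
  by apply: reach_trans sy; apply: reach_trans sy0; exact: reach_trans r0.
have [s' hs' sel'] := hit _ hS; have [z [a1 [a2 [zn cz le r1 r2]]]] := hz _ hs'.
have [s'n _ gz] := kept_star sim cl zn cz.
have gz' : reach (gr es) 1 s' z by apply: reach1; exact: sub_kept gz.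
have t1 : reach (sp es0 n mk) (1 + a1) s' c.
  by apply: tree => //; apply: reach_trans gz' _; exact: reach_sym (@gr_sym _) r1.
have t2 : reach (sp es0 n mk) (1 + a2) s' y.
  by apply: tree => //; exact: reach_trans gz' _.
apply: (@reach_le _ (1 + (1 + a1) + (1 + a2))); first by lia.
apply: reach_trans t2; apply: reach_trans sx _.
exact: reach_sym (@sp_sym _ _ _) t1.
Qed.

(** The edge budget lists kept edges, recorded paths ([q] edges per pair of a centre and a cluster)
    and hitting trees. The condition on [B] suffices because at most [K * n <= n * n] sets are
    recorded. *)
Lemma fine_spec n es q B st t : simple n es -> inp n es st -> st aQ 0 = q -> 0 < q ->
  (forall i, st aHit i = 0) -> (forall i, st aSel i = 0) ->
  (forall i, st aLen i = 0) -> st aNs 0 = 0 -> n * n < 2 ^ B ->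
  let es1 := alive es (st aDead) in
  wp pFine (fun st' t' => exists K S, [/\ K * (q * q) <= n, S * q.+1 <= 9 * K * B,
      forall k u v, reach (gr es1) k u v -> reach (sp es n (st' aMark)) (k + 4) u v,
      mle (st aMark) (st' aMark) &
      (forall F, few (st aMark) F ->
        few (st' aMark) (F + (n * (q * q) + n) + K * (K * q) + n * S)) /\
      t' <= t + 3000 * (n + size es + 1 + K * (n * (q + 2) + size es1 + 1) +
        (B + 1) * (n + K * n * q.+1 + 1) + (S + 1) * (n + size es1 + 1))]) st t.
Proof.
move=> sim hinp hq q0 hit0 sel0 len0 ns0 hB es1; have [hn hm he] := hinp.
have sub : subrel (gr es1) (gr es) by apply: gr_sub; exact: alive_sub.
have sim1 : simple n es1 by exact: simple_alive.
have qq0 : 0 < q * q by rewrite muln_gt0 q0.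
apply: wp_seq; apply: wp_use; first exact: build_spec sim hinp.
move=> st1 t1 s1 [tab1 it1].
have hn1 : st1 aN 0 = n by frame s1.
have hq1 : st1 aQ 0 = q by frame s1.
have thr1 st' : st' aQ = st1 aQ -> den st' ($aQ * $aQ)%P = q * q.
  by move=> /= ->; rewrite hq1.
apply: wp_seq; apply: wp_use; first exact: (cluster_spec _ sim1 hn1 tab1 qq0 thr1).
move=> st2 t2 s2 [cl it2].
have inp2 : inp n es st2.
  by split; [frame s2; frame s1|frame s2; frame s1|move=> e; frame s2; frame s1; exact: he].
have d2 : st2 aDead = st aDead by frame s2; frame s1.
apply: wp_seq; apply: wp_use; first exact: keep_spec inp2.
rewrite d2 -/es1 => st3 t3 s3 [m3 keep3 f3 it3].
have e3 : st3 aCen = st2 aCen by frame s3.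
have i3 : st3 aIsc = st2 aIsc by frame s3.
have k3 : st2 aMark = st aMark by frame s2; frame s1.
rewrite k3 in m3 f3.
set K := count (fun v => st2 aIsc v != 0) (iota 0 n).
apply: wp_seq; apply: wp_use.
  apply: (@centres_spec n es1 es (q * q) q) => //; rewrite ?e3 ?i3 //.
  - by frame s3; frame s2.
  - by frame s3; frame s2.
  - by frame s3; frame s2.
  - by frame s3; frame s2; frame s1; move=> v hv; rewrite len0.
  - by frame s3; frame s2; frame s1.
rewrite e3 i3 -/K => st4 t4 s4 [[sets [x1 x2 x3 x4 x5]] [m4 f4 it4]].
have Kn : K <= n.
  by apply: leq_trans (count_size _ _) _; rewrite size_iota.
apply: wp_seq; apply: wp_use.
  apply: (@hit_spec n (st2 aIsc) q sets B) => //.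
  - by apply: leq_ltn_trans hB; apply: leq_trans x1 _; rewrite leq_mul2r Kn orbT.
  - by frame s4; frame s3; frame s2.
  - by move=> i; frame s4; frame s3; frame s2; frame s1.
  - by move=> i; frame s4; frame s3; frame s2; frame s1.
rewrite -/K => st5 t5 s5 [hit5 cnt5 it5].
apply: wp_use.
  apply: (@trees_spec aSel n es1 es _ _ isT sim1 sub).
    by frame s5; frame s4; frame s3; frame s2.
  by frame s5; frame s4; frame s3; frame s2.
move: cnt5; set S := count (fun v => st5 aSel v != 0) (iota 0 n) => cnt5.
have k5 : st5 aMark = st4 aMark by frame s5.
rewrite k5 => st6 t6 s6 [m6 r6 f6 it6].
have mk36 := mle_trans m4 m6.
have keep6 : subrel (gr (kept (st2 aCen) es1)) (sp es n (st6 aMark)).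
  by move=> x y /keep3; exact: sp_sub mk36 _ _.
have szk : size (kept (st2 aCen) es1) <= n * (q * q) + n.
  by case: cl => _ c2 _; exact: (size_kept sim1 c2).
exists K, S; split.
- by case: cl.
- exact: cnt5.
- move=> k u v /(reach_split2 (P := fun x => (st2 aCen x != 0) && (x < n)) (@sub_kept (st2 aCen) _)).
  case=> [x y gxy|r|[x [y [a [b [c [[le h1 /andP[h2 h2n] /andP[h3 h3n]] [h4 h5]]]]]]]].
  + rewrite gr_kept gxy /= negbK => /and5P[-> -> _ _ _].
    by have [-> ->] := gr_lt sim1 gxy.
  + by apply: reach_le (reach_sub keep6 r); lia.
  have srv c' : c' < n -> st2 aIsc c' != 0 -> served n es1 (st2 aCen) sets (sp es n (st6 aMark)) c'.
    by move=> hc1 hc2; apply: served_le (x5 _ hc1 hc2) => //; exact: sp_sub.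
  have r4 := served_stretch sim1 cl keep6 srv hit5 r6 h2 h3 h2n h3n h4.
  apply: (@reach_le _ (a + (b + 4) + c)); first by lia.
  apply: reach_trans (reach_sub keep6 h5).
  by apply: reach_trans r4; exact: reach_sub keep6 h1.
- exact: mle_trans m3 mk36.
split.
- move=> F /f3/f4/f6; apply: few_le; lia.
have N1 : (B + 1) * (n + size sets * q.+1 + 1) <= (B + 1) * (n + K * n * q.+1 + 1).
  by rewrite leq_mul2l leq_add2r leq_add2l leq_mul2r x1 !orbT.
have sz1 : size es1 <= size es.
  by rewrite size_map size_filter; apply: leq_trans (count_size _ _) _; rewrite size_iota.
have {}it5 : t5 <= t4 + 200 * ((B + 1) * (n + size sets * q.+1 + 1)) by rewrite mulnA.
have {}it6 : t6 <= t5 + 400 * ((S + 1) * (n + size es1 + 1)) by rewrite mulnA.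
have {}it2 : t2 <= t1 + 210 * (n + size es1 + 1) by exact: it2.
(* The products are generalised to variables, so that the sum of the running times becomes linear
   arithmetic. *)
move: ((S + 1) * _) it6 => X it6.
move: (K * (n * _ + _ + _)) it4 => Y it4.
move: ((B + 1) * (n + size sets * _ + _)) N1 it5 => Z N1 it5.
move: ((B + 1) * (n + _ + 1)) N1 => V N1.
clear -it1 it2 it3 it4 it5 it6 N1 sz1; move: (size es) (size es1) sz1 it1 it2 it3 => a b; lia.
Qed.

(** * Output, choice of q, and the whole program *)

Definition pFilter : cmd :=
  ((aK <~ #0) ;;
   For aI ($aM)
     (when (#0 < aMark@[aU@[$aI] * $aN + aV@[$aI]] + aMark@[aV@[$aI] * $aN + aU@[$aI]])
        (Assign aU $aK (aU@[$aI]) ;; Assign aV $aK (aV@[$aI]) ;; (aK <~ $aK + #1))) ;;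
   (aM <~ $aK))%P.

Definition marked n (mk : nat -> nat) (e : nat * nat) :=
  (mk (e.1 * n + e.2) != 0) || (mk (e.2 * n + e.1) != 0).

Lemma filter_spec n es st t : inp n es st ->
  wp pFilter (fun st' t' => inp n [seq e <- es | marked n (st aMark) e] st' /\
    t' <= t + 100 * (size es + 1)) st t.
Proof.
move=> [hn hm he]; pose F k := [seq e <- take k es | marked n (st aMark) e].
(* The list is compacted in place; the write position never overtakes the read position, so no
   unread edge is lost. *)
have sF k : size (F k) <= k.
  rewrite size_filter; apply: leq_trans (count_size _ _) _.
  by rewrite size_take; case: ltnP.
apply: wp_seq; apply: wp_assign; norm; apply: wp_seq.
apply: (@wp_for _ _ _ (fun k st' t' => [/\ st' aK 0 = size (F k),
   forall i, i < size (F k) -> (st' aU i, st' aV i) = nth (0, 0) (F k) i,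
   forall e, k <= e < size es -> (st' aU e, st' aV e) = nth (0, 0) es e &
   t' <= t + 10 + 90 * k])) => //.
- norm; split=> //; rewrite /F ?take0 //=; by lia.
- move=> k st1 t1; norm; rewrite hm => hk s1 ik [i1 i2 i3 it].
  have eN : st1 aN 0 = n by frame s1; norm.
  have eM : st1 aMark = st aMark by frame s1; norm.
  have [eU eV] : st1 aU k = (nth (0, 0) es k).1 /\ st1 aV k = (nth (0, 0) es k).2.
    by rewrite -i3 ?leqnn.
  have FS : F k.+1 = if marked n (st aMark) (nth (0, 0) es k)
      then rcons (F k) (nth (0, 0) es k) else F k.
    by rewrite /F (take_nth (0, 0) hk) filter_rcons.
  have mE : (0 < st aMark ((nth (0, 0) es k).1 * n + (nth (0, 0) es k).2) +
     st aMark ((nth (0, 0) es k).2 * n + (nth (0, 0) es k).1)) = marked n (st aMark) (nth (0, 0) es k).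
    by rewrite addn_gt0 !lt0n.
  apply: wp_if => /=; rewrite ik eN eM eU eV mE; case: (marked _ _ _) FS => // FS _.
    apply: wp_seq; apply: wp_assign; norm; rewrite ik eU i1.
    apply: wp_seq; apply: wp_assign; norm; rewrite ik eV i1.
    apply: wp_assign; norm; rewrite i1 addn1 FS size_rcons; split=> //; last by lia.
    + move=> i; rewrite ltnS leq_eqVlt => /orP[/eqP ->|hi].
        by rewrite !upd_eq nth_rcons ltnn eqxx; case: (nth _ _ _).
      by rewrite !upd_neq ?nth_rcons ?hi ?i2 //; lia.
    + move=> e he'; have hF := sF k; rewrite !upd_neq ?i3 //; lia.
  apply: wp_skip; norm; rewrite FS; split=> //; last by lia.
  by move=> e he'; apply: i3; lia.
move=> st1 t1 s1; norm; rewrite hm /F take_size => -[i1 i2 i3 it].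
apply: wp_assign; norm; rewrite i1; split; last by lia.
split=> //; norm; first by frame s1; norm.
Qed.

Fixpoint powE k : expr := if k is k'.+1 then (if k' is 0 then $aQ%P else (powE k' * $aQ)%P) else #1%P.

Arguments powE : simpl never.

Lemma den_powE st k : den st (powE k) = st aQ 0 ^ k.
Proof.
elim: k => // -[|k] IH; first by rewrite expn1.
by rewrite expnSr -IH.
Qed.

Definition pRoot : cmd :=
  ((aQ <~ #1) ;; While (powE 5 < $aN) (aQ <~ $aQ + #1))%P.

Definition pMain : cmd :=
  (If ($aM == #0) Skip
    (pRoot ;;
     If (powE 7 < $aM)
       (pLevel (powE 4) ;; pLevel (powE 3) ;; pFine ;; pFilter) Skip))%P.

Lemma reach_filter n es mk :
  subrel (sp es n mk) (gr [seq e <- es | marked n mk e]).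
Proof.
move=> x y /andP[g m]; rewrite /gr !mem_filter /marked /= (orbC (mk (y * n + x) != 0)) m /=.
exact: g.
Qed.

(** Linear search suffices, as it costs O(q). The 32 is 2 ^ 5: the candidate before the result has
    fifth power below [n], and [q + 1 <= 2 * q]. *)
Lemma root_spec n st t (Q : store -> nat -> Prop) : st aN 0 = n -> 0 < n ->
  (forall st' t' q, same [:: aQ] st st' -> st' aQ 0 = q -> 0 < q -> n <= q ^ 5 -> q ^ 5 <= 32 * n ->
     t' <= t + 40 * q -> Q st' t') ->
  wp pRoot Q st t.
Proof.
move=> hn n0 hQ; apply: wp_seq; apply: wp_assign; norm.
apply: (@wp_while _ _ (fun st' t' => [/\ 0 < st' aQ 0, st' aQ 0 ^ 5 <= 32 * n &
  t' + 20 <= t + 40 * st' aQ 0]) (fun st' => n - st' aQ 0)).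
- by norm; split=> //; lia.
- move=> st1 t1 s1 [i1 i2 it]; rewrite den_op den_powE /=.
  have -> : st1 aN 0 = n by frame s1; norm.
  case: ltnP => // lt _; apply: wp_assign; norm; rewrite addn1.
  move: (st1 aQ 0) i1 i2 it lt => q q0 q5 it lt.
  have qn : q < n.
    by apply: leq_ltn_trans lt; rewrite -[q in q <= _]expn1 leq_pexp2l.
  split; last by lia.
  split=> //; last by lia.
  apply: (@leq_trans ((2 * q) ^ 5)); first by apply: leq_expn2; lia.
  by rewrite expnMn leq_mul2l /= ltnW.
move=> st1 t1 s1 [i1 i2 it]; rewrite den_op den_powE /=.
have -> : st1 aN 0 = n by frame s1; norm.
case: ltnP => // le _; apply: hQ erefl i1 le i2 _; last by rewrite /=; lia.
by apply: same_trans s1; apply: same_update.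
Qed.

(** The parameter [X] lets a single computation serve both terms of the minimum: it is instantiated
    with [m * q ^ 3] and with [q ^ 11]. *)
Lemma time_bound n m MA MB q KA KB K S B X :
  0 < q -> n <= q ^ 5 -> KA <= q ^ 1 -> KB <= q ^ 2 -> K <= q ^ 3 -> S <= 9 * q ^ 2 * B ->
  q ^ 1 * m <= X -> q ^ 2 * MA <= 2 * X -> q ^ 3 * MB <= 2 * X -> q ^ 10 <= X ->
  (n + m + (KA + 1) * (n + m + 1)) + (n + m + (KB + 1) * (n + MA + 1)) +
  (n + m + 1 + K * (n * (q + 2) + MB + 1) +
        (B + 1) * (n + K * n * q.+1 + 1) + (S + 1) * (n + MB + 1))
  <= 100 * ((B + 1) * X).
Proof.
move=> q0 n5 a b c s x1 x2 x3 x10.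
have P i : i <= 10 -> q ^ i <= X by move=> h; apply: leq_trans x10; rewrite leq_pexp2l.
have one i Y : Y <= q ^ i * Y by rewrite leq_pmull // expn_gt0 q0.
have M u v i j : u <= q ^ i -> v <= q ^ j -> i + j <= 10 -> u * v <= X.
  by move=> h1 h2 h3; apply: leq_trans (leq_mul h1 h2) _; rewrite -expnD P.
have nX : n <= X by exact: leq_trans n5 (P 5 isT).
have mX : m <= X := leq_trans (one 1 m) x1.
have AX : MA <= 2 * X := leq_trans (one 2 MA) x2.
have BX : MB <= 2 * X := leq_trans (one 3 MB) x3.
have TA : (KA + 1) * (n + m + 1) <= 6 * X.
  have := M _ _ _ _ a n5 isT; have := leq_trans (leq_mul a (leqnn m)) x1.
  have := leq_trans a (P 1 isT); have := P 0 isT; lia.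
have TB : (KB + 1) * (n + MA + 1) <= 8 * X.
  have := M _ _ _ _ b n5 isT; have := leq_trans (leq_mul b (leqnn MA)) x2.
  have := leq_trans b (P 2 isT); have := P 0 isT; lia.
have Kn : K * n <= q ^ 8 by rewrite (expnD q 3 5) leq_mul.
have TC : K * (n * (q + 2) + MB + 1) <= 6 * X.
  have := leq_trans (leq_mul c (leqnn MB)) x3.
  have := leq_trans c (P 3 isT); have := leq_trans Kn (P 8 isT).
  have := M (K * n) q 8 1 Kn; rewrite expn1 => /(_ (leqnn _) isT); lia.
have TD : n + K * n * q.+1 + 1 <= 4 * X.
  have := leq_trans Kn (P 8 isT); have := P 0 isT; rewrite mulnS.
  have := M (K * n) q 8 1 Kn; rewrite expn1 => /(_ (leqnn _) isT); lia.
have TE : q ^ 2 * (n + MB + 1) <= 4 * X.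
  have := M (q ^ 2) n 2 5 (leqnn _) n5 isT; have := P 2 isT.
  have : q ^ 2 * MB <= q ^ 3 * MB by rewrite leq_mul2r leq_pexp2l ?orbT.
  by rewrite !mulnDr muln1; lia.
have TF : S * (n + MB + 1) <= 36 * (B * X).
  apply: leq_trans (leq_mul s (leqnn _)) _.
  move: (q ^ 2) (n + MB + 1) TE => p Y TE.
  have -> : 9 * p * B * Y = 9 * B * (p * Y) by lia.
  by apply: leq_trans (leq_mul (leqnn _) TE) _; lia.
have TG : (B + 1) * (n + K * n * q.+1 + 1) <= 4 * (B * X + X).
  rewrite -[in X in _ <= 4 * (_ + X)](mul1n X) -mulnDl.
  by rewrite mulnCA leq_mul2l TD orbT.
rewrite (mulnDl S) mul1n.
have -> : (B + 1) * X = B * X + X by rewrite mulnDl mul1n.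
have := P 0 isT.
clear -nX mX AX BX TA TB TC TF TG.
move: (K * (n * _ + _ + _)) (S * _) ((KA + 1) * _) ((KB + 1) * _) ((B + 1) * _) (B * X) TA TB TC TF TG.
by move=> *; lia.
Qed.

(** Edgeless inputs form a separate alternative with constant time: the target bound then contains
    the factor m = 0, and even the search for [q] would exceed it. *)
Lemma main_spec : exists C, forall n es st B, simple n es -> inp n es st ->
  (forall a i, 4 <= a -> st a i = 0) -> n * n < 2 ^ B ->
  wp pMain (fun st' t' => exists P, let es' := filter P es in
    [/\ inp n es' st',
      forall k u v, reach (gr es) k u v -> reach (gr es') (k + 4) u v &
      (size es = 0 /\ t' <= C) \/
      exists q, [/\ q ^ 5 <= 32 * n, size es' <= 20 * (B + 1) * q ^ 7,
        t' <= C * ((B + 1) * (size es * q ^ 3)) &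
        t' <= C * ((B + 1) * q ^ 11)]]) st 0.
Proof.
(* Since [ecost (powE 4)] is 11, the levels cost at most 24000 times their terms and [time_bound]
   contributes a factor 100; the rest is slack. The equation keeps the number opaque. *)
have [C hC] : exists C, C = 3000 * 1000 by eexists.
exists C => n es st B sim hinp st0 hB; have [hn hm he] := hinp.
have allP st' : inp n es st' -> exists2 P, inp n (filter P es) st' & filter P es = es.
  by exists predT; rewrite filter_predT.
have id4 k u v : reach (gr es) k u v -> reach (gr es) (k + 4) u v.
  by apply: reach_le; exact: leq_addr.
have mnn := simple_size sim.
apply: wp_if => /=; norm; rewrite hm => m0.
  apply: wp_skip; have [P hP eP] := allP _ hinp; exists P; rewrite /= eP; split=> //.
  by left; split; [move: m0; case: (size es)|lia].
have {}m0 : 0 < size es by move: m0; case: (size es).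
have n0 : 0 < n by move: mnn m0; case: (n) => //; lia.
apply: wp_seq; apply: (root_spec hn) => // st1 t1 q s1 hq q0 nq qn it1.
have hn1 : st1 aN 0 = n by frame s1.
have hm1 : st1 aM 0 = size es by frame s1.
have hinp1 : inp n es st1 by split=> // e; frame s1; exact: he.
apply: wp_if; rewrite den_op den_powE /= hq hm1; case: ltnP => // mq _; last first.
  apply: wp_skip; have [P hP eP] := allP _ hinp1; exists P; rewrite /= eP; split=> //.
  right; exists q; split=> //.
  - by apply: leq_trans mq _; rewrite leq_pmull // muln_gt0 addn1.
  - have : q <= (B + 1) * (size es * q ^ 3).
      by rewrite addn1 mulSn mulnC; apply: leq_trans (leq_addr _ _); nia.
    rewrite hC; nia.
  - have : q <= (B + 1) * q ^ 11.
      by rewrite addn1 mulSn; apply: leq_trans (leq_addr _ _); rewrite -[q in q <= _]expn1 leq_pexp2l.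
    rewrite hC; nia.
have thrE k st' : st' aQ = st1 aQ -> den st' (powE k) = q ^ k.
  by move=> e; rewrite den_powE e hq.
apply: wp_seq; apply: wp_use.
  by apply: (@level_spec n es (powE 4) (q ^ 4)) => //; [rewrite expn_gt0 q0|exact: thrE].
rewrite alive0; last by move=> e _; frame s1; apply: st0.
move=> st2 t2 s2 [KA hKA [m2 r2 f2 [sz2 sz2'] it2]].
have hinp2 : inp n es st2 by split; [frame s2|frame s2|move=> e; frame s2; frame s1; exact: he].
apply: wp_seq; apply: wp_use.
  apply: (@level_spec n es (powE 3) (q ^ 3)) => //; [by rewrite expn_gt0 q0|].
  by move=> st' e; apply: thrE; rewrite e; frame s2.
move=> st3 t3 s3 [KB hKB [m3 r3 f3 [sz3 sz3'] it3]].
have hinp3 : inp n es st3.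
  by split; [frame s3; frame s2|frame s3; frame s2|move=> e; frame s3; frame s2; frame s1; exact: he].
apply: wp_seq; apply: wp_use.
  apply: (@fine_spec n es q B) => //.
  - by frame s3; frame s2.
  - by move=> i; frame s3; frame s2; frame s1; apply: st0.
  - by move=> i; frame s3; frame s2; frame s1; apply: st0.
  - by move=> i; frame s3; frame s2; frame s1; apply: st0.
  - by frame s3; frame s2; frame s1; apply: st0.
move=> st4 t4 s4 [K [S [hK hS r4 m4 [f4 it4]]]].
have hinp4 : inp n es st4.
  by split; [frame s4; frame s3; frame s2|frame s4; frame s3; frame s2|move=> e; frame s4; frame s3; frame s2; frame s1; exact: he].
apply: wp_use; first exact: filter_spec hinp4.
move=> st5 t5 s5 [hinp5 it5]; exists (marked n (st4 aMark)); split=> //.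
  move=> k u v /r2[/r3[/r4|]|] h; apply: reach_sub (reach_le _ h).
  - exact: reach_filter.
  - by [].
  - by move=> x y /(sp_sub m4)/reach_filter.
  - by lia.
  - by move=> x y /(sp_sub (mle_trans m3 m4))/reach_filter.
  - by lia.
(* Threshold [q ^ i] and [n <= q ^ 5] leave at most [q ^ (5 - i)] centres. *)
have lec K' i j : K' * q ^ i <= n -> i + j = 5 -> K' <= q ^ j.
  move=> h e; rewrite -(@leq_pmul2r (q ^ i)) ?expn_gt0 ?q0 //.
  by apply: leq_trans h _; apply: leq_trans nq _; rewrite -expnD addnC e.
have a := lec KA 4 1 hKA erefl; have b := lec KB 3 2 hKB erefl.
have c : K <= q ^ 3 by apply: (lec K 2 3) => //; rewrite expnS expn1.
have s : S <= 9 * q ^ 2 * B.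
  rewrite -(@leq_pmul2r q) //; apply: (@leq_trans (S * q.+1)); first by rewrite leq_mul2l leqnSn orbT.
  apply: leq_trans hS _; have -> : 9 * q ^ 2 * B * q = 9 * q ^ 3 * B by rewrite (expnS q 2); lia.
  by rewrite leq_mul2r leq_mul2l c !orbT.
have T X : q ^ 1 * size es <= X -> q ^ 2 * size (alive es (st2 aDead)) <= 2 * X ->
    q ^ 3 * size (alive es (st3 aDead)) <= 2 * X -> q ^ 10 <= X -> t5 <= C * ((B + 1) * X).
  move=> x1 x2 x3 x4; have := time_bound q0 nq a b c s x1 x2 x3 x4.
  have q1 : q <= X by apply: leq_trans x4; rewrite -[q in q <= _]expn1 leq_pexp2l.
  have mX : size es <= X by apply: leq_trans x1; rewrite expn1 leq_pmull.
  have XB : X <= (B + 1) * X by rewrite leq_pmull // addn1.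
  move: it2 it3 it4; rewrite /= => it2 it3 it4.
  move: (n + size es + _ * (n + size es + 1)) it2 => Y2 it2.
  move: (n + size es + _ * (n + _ + 1)) it3 => Y3 it3.
  move: (n + size es + 1 + _ + _ + _) it4 => Y4 it4.
  move: ((B + 1) * X) XB => Z XB.
  rewrite hC; clear -it1 it2 it3 it4 it5 q1 mX XB q0; lia.
right; exists q; split=> //.
- have few0 : few (st1 aMark) 0 by exists [::] => // i; frame s1; rewrite st0.
  apply: leq_trans (size_marked sim (f4 _ (f3 _ (f2 _ few0)))) _.
  have P i : i <= 7 -> q ^ i <= q ^ 7 by move=> h; rewrite leq_pexp2l.
  have M u v i j : u <= q ^ i -> v <= q ^ j -> i + j <= 7 -> u * v <= q ^ 7.
    by move=> h1 h2 h3; apply: leq_trans (leq_mul h1 h2) _; rewrite -expnD P.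
  have y1 := M _ _ _ _ nq a isT; have y2 := M _ _ _ _ nq b isT.
  have y3 : n * (q * q) <= q ^ 7 by apply: (M _ _ 5 2).
  have y4 : K * (K * q) <= q ^ 7 by rewrite mulnA; apply: (M _ _ 6 1) => //; rewrite (expnD q 3 3) leq_mul.
  have y5 : n * S <= 9 * (B * q ^ 7).
    apply: leq_trans (leq_mul nq s) _; rewrite (expnD q 5 2); lia.
  have y6 := leq_trans nq (P 5 isT).
  have -> : 20 * (B + 1) * q ^ 7 = 20 * (B * q ^ 7) + 20 * q ^ 7 by lia.
  move: (q ^ 7) (B * _) (n * KA) (n * KB) (n * (q * q)) (K * (K * q)) (n * S) y1 y2 y3 y4 y5 y6.
  clear; move=> *; lia.
(* Case [X = size es * q ^ 3]: surviving edges are bounded by all edges, and [q ^ 10 <= X] is what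
   [q ^ 7 < size es] provides. *)
- apply: T.
  + by rewrite mulnC leq_mul2l leq_pexp2l ?orbT.
  + apply: (@leq_trans (q ^ 3 * size es)); last by lia.
    by apply: leq_mul; rewrite ?leq_pexp2l.
  + apply: (@leq_trans (q ^ 3 * size es)); last by lia.
    by rewrite leq_mul2l (leq_trans sz3' sz2') orbT.
  + by rewrite (expnD q 7 3) leq_mul2r ltnW ?orbT.
(* Case [X = q ^ 11]: now the clustering bounds on the surviving edges are used, 2 * q^9 and 2 *
   q^8, together with [size es <= n * n]. *)
have W k l N : N <= n * q ^ k + n -> 5 + k <= l -> N <= 2 * q ^ l.
  move=> h e; apply: leq_trans h _; rewrite mul2n -addnn; apply: leq_add.
    by apply: leq_trans (leq_mul nq (leqnn _)) _; rewrite -expnD leq_pexp2l.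
  by apply: leq_trans nq _; rewrite leq_pexp2l //; lia.
apply: T.
- rewrite (expnD q 1 10) leq_mul2l; apply/orP; right; apply: leq_trans mnn _.
  by rewrite (expnD q 5 5) leq_mul.
- rewrite (expnD q 2 9) mulnCA leq_mul2l; apply/orP; right; exact: W sz2 _.
- rewrite (expnD q 3 8) mulnCA leq_mul2l; apply/orP; right; exact: W sz3 _.
- by rewrite leq_pexp2l.
Qed.

(** * Transfer to the word RAM and to real exponents *)

From mathcomp Require Import all_order all_algebra.
From mathcomp Require Import boolp classical_sets reals constructive_ereal ereal exp.

Import Order.TTheory GRing.Theory Num.Theory.

Definition nat_edges n (s : seq ('I_n * 'I_n)) : seq (nat * nat) :=
  [seq (val p.1, val p.2) | p <- s].

Lemma set2_eq (T : finType) (a b c d : T) :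
  [set a; b]%SET = [set c; d]%SET -> (a = c /\ b = d) \/ (a = d /\ b = c).
Proof.
move=> e; have m x : (x == a) || (x == b) = (x == c) || (x == d).
  by have := congr1 (fun S : {set T} => x \in S) e; rewrite /= !inE.
have := m a; rewrite eqxx => /esym/orP[]/eqP ac.
  subst c; left; split=> //; have := m b; rewrite eqxx orbT => /esym/orP[]/eqP // ba.
  by subst b; have := m d; rewrite eqxx orbT orbb => /eqP.
subst d; right; split=> //; have := m b; rewrite eqxx orbT => /esym/orP[]/eqP // ba.
by subst b; have := m c; rewrite eqxx orbb => /eqP.
Qed.

Lemma adj_gr n (E : {set {set 'I_n}}) s u v : edge_list E s ->
  adj E u v = gr (nat_edges s) (val u) (val v).
Proof.
move=> hs; have -> : adj E u v = ([set u; v]%SET \in [seq [set p.1; p.2]%SET | p <- s]).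
  by rewrite (perm_mem hs) mem_enum.
apply/mapP/orP => [[[a b] hab /= /set2_eq[[-> ->]|[-> ->]]]|].
- by left; apply/mapP; exists (a, b).
- by right; apply/mapP; exists (a, b).
by case=> /mapP[[a b] hab /= [/val_inj -> /val_inj ->]]; exists (a, b) => //; rewrite finset.setUC.
Qed.

Lemma simple_nat_edges n (E : {set {set 'I_n}}) s :
  is_graph E -> edge_list E s -> simple n (nat_edges s).
Proof.
move=> hE hs; split.
  move=> e /mapP[[a b] hab ->] /=; split; [exact: ltn_ord|exact: ltn_ord|].
  have : [set a; b]%SET \in E.
    by rewrite -mem_enum -(perm_mem hs); apply/mapP; exists (a, b).
  move=> /hE; rewrite cards2 -val_eqE.
  by case: (_ == _).
(* Turning normalised pairs back into vertex sets reduces duplicate-freeness to that of the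
   enumeration of [E]. *)
pose F (e : nat * nat) := [set i : 'I_n | (val i == e.1) || (val i == e.2)]%SET.
apply: (@map_uniq _ _ F); rewrite -!map_comp.
rewrite (@eq_map _ _ _ (fun p : 'I_n * 'I_n => [set p.1; p.2]%SET)).
  by rewrite (perm_uniq hs) enum_uniq.
move=> [a b]; apply/setP => i; rewrite !inE /= -!val_eqE /= /minn /maxn.
by case: ltnP => //=; rewrite orbC.
Qed.

Lemma nat_edges_nth n (s : seq ('I_n * 'I_n)) i :
  nth (0, 0) (nat_edges s) i = (nth 0 [seq val p.1 | p <- s] i, nth 0 [seq val p.2 | p <- s] i).
Proof. by elim: s i => [|p s IH] [|i] //=. Qed.

Lemma inp_input n (s : seq ('I_n * 'I_n)) : inp n (nat_edges s) (input s).
Proof.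
split=> [||e _]; rewrite ?nat_edges_nth //.
by rewrite size_map.
Qed.

Lemma inp_outputs n (s : seq ('I_n * 'I_n)) st : inp n (nat_edges s) st -> outputs st s.
Proof.
move=> [_ h1 h2]; rewrite size_map in h1 h2; split=> // i /h2.
by rewrite nat_edges_nth => -[].
Qed.

Lemma edge_list_filter n (E : {set {set 'I_n}}) s (P : pred ('I_n * 'I_n)) : edge_list E s ->
  exists E' : {set {set 'I_n}}, edge_list E' [seq p <- s | P p] /\ E' \subset E.
Proof.
move=> hs; exists [set e in [seq [set p.1; p.2]%SET | p <- [seq p <- s | P p]]]%SET; split.
  apply: uniq_perm; rewrite ?enum_uniq //.
    apply: (subseq_uniq (map_subseq _ (filter_subseq _ _))).
    by rewrite (perm_uniq hs) enum_uniq.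
  by move=> e; rewrite mem_enum inE.
apply/fintype.subsetP => e; rewrite inE => /mapP[p]; rewrite mem_filter => /andP[_ hp] ->.
by rewrite -mem_enum -(perm_mem hs); apply/mapP; exists p.
Qed.

Lemma edge_list_card n (E : {set {set 'I_n}}) s : edge_list E s -> #|E| = size (nat_edges s).
Proof. by move=> hs; rewrite cardE -(perm_size hs) !size_map. Qed.

Lemma path_reach n (E : {set {set 'I_n}}) s u p : edge_list E s ->
  path (adj E) u p -> reach (gr (nat_edges s)) (size p) (val u) (val (last u p)).
Proof.
move=> hs hp; exists (map val p); rewrite last_map size_map; split=> //.
rewrite path_map; apply: sub_path hp => x y; by rewrite (adj_gr _ _ hs).
Qed.

Lemma reach_path n (E : {set {set 'I_n}}) s k (u v : 'I_n) :
  simple n (nat_edges s) -> edge_list E s -> reach (gr (nat_edges s)) k (val u) (val v) ->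
  exists p, [/\ path (adj E) u p, last u p = v & size p <= k].
Proof.
move=> sim hs [p []]; elim: p k u => [|x p IH] k u /=.
  by move=> _ /val_inj <- _; exists [::].
move=> /andP[g h1] h2; case: k => // k h3.
have [_ xn _] := gr_lt sim g.
have [q [q1 q2 q3]] := IH k (Ordinal xn) h1 h2 h3.
by exists (Ordinal xn :: q); split=> //=; rewrite (adj_gr _ _ hs) g.
Qed.

(** Moving the 4 to the left leaves a lower bound for an infimum, checked walk by walk; if no walk
    exists, there is nothing to check. *)
Lemma spanner_of_reach (R : realType) n (E E' : {set {set 'I_n}}) s s' :
  edge_list E s -> edge_list E' s' -> simple n (nat_edges s') ->
  E' \subset E ->
  (forall k u v, reach (gr (nat_edges s)) k u v -> reach (gr (nat_edges s')) (k + 4) u v) ->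
  additive_spanner R 4 E E'.
Proof.
move=> hs hs' sim' sub h; split=> // u v.
rewrite -leeBlDr //; apply: le_ereal_inf_tmp => _ [p [hp <- ->]].
have [q [q1 q2 q3]] := reach_path sim' hs' (h _ _ _ (path_reach hs hp)).
rewrite leeBlDr // -EFinD -natrD; apply: (@le_trans _ _ ((size q)%:R%:E)%R).
  by apply: ereal_inf_lbound; exists q.
by rewrite lee_fin ler_nat.
Qed.

(** * Real exponents, logarithms and word length *)

Local Open Scope ring_scope.

Lemma powR_fifth (R : realType) (n j : nat) :
  n%:R `^ (j%:R / 5) = (n%:R `^ (1 / 5)) ^+ j :> R.
Proof. by rewrite -powR_mulrn ?powR_ge0 // -powRrM; congr (_ `^ _); rewrite div1r mulrC. Qed.

Lemma root_powR (R : realType) (n q : nat) : (q ^ 5 <= 32 * n)%N ->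
  q%:R <= 2 * n%:R `^ (1 / 5) :> R.
Proof.
move=> h; rewrite -(@ler_pXn2r _ 5) ?nnegrE ?mulr_ge0 ?powR_ge0 //.
rewrite exprMn -powR_fifth divff ?pnatr_eq0 // powRr1 // -!natrX -natrM ler_nat.
exact: h.
Qed.

(** The slack [j <= i] lets the exponents 3 and 11 share the constant 2^11. *)
Lemma root_powRX (R : realType) (n q j i : nat) : (q ^ 5 <= 32 * n)%N -> (j <= i)%N ->
  (q ^ j)%:R <= (2 ^ i)%:R * n%:R `^ (j%:R / 5) :> R.
Proof.
move=> h ji; rewrite powR_fifth natrX.
apply: le_trans (_ : (2 * n%:R `^ (1 / 5)) ^+ j <= _).
  by apply: lerXn2r; rewrite ?nnegrE ?mulr_ge0 ?powR_ge0 ?root_powR.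
rewrite exprMn ler_wpM2r ?exprn_ge0 ?powR_ge0 // -natrX ler_nat.
exact: leq_pexp2l.
Qed.

Lemma le_max_min (R : realType) (t G G' : nat) (a b : R) : (G <= G')%N ->
  0 <= a -> 0 <= b -> t%:R <= G%:R * a -> t%:R <= G%:R * b ->
  t%:R <= G'%:R * Num.max 1 (Num.min a b).
Proof.
move=> GG a0 b0 ta tb; apply: (@le_trans _ _ (G%:R * Num.min a b)).
  by rewrite /Num.min; case: ifP.
apply: ler_pM; rewrite ?ler_nat ?le_max ?lexx ?orbT //.
by rewrite le_min a0.
Qed.

Lemma lg_gt0 n : (0 < lg n)%N.
Proof. by rewrite /lg trunc_log_gt0. Qed.

(** The logarithm is rounded down, so [lg n + 1] bits are needed; as [lg n] is positive, doubling it
    covers the extra one. *)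
Lemma lg_ltn n : (n.+2 < 2 ^ (2 * lg n))%N.
Proof.
have := trunc_log_ltn n.+2 (ltnSn 1); rewrite -/(lg n) => h.
apply: leq_trans h _; rewrite leq_pexp2l //; have := lg_gt0 n; lia.
Qed.

Lemma lg_le n : (lg n <= n.+2)%N.
Proof.
apply: leq_trans (ltnW (ltn_expl _ (ltnSn 1))) _; exact: trunc_logP.
Qed.

Lemma input_bounded n (E : {set {set 'I_n}}) s :
  is_graph E -> edge_list E s -> bounded (n + n * n) (input s).
Proof.
move=> hE hs.
have sz : (size s <= n * n)%N.
  by have := simple_size (simple_nat_edges hE hs); rewrite size_map.
have b (f : 'I_n * 'I_n -> 'I_n) i : (nth 0 [seq val (f p) | p <- s] i <= n)%N.
  elim: s {hs sz} i => [|p s IH] [|i] //=; exact: ltnW.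
move=> [|[|[|[|a]]]] [|i] //=.
- by rewrite leq_addr.
- exact: leq_trans sz (leq_addl _ _).
all: exact: leq_trans (b _ _) (leq_addr _ _).
Qed.

Lemma run_main : exists k C : nat, forall n (E : {set {set 'I_n}}) s,
  is_graph E -> edge_list E s ->
  let es := nat_edges s in
  exists st t P, let es' := [seq e <- es | P e] in
    [/\ exec (k * lg n) pMain (input s) st t, inp n es' st,
      forall k u v, reach (gr es) k u v -> reach (gr es') (k + 4) u v &
      (size es = 0%N /\ (t <= C)%N) \/
      exists q, [/\ (q ^ 5 <= 32 * n)%N, (size es' <= 100 * lg n * q ^ 7)%N,
        (t <= C * lg n * (size es * q ^ 3))%N &
        (t <= C * lg n * q ^ 11)%N]].
Proof.
have [C hC] := main_spec.
(* Checked by computation: 2 bounds the constants and the growth of assigned values, 100 the degree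
   of every expression. *)
have tm : tame 2 100 pMain by vm_compute.
(* With A the sum of the first three terms in the inner bracket, contents and constants during the
   run stay below A * (n + 2)^4 < (n + 2)^(A + 5). Expressions have degree at most 100, and n + 2 <
   2^(2 * lg n) gives the outer factor 2. *)
exists (2 * ((C * 5 * 32 ^ 3 * 2 + C * 10 + 10 + 5) * 100))%N, (C * 5)%N => n E s hE hs es.
have lg0 := lg_gt0 n; have lgn := lg_le n.
have sim := simple_nat_edges hE hs.
pose B := (2 * (2 * lg n))%N.
have hB : (n * n < 2 ^ B)%N.
  rewrite /B mul2n -addnn expnD; have := lg_ltn n; nia.
have B5 : (B + 1 <= 5 * lg n)%N by rewrite /B; lia.
have z a i : (4 <= a)%N -> input s a i = 0%N by case: a => [|[|[|[|a]]]].
have [st [t [run [P [hi hr ht]]]]] := hC n es (input s) B sim (inp_input s) z hB.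
rewrite add0n in ht.
have ht' : (size es = 0%N /\ (t <= C * 5)%N) \/
      exists q, [/\ (q ^ 5 <= 32 * n)%N, (size [seq e <- es | P e] <= 100 * lg n * q ^ 7)%N,
        (t <= C * 5 * lg n * (size es * q ^ 3))%N &
        (t <= C * 5 * lg n * q ^ 11)%N].
  case: ht => [[h0 h]|[q [h1 h2 h3 h4]]]; [by left; split=> //; lia|right; exists q; split=> //].
  - apply: leq_trans h2 _; rewrite leq_mul2r; apply/orP; right; lia.
  - apply: leq_trans h3 _; rewrite mulnA leq_mul2r; apply/orP; right.
    by rewrite -mulnA leq_mul2l B5 orbT.
  - apply: leq_trans h4 _; rewrite mulnA leq_mul2r; apply/orP; right.
    by rewrite -mulnA leq_mul2l B5 orbT.
exists st, t, P; split=> //.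
(* A crude polynomial bound suffices for the word length: q^11 <= (q^5)^3 <= (32 * (n + 2))^3, and
   the logarithm is at most n + 2. *)
have tle : (t <= (C * 5 * 32 ^ 3 + C * 5) * n.+2 ^ 4)%N.
  case: ht' => [[_ h]|[q [h1 _ _ h]]].
    apply: leq_trans h _; rewrite mulnDl; apply: leq_trans (leq_addl _ _).
    by rewrite leq_pmulr // expn_gt0.
  apply: leq_trans h _; rewrite mulnDl; apply: leq_trans (leq_addr _ _).
  rewrite -(mulnA (C * 5)%N (lg n)) -(mulnA (C * 5)%N (32 ^ 3)%N) leq_mul2l; apply/orP; right.
  have -> : (32 ^ 3 * n.+2 ^ 4 = n.+2 * (32 * n.+2) ^ 3)%N by rewrite expnMn expnS mulnCA.
  apply: leq_mul lgn _; case: q h1 => // q h1.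
  apply: (@leq_trans ((q.+1 ^ 5) ^ 3)); first by rewrite -expnM leq_pexp2l.
  by apply: leq_expn2; apply: leq_trans h1 _; rewrite leq_mul2l; apply/orP; right; lia.
have [] := @big_exec (2 * ((C * 5 * 32 ^ 3 * 2 + C * 10 + 10 + 5) * 100) * lg n)%N 2 100
  _ _ _ _ (n + n * n + 2)%N run tm.
- by apply: bounded_le (input_bounded hE hs); exact: leq_addr.
- exact: leq_addl.
- set A := (C * 5 * 32 ^ 3 * 2 + C * 10 + 10)%N.
  have le4 : ((n + n * n + 2 + 2 * t).+2 <= A * n.+2 ^ 4)%N.
    have e : (n + n * n + 2 + 2 <= 10 * n.+2 ^ 4)%N.
      have : (n.+2 * n.+2 <= n.+2 ^ 4)%N by rewrite -[(_ * _)%N]/(n.+2 ^ 2)%N leq_pexp2l.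
      lia.
    rewrite /A; move: (n.+2 ^ 4)%N e tle => Y e tle; move: (32 ^ 3)%N tle => D tle; lia.
  have leA : (A * n.+2 ^ 4 < n.+2 ^ (A + 5))%N.
    have -> : (A + 5 = 1 + (A + 4))%N by lia.
    rewrite (expnD _ 1) (expnD _ A) expn1.
    have : (A < n.+2 ^ A)%N by apply: ltn_expl.
    have : (0 < n.+2 ^ 4)%N by rewrite expn_gt0.
    move: (n.+2 ^ 4)%N (n.+2 ^ A)%N => Y Z; nia.
  apply: (@leq_ltn_trans ((n.+2 ^ (A + 5)) ^ 100)).
    by apply: leq_expn2; apply: leq_trans le4 (ltnW leA).
  rewrite -expnM (mulnAC 2 ((A + 5) * 100)%N) (expnM 2) ltn_exp2r; last by rewrite muln_gt0 addnS.
  exact: lg_ltn.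
by [].
Qed.

Theorem theorem1 (R : realType) :
  exists (P : cmd) (k C d : nat),
    forall (n : nat) (E : {set {set 'I_n}}) (s : seq ('I_n * 'I_n)),
      is_graph E -> edge_list E s ->
      exists (st : store) (t : nat) (E' : {set {set 'I_n}})
             (s' : seq ('I_n * 'I_n)),
        [/\ exec (k * lg n)%N P (input s) st t,
            outputs st s' /\ edge_list E' s',
            additive_spanner R 4 E E',
            #|E'|%:R <= (C * lg n ^ d)%N%:R * n%:R `^ (7 / 5) :> R
          & t%:R <= (C * lg n ^ d)%N%:R *
              Num.max 1 (Num.min (#|E|%:R * n%:R `^ (3 / 5))
                                 (n%:R `^ (11 / 5))) :> R].
Proof.
have [k [C run]] := run_main.
(* A single logarithm suffices for both size and time. The factors 2^11 and 2^7 come from q <= 2 *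
   n^(1/5), raised to the powers in the time and size bounds. *)
exists pMain, k, (C * 2 ^ 11 + 100 * 2 ^ 7)%N, 1%N => n E s hE hs.
have [st [t [P [hx hi hr ht]]]] := run n E s hE hs.
have fE : [seq e <- nat_edges s | P e] =
    nat_edges [seq p <- s | P (val p.1, val p.2)] by rewrite /nat_edges filter_map.
have [E' [hs' sub]] := edge_list_filter (fun p => P (val p.1, val p.2)) hs.
rewrite fE in hi hr ht.
exists st, t, E', [seq p <- s | P (val p.1, val p.2)]; split=> //.
- by split=> //; exact: inp_outputs hi.
- have sim' : simple n (nat_edges [seq p <- s | P (val p.1, val p.2)]).
    by rewrite -fE; apply: simple_filter; exact: simple_nat_edges hE hs.
  exact: spanner_of_reach hs hs' sim' sub hr.
- rewrite (edge_list_card hs') expn1; case: ht => [[s0 _]|[q [h1 h2 _ _]]].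
    have -> : size (nat_edges [seq p <- s | P (val p.1, val p.2)]) = 0%N.
      apply/eqP; rewrite -leqn0 -s0 -fE size_filter; exact: count_size.
    by rewrite mulr_ge0 // powR_ge0.
  apply: (@le_trans _ _ (100 * lg n * q ^ 7)%N%:R); first by rewrite ler_nat.
  rewrite natrM; apply: le_trans (ler_wpM2l (ler0n _ _) (root_powRX R h1 (leqnn 7))) _.
  rewrite mulrA -natrM ler_wpM2r ?powR_ge0 // ler_nat.
  by rewrite mulnAC leq_mul2r leq_addl orbT.
- rewrite (edge_list_card hs) expn1.
  have lg0 := lg_gt0 n.
  have GG : (C * lg n * 2 ^ 11 <= (C * 2 ^ 11 + 100 * 2 ^ 7) * lg n)%N.
    by rewrite mulnAC leq_mul2r leq_addr orbT.
  (* Without edges the minimum is 0, and the constant running time is absorbed by the 1 in the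
     maximum. *)
  case: ht => [[s0 tC]|[q [h1 _ h3 h4]]].
    apply: (@le_trans _ _ ((C * 2 ^ 11 + 100 * 2 ^ 7) * lg n)%N%:R).
      rewrite ler_nat; apply: leq_trans tC _; apply: leq_trans GG.
      by rewrite -mulnA leq_pmulr // muln_gt0 lg0 expn_gt0.
    by rewrite ler_peMr // le_max lexx.
  apply: (le_max_min GG); rewrite ?mulr_ge0 ?powR_ge0 //.
    apply: (@le_trans _ _ (C * lg n * (size (nat_edges s) * q ^ 3))%N%:R); first by rewrite ler_nat.
    rewrite !(natrM _ (C * lg n)) -mulrA ler_wpM2l // natrM mulrCA ler_wpM2l //.
    exact: root_powRX.
  apply: (@le_trans _ _ (C * lg n * q ^ 11)%N%:R); first by rewrite ler_nat.
  rewrite !(natrM _ (C * lg n)) -mulrA ler_wpM2l //.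
  exact: root_powRX.
Qed.
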